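(* Let $r,s\ge2$ and let $F:U\to\mathbb P^{r',s',t'}$ be a local orthogonal map, where $U\subset\mathbb P^{r,s,t}$ is a connected open set containing a null point. If $\min\{r',s'\}\le\min\{r,s\}$, then $F$ is either null or quasi-linear (and, when $t'=0$, either null or linear). If in addition $F$ maps at least one positive point to a positive point, or at least one negative point to a negative point, then $F$ is quasi-standard (standard when $t'=0$).
   Context: Let $r,s,t\ge 0$ be integers with $n=r+s+t>0$. $\mathbb C^{r,s,t}$ denotes $\mathbb C^n$ equipped with the (possibly degenerate, indefinite) Hermitian form $\langle z,w\rangle_{r,s,t}=\sum_{j=1}^{r}z_j\bar w_j-\sum_{j=r+1}^{r+s}z_j\bar w_j$, and $\mathbb P^{r,s,t}$ is its projectivization. A point $[z]$ is positive, negative or null according as $\langle z,z\rangle_{r,s,t}>0$, $<0$ or $=0$; $[z]\perp[w]$ if $\langle z,w\rangle_{r,s,t}=0$. A complex linear subspace $H$ (or $\mathbb PH$) is a null space if the form vanishes identically on $H$. Let $U\subset\mathbb P^{r,s,t}$ be a connected open set containing a null point. A holomorphic map $F:U\to\mathbb P^{r',s',t'}$ is a local orthogonal map if $F(p)\perp F(q)$ for all $p,q\in U$ with $p\perp q$. $F$ is linear if it extends to a rational map induced by a linear map $\mathbb C^{r+s+t}\to\mathbb C^{r'+s'+t'}$; standard if it is induced by a linear isometry $\mathbb C^{r,s,t}\to\mathbb C^{r',s',t'}$ (a linear map $L$ with $\langle Lu,Lv\rangle_{r',s',t'}=\langle u,v\rangle_{r,s,t}$); null if $F(U)$ is contained in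 a null space. $F$ is quasi-standard (resp. quasi-linear) if either $F$ is standard (resp. linear), or there is a decomposition $\mathbb C^{r',s',t'}=A\oplus B$ into nonzero subspaces with $\langle a,b\rangle_{r',s',t'}=0$ for all $a\in A,b\in B$ such that $\pi_A\circ F$ is standard (resp. linear) and $\pi_B\circ F$ is null, where $\pi_A:\mathbb P^{r',s',t'}\dashrightarrow\mathbb PA$, $\pi_B:\mathbb P^{r',s',t'}\dashrightarrow\mathbb PB$ are induced by the linear projections, and $\mathbb PA,\mathbb PB$ carry the restricted forms. *)

(* Defs.v *)
From HB Require Import structures.
From mathcomp Require Import all_boot all_order all_algebra.
From mathcomp Require Import all_classical all_reals all_analysis.
From mathcomp Require Import complex.
Import numFieldNormedType.Exports.

Set Implicit Arguments.
Unset Strict Implicit.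
Unset Printing Implicit Defensive.

Import Order.TTheory GRing.Theory Num.Theory.
Local Open Scope ring_scope.
Local Open Scope classical_set_scope.

Definition cvec (R : realType) (n : nat) : normedModType R[i] := 'rV[R[i]]_n.

Definition herm (R : realType) (r s t : nat) (z w : 'rV[R[i]]_(r + s + t)) : R[i] :=
  \sum_(j < r + s + t)
     (if (j < r)%N then 1 else if (j < r + s)%N then -1 else 0) * z ord0 j * (w ord0 j)^*.

Definition same_point (R : realType) (m : nat) (v w : 'rV[R[i]]_m) : Prop :=
  exists mu : R[i], mu != 0 /\ v = mu *: w.

(* U is (the cone over) a connected open subset of P^{r,s,t} containing a null point:
   U is an open, connected subset of C^n \ {0} stable under C^*, with some
   z in U satisfying <z,z> = 0. *)
Definition proj_domain (R : realType) (r s t : nat) (U : set 'rV[R[i]]_(r + s + t)) : Prop :=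
  [/\ @open (cvec R (r + s + t)) U,
      @connected (cvec R (r + s + t)) U,
      ~ U 0,
      (forall z (lam : R[i]), U z -> lam != 0 -> U (lam *: z))
    & exists z, U z /\ herm z z = 0].

(* F : U -> P^{m} given by representatives: F z is a nonzero vector representing
   the image of [z]; well defined on projective points; and holomorphic, i.e.
   locally it has a nowhere vanishing holomorphic lift G. *)
Definition holo_proj_map (R : realType) (n m : nat)
    (U : set 'rV[R[i]]_n) (F : 'rV[R[i]]_n -> 'rV[R[i]]_m) : Prop :=
  [/\ (forall z, U z -> F z != 0),
      (forall z (lam : R[i]), U z -> lam != 0 -> same_point (F (lam *: z)) (F z))
    & (forall z, U z -> exists (V : set 'rV[R[i]]_n) (G : 'rV[R[i]]_n -> 'rV[R[i]]_m),
          [/\ @open (cvec R n) V, V z, V `<=` U,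
              (forall w, V w -> differentiable (G : cvec R n -> cvec R m) (w : cvec R n))
            & (forall w, V w -> G w != 0 /\ same_point (F w) (G w))])].

Definition local_orthogonal (R : realType) (r s t r' s' t' : nat)
    (U : set 'rV[R[i]]_(r + s + t)) (F : 'rV[R[i]]_(r + s + t) -> 'rV[R[i]]_(r' + s' + t')) :=
  forall p q, U p -> U q -> herm p q = 0 -> herm (F p) (F q) = 0.

Definition null_space (R : realType) (r' s' t' : nat)
    (H : 'M[R[i]]_(r' + s' + t')) : Prop :=
  forall a b : 'rV[R[i]]_(r' + s' + t'),
    (a <= H)%MS -> (b <= H)%MS -> herm a b = 0.

Definition isometry_mx (R : realType) (r s t r' s' t' : nat)
    (L : 'M[R[i]]_(r + s + t, r' + s' + t')) : Prop :=
  forall u v, herm (u *m L) (v *m L) = herm u v.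

(* The (rational) map P, defined at z in U when P z != 0, taking values in the
   projectivization of the subspace A, is linear: it is induced by a linear map
   L (with image in A, not vanishing identically on U), agreeing with P wherever
   both are defined. *)
Definition linear_into (R : realType) (n m : nat) (U : set 'rV[R[i]]_n)
    (P : 'rV[R[i]]_n -> 'rV[R[i]]_m) (A : 'M[R[i]]_m) (L : 'M[R[i]]_(n, m)) : Prop :=
  [/\ (L <= A)%MS,
      (exists z, U z /\ z *m L != 0)
    & (forall z, U z -> z *m L != 0 -> P z != 0 -> same_point (P z) (z *m L))].

Definition null_into (R : realType) (r' s' t' n : nat) (U : set 'rV[R[i]]_n)
    (P : 'rV[R[i]]_n -> 'rV[R[i]]_(r' + s' + t')) (B : 'M[R[i]]_(r' + s' + t')) : Prop :=
  exists H : 'M[R[i]]_(r' + s' + t'),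
    [/\ (H <= B)%MS, null_space H & forall z, U z -> (P z <= H)%MS].

Definition is_linear (R : realType) (r s t r' s' t' : nat)
    (U : set 'rV[R[i]]_(r + s + t)) (F : 'rV[R[i]]_(r + s + t) -> 'rV[R[i]]_(r' + s' + t')) :=
  exists L, linear_into U F 1%:M L.

Definition is_standard (R : realType) (r s t r' s' t' : nat)
    (U : set 'rV[R[i]]_(r + s + t)) (F : 'rV[R[i]]_(r + s + t) -> 'rV[R[i]]_(r' + s' + t')) :=
  exists L, linear_into U F 1%:M L /\ isometry_mx L.

Definition is_null (R : realType) (r s t r' s' t' : nat)
    (U : set 'rV[R[i]]_(r + s + t)) (F : 'rV[R[i]]_(r + s + t) -> 'rV[R[i]]_(r' + s' + t')) :=
  null_into U F 1%:M.

Definition orth_decomp (R : realType) (r' s' t' : nat) (A B : 'M[R[i]]_(r' + s' + t')) :=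
  [/\ A != 0, B != 0, ((A + B)%MS == 1%:M)%MS, ((A :&: B)%MS == (0 : 'M[R[i]]_(r' + s' + t')))%MS
    & forall a b : 'rV[R[i]]_(r' + s' + t'), (a <= A)%MS -> (b <= B)%MS -> herm a b = 0].

Definition is_quasi_linear (R : realType) (r s t r' s' t' : nat)
    (U : set 'rV[R[i]]_(r + s + t)) (F : 'rV[R[i]]_(r + s + t) -> 'rV[R[i]]_(r' + s' + t')) :=
  is_linear U F \/
  exists A B : 'M[R[i]]_(r' + s' + t'),
    [/\ orth_decomp A B,
        (exists z, U z /\ F z *m proj_mx A B != 0),
        (exists z, U z /\ F z *m proj_mx B A != 0),
        (exists L, linear_into U (fun z => F z *m proj_mx A B) A L)
      & null_into U (fun z => F z *m proj_mx B A) B].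

Definition is_quasi_standard (R : realType) (r s t r' s' t' : nat)
    (U : set 'rV[R[i]]_(r + s + t)) (F : 'rV[R[i]]_(r + s + t) -> 'rV[R[i]]_(r' + s' + t')) :=
  is_standard U F \/
  exists A B : 'M[R[i]]_(r' + s' + t'),
    [/\ orth_decomp A B,
        (exists z, U z /\ F z *m proj_mx A B != 0),
        (exists z, U z /\ F z *m proj_mx B A != 0),
        (exists L, linear_into U (fun z => F z *m proj_mx A B) A L /\ isometry_mx L)
      & null_into U (fun z => F z *m proj_mx B A) B].

(* Main.v *)
(* Let G be a local holomorphic lift of F near a null point, and consider the kernel
   K(z,w) = <Gz,Gw>', which vanishes whenever <z,w> = 0. Put p = min(r,s) >= 2. As
   min(r',s') <= p, the images of points of an isotropic p-space lie in a space on which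
   <.,.>' has functionals of rank at most p.

   If x is orthogonal to u, then <Gx, dG_u v>' = <x,v> h(x,u). If h does not vanish
   identically, these functionals exhaust the p available dimensions on an isotropic
   p-space, which forces K(x,w) = l_w(x) h(x,u) with l_w proportional to <.,w>. Comparing
   isotropic p-spaces that share a vector shows that K/<.,.> has rank one, so that
   <g z, g w>' = eps <z,w> with eps = 1 or -1 for a rescaled lift g. If h vanishes
   identically, a flag of vectors x_1, ..., x_p in an isotropic p-space and a Wronskian
   argument on the line x_1 x_2 show that K = 0.

   In the first case a basis of points yields a linear L with g z = z L + nu z, where the
   values of nu are isotropic, mutually orthogonal, and orthogonal to the image of L. In
   the second case F is null. Both conclusions are analytic conditions on F, hence extend
   to the connected domain U. If t' = 0, a nonzero value of nu would give an isotropic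
   space of dimension p + 1. A positive point mapped to a positive point forces eps = 1.

   Only complex differentiability along lines is available, so the identity theorem is
   obtained from Goursat's theorem and the Cauchy estimate on squares. *)
Require Import Defs.
From HB Require Import structures.
From mathcomp Require Import all_boot all_order all_algebra.
From mathcomp Require Import all_classical all_reals all_analysis.
From mathcomp Require Import complex.
From mathcomp Require Import ring lra zify.
Import numFieldNormedType.Exports.
Import Order.TTheory GRing.Theory Num.Theory.

Set Implicit Arguments.
Unset Strict Implicit.
Unset Printing Implicit Defensive.

Local Open Scope ring_scope.
Local Open Scope classical_set_scope.

(** Three obstacles shape the argument. The kernel is holomorphic in its first slot and
    antiholomorphic in the second, so orthogonal pairs are differentiated with a conjugated second
    parameter, and zeros in [w] are propagated through conjugates. Isotropic subspaces contain only
    null vectors, and null points do not form an open set: to reach the other points, a function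
    vanishing on a real segment is glued with 0 across it. Both forms may be degenerate, so ranks
    and independence are measured after multiplication by the Gram matrix [sgn_mx], that is, modulo
    the radical. A single null vector [v0], orthogonal to no point of the working ball, is the
    transverse direction: moving along it restores orthogonality after a perturbation, and
    derivatives along it measure the kernel near orthogonal pairs. The complex analysis is condensed
    into one statement, [zero_propagation]; the geometry is carried out over any closed field
    satisfying it. *)

Definition CC (R : realType) : numFieldType := R[i].

(** * Continuity and derivatives in epsilon form *)

Lemma near_dist_le (K : numFieldType) (V : normedModType K) (z : V) (e : K) :
  0 < e -> \forall w \near z, `|z - w| <= e.
Proof. by move=> e0; apply: (@cvgr_dist_le _ _ _ (nbhs z) _ id z). Qed.

Lemma eps_continuous (K L : numFieldType) (V : normedModType K) (W : normedModType L)
    (f : V -> W) (z : V) :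
  (forall e : L, 0 < e -> exists2 d : K, 0 < d &
     forall w, `|z - w| <= d -> `|f z - f w| <= e) ->
  {for z, continuous f}.
Proof.
move=> h; apply/cvgrPdist_le => e /h[d d0 hd].
exact: filterS (near_dist_le z d0).
Qed.

Lemma continuous_eps (K L : numFieldType) (V : normedModType K) (W : normedModType L)
    (f : V -> W) (z : V) : {for z, continuous f} ->
  forall e : L, 0 < e -> exists2 d : K, 0 < d &
     forall w, `|z - w| < d -> `|f z - f w| <= e.
Proof.
move=> /cvgrPdist_le h e e0; have /nbhs_ballP[d /= d0 hd] := h _ e0.
by exists d => // w zw; apply: hd; rewrite -ball_normE.
Qed.

Section DerivableExpansion.
Context {K : numFieldType}.

Lemma derivable_expand (f : K -> K) (q : K) : derivable f q 1 ->
  forall e : K, 0 < e -> exists2 d : K, 0 < d &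
    forall z, `|z - q| < d -> `|f z - f q - 'D_1 f q * (z - q)| <= e * `|z - q|.
Proof.
move=> fd e e0.
have fd' : h^-1 *: ((f \o shift q) (h *: 1) - f q) @[h --> 0^'] --> 'D_1 f q.
  exact: fd.
move/cvgrPdist_le : fd' => /(_ _ e0).
rewrite near_withinE => /nbhs_ballP[d /= d0 hd].
exists d => // z zq.
have [->|zq0] := eqVneq z q; first by rewrite !subrr mulr0 subr0 normr0 mulr0.
have zq1 : z - q != 0 by rewrite subr_eq0.
have := hd (z - q); rewrite -ball_normE/= sub0r normrN => /(_ zq zq1).
rewrite /shift/=; have -> : (z - q) *: (1 : K) + q = z by rewrite -[_ *: _]/(_ * _) mulr1 subrK.
rewrite -[_ *: _]/((z - q)^-1 * (f z - f q)) distrC.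
have -> : f z - f q - 'D_1 f q * (z - q) = ((z - q)^-1 * (f z - f q) - 'D_1 f q) * (z - q).
  by rewrite mulrBl mulrAC mulVf// mul1r.
by rewrite normrM => h; rewrite ler_wpM2r.
Qed.

Lemma expand_is_derive (f : K -> K) (q k : K) :
  (forall e : K, 0 < e -> exists2 d : K, 0 < d &
    forall z, `|z - q| < d -> `|f z - f q - k * (z - q)| <= e * `|z - q|) ->
  is_derive q 1 f k.
Proof.
move=> hk.
have lk : h^-1 *: ((f \o shift q) (h *: 1) - f q) @[h --> 0^'] --> k.
  apply/cvgrPdist_le => e /hk[d d0 hd].
  rewrite near_withinE; apply/nbhs_ballP; exists d => //= h.
  rewrite -ball_normE/= sub0r normrN => hd0 h0.
  have := hd (h + q); rewrite addrK => /(_ hd0).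
  rewrite /shift/= -![_ *: _]/(_ * _) mulr1 => le.
  have -> : k - h^-1 * (f (h + q) - f q) = - (h^-1 * (f (h + q) - f q - k * h)).
    by rewrite [X in _ = - X]mulrBr (mulrC k) mulrA mulVf// mul1r opprB.
  by rewrite normrN normrM normfV mulrC ler_pdivrMr ?normr_gt0.
by apply: DeriveDef; [apply/cvg_ex; exists k|exact: cvg_lim lk].
Qed.

Lemma derivable_epsP (f : K -> K) (q : K) : derivable f q 1 <->
  exists k : K, forall e : K, 0 < e -> exists2 d : K, 0 < d &
    forall z, `|z - q| < d -> `|f z - f q - k * (z - q)| <= e * `|z - q|.
Proof.
split; first by move=> fd; exists ('D_1 f q); exact: derivable_expand.
by move=> [k /expand_is_derive[]].
Qed.

End DerivableExpansion.

(** * Complex integration and propagation of zeros *)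

Section ComplexIntegral.
Context {R : realType}.
Local Notation C := (CC R).
Local Notation mu := (@lebesgue_measure R).
Implicit Types (g : R -> C) (a b c d M : R).

Lemma Re_norm_le (z : C) (e : R) : `|z| <= e%:C%C -> `|complex.Re z| <= e.
Proof. by move=> h; rewrite -lecR (le_trans (normc_ge_Re z)). Qed.

Lemma normc_ge_Im (z : C) : `|complex.Im z|%:C%C <= `|z|.
Proof.
have := normc_ge_Re (z * 'i%C); rewrite ReiNIm normrN normrM.
suff -> : `|'i%C : C| = 1 by rewrite mulr1.
by rewrite normc_def/= expr0n expr1n add0r sqrtr1.
Qed.

Lemma Im_norm_le (z : C) (e : R) : `|z| <= e%:C%C -> `|complex.Im z| <= e.
Proof. by move=> h; rewrite -lecR (le_trans (normc_ge_Im z)). Qed.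

Lemma norm_le_ReIm (z : C) (e f : R) :
  `|complex.Re z| <= e -> `|complex.Im z| <= f -> `|z| <= (e + f)%:C%C.
Proof.
move=> he hf; rewrite [z]complexE.
apply: (le_trans (ler_normD _ _)); rewrite normrM.
have -> : `|'i%C : C| = 1 by rewrite normc_def/= expr0n expr1n add0r sqrtr1.
rewrite mul1r rmorphD/= lerD//.
  by rewrite normc_def/= expr0n addr0 sqrtr_sqr lecR.
by rewrite normc_def/= expr0n addr0 sqrtr_sqr lecR.
Qed.

Lemma posC_real (e : C) : 0 < e -> exists2 r : R, e = r%:C%C & 0 < r.
Proof.
move=> e0; have /complex_realP[r re] : e \is Num.real by exact: gtr0_real.
by exists r => //; rewrite -ltcR -re.
Qed.

Lemma continuous_Re : continuous (@complex.Re R : C -> R).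
Proof.
move=> z; apply: (@eps_continuous (CC R) R (CC R)) => e e0.
exists (e%:C%C : C); first by rewrite ltcR.
by move=> w; rewrite -raddfB/=; exact: Re_norm_le.
Qed.

Lemma continuous_Im : continuous (@complex.Im R : C -> R).
Proof.
move=> z; apply: (@eps_continuous (CC R) R (CC R)) => e e0.
exists (e%:C%C : C); first by rewrite ltcR.
by move=> w; rewrite -raddfB/=; exact: Im_norm_le.
Qed.

Lemma norm_real_complex (x : R) : `|x%:C%C : C| = `|x|%:C%C.
Proof. by rewrite normc_def/= expr0n addr0 sqrtr_sqr. Qed.

Definition ccont g a b := forall t, a <= t <= b -> {for t, continuous g}.

Definition cint g a b : C :=
  Complex (Rintegral mu `[a, b] (fun t => complex.Re (g t)))
          (Rintegral mu `[a, b] (fun t => complex.Im (g t))).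

Lemma ccont_Re_int g a b : ccont g a b ->
  mu.-integrable `[a, b] (EFin \o (fun t => complex.Re (g t))).
Proof.
move=> gc; apply: continuous_compact_integrable; first exact: segment_compact.
apply/continuous_in_subspaceT => t; rewrite inE/= in_itv/= => tab.
apply: (@continuous_comp R (CC R) R g (@complex.Re R)); [exact: gc|exact: continuous_Re].
Qed.

Lemma ccont_Im_int g a b : ccont g a b ->
  mu.-integrable `[a, b] (EFin \o (fun t => complex.Im (g t))).
Proof.
move=> gc; apply: continuous_compact_integrable; first exact: segment_compact.
apply/continuous_in_subspaceT => t; rewrite inE/= in_itv/= => tab.
apply: (@continuous_comp R (CC R) R g (@complex.Im R)); [exact: gc|exact: continuous_Im].
Qed.

Lemma cintB g1 g2 a b : ccont g1 a b -> ccont g2 a b ->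
  cint (fun t => g1 t - g2 t) a b = cint g1 a b - cint g2 a b.
Proof.
move=> c1 c2; apply/eqP; rewrite eq_complex/=; apply/andP; split; apply/eqP.
  rewrite -RintegralB//; try exact: ccont_Re_int.
  by apply: eq_Rintegral => t _; rewrite raddfB.
rewrite -RintegralB//; try exact: ccont_Im_int.
by apply: eq_Rintegral => t _; rewrite raddfB.
Qed.

Lemma cintZ (k : C) g a b : ccont g a b ->
  cint (fun t => k * g t) a b = k * cint g a b.
Proof.
move=> cg; case: k => p q; apply/eqP; rewrite eq_complex/=.
apply/andP; split; apply/eqP.
  rewrite -!RintegralZl//; do ?[exact: ccont_Re_int|exact: ccont_Im_int].
  rewrite -RintegralB//=.
  - by apply: eq_Rintegral => t _; case: (g t).
  - have := @integrableZl _ _ _ mu `[a, b] (measurable_itv _) p _ (ccont_Re_int cg).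
    by [].
  - have := @integrableZl _ _ _ mu `[a, b] (measurable_itv _) q _ (ccont_Im_int cg).
    by [].
rewrite -!RintegralZl//; do ?[exact: ccont_Re_int|exact: ccont_Im_int].
rewrite -RintegralD//=.
- by apply: eq_Rintegral => t _; case: (g t).
- have := @integrableZl _ _ _ mu `[a, b] (measurable_itv _) p _ (ccont_Im_int cg).
  by [].
- have := @integrableZl _ _ _ mu `[a, b] (measurable_itv _) q _ (ccont_Re_int cg).
  by [].
Qed.

Lemma Rint_cst (k a b : R) : a <= b ->
  Rintegral mu `[a, b] (fun=> k) = k * (b - a).
Proof.
move=> ab; rewrite Rintegral_cst//; have := @lebesgue_measure_itv R `[a, b]%R.
move=> /= ->; rewrite lte_fin; by case: ltgtP ab => // -> _; rewrite subrr/= mulr0.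
Qed.

Lemma cint_cst (k : C) a b : a <= b -> cint (fun=> k) a b = k * (b - a)%:C%C.
Proof.
move=> ab; case: k => p q; apply/eqP; rewrite eq_complex/= !Rint_cst//.
by rewrite !mulr0 subr0 add0r !eqxx.
Qed.

Lemma Rint_split (f : R -> R) a m b : a <= m <= b ->
  mu.-integrable `[a, b] (EFin \o f) ->
  Rintegral mu `[a, b] f = Rintegral mu `[a, m] f + Rintegral mu `[m, b] f.
Proof.
move=> /andP[am mb] fi.
have := @Rintegral_itvB R f (BLeft a) (BRight b) m fi.
rewrite !bnd_simp => /(_ am mb) /eqP; rewrite subr_eq => /eqP ->.
rewrite addrC; congr (_ + _); rewrite Rintegral_itv_obnd_cbnd//.
apply: integrableS fi => //.
by apply: subset_itvr; rewrite bnd_simp.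
Qed.

Lemma cint_split g a m b : a <= m <= b -> ccont g a b ->
  cint g a b = cint g a m + cint g m b.
Proof.
move=> amb gc; apply/eqP; rewrite eq_complex/=.
rewrite (Rint_split amb (ccont_Re_int gc)) (Rint_split amb (ccont_Im_int gc)).
by rewrite !eqxx.
Qed.

Lemma Rint_norm_le (f : R -> R) a b M : a <= b ->
  mu.-integrable `[a, b] (EFin \o f) -> (forall t, a <= t <= b -> `|f t| <= M) ->
  `|Rintegral mu `[a, b] f| <= M * (b - a).
Proof.
move=> ab fi fM; apply: (le_trans (le_normr_Rintegral _ fi)) => //.
rewrite -(Rint_cst _ ab); apply: le_Rintegral => //.
- exact: (integrable_norm fi).
- apply: continuous_compact_integrable; first exact: segment_compact.
  by apply/continuous_in_subspaceT => t _; exact: cvg_cst.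
Qed.

(** The factor 2 comes from bounding the real and imaginary parts separately. *)
Lemma cint_norm_le g a b M : a <= b -> ccont g a b ->
  (forall t, a <= t <= b -> `|g t| <= M%:C%C) ->
  `|cint g a b| <= (2 * M * (b - a))%:C%C.
Proof.
move=> ab gc gM.
have -> : 2 * M * (b - a) = M * (b - a) + M * (b - a) by ring.
apply: norm_le_ReIm => /=.
  by apply: Rint_norm_le => //; [exact: ccont_Re_int|move=> t /gM/Re_norm_le].
by apply: Rint_norm_le => //; [exact: ccont_Im_int|move=> t /gM/Im_norm_le].
Qed.

Lemma cint_Im_ge g a b M : a <= b -> ccont g a b ->
  (forall t, a <= t <= b -> M <= complex.Im (g t)) ->
  M * (b - a) <= complex.Im (cint g a b).
Proof.
move=> ab gc gM; rewrite /= -(Rint_cst _ ab); apply: le_Rintegral => //.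
- apply: continuous_compact_integrable; first exact: segment_compact.
  by apply/continuous_in_subspaceT => t _; exact: cvg_cst.
- exact: ccont_Im_int.
Qed.

End ComplexIntegral.

(** * Compactness of rectangles by bisection *)

Section Cousin.
Context {R : realType}.

Lemma pow2_small (w e : R) : 0 < e -> exists n : nat, w / 2 ^+ n < e.
Proof.
move=> e0.
have := archi_boundP (normr_ge0 (w / e)); set k := Num.bound _ => hk.
exists k; rewrite ltr_pdivrMr ?exprn_gt0// mulrC -ltr_pdivrMr//.
apply: (le_lt_trans (ler_norm _)); apply: (lt_le_trans hk).
by rewrite -natrX ler_nat ltnW// ltn_expl.
Qed.

Variable P : R -> R -> R -> R -> Prop.
Hypothesis P4 : forall a b c d, a <= b -> c <= d ->
  P a ((a + b) / 2) c ((c + d) / 2) -> P ((a + b) / 2) b c ((c + d) / 2) ->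
  P a ((a + b) / 2) ((c + d) / 2) d -> P ((a + b) / 2) b ((c + d) / 2) d ->
  P a b c d.

(** The first failing quarter, and the last quarter by default; if the whole rectangle fails, then
    by [P4] the chosen quarter fails too. *)
Let next (q : R * R * (R * R)) : R * R * (R * R) :=
  let: (a, b, (c, d)) := q in
  if `[< ~ P a ((a + b) / 2) c ((c + d) / 2) >]
    then (a, (a + b) / 2, (c, (c + d) / 2)) else
  if `[< ~ P ((a + b) / 2) b c ((c + d) / 2) >]
    then ((a + b) / 2, b, (c, (c + d) / 2)) else
  if `[< ~ P a ((a + b) / 2) ((c + d) / 2) d >]
    then (a, (a + b) / 2, ((c + d) / 2, d)) else
  ((a + b) / 2, b, ((c + d) / 2, d)).

Let bad (q : R * R * (R * R)) := ~ P q.1.1 q.1.2 q.2.1 q.2.2.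

Lemma bisection_next q : q.1.1 <= q.1.2 -> q.2.1 <= q.2.2 -> bad q ->
  [/\ bad (next q), q.1.1 <= (next q).1.1, (next q).1.2 <= q.1.2,
     q.2.1 <= (next q).2.1 & (next q).2.2 <= q.2.2] /\
  ((next q).1.2 - (next q).1.1 = (q.1.2 - q.1.1) / 2 /\
   (next q).2.2 - (next q).2.1 = (q.2.2 - q.2.1) / 2).
Proof.
case: q => -[a b] [c d]; rewrite /bad /next /= => ab cd nP.
case: asboolP => h1; first by split; [split => //=|split => //=]; lra.
case: asboolP => h2; first by split; [split => //=|split => //=]; lra.
case: asboolP => h3; first by split; [split => //=|split => //=]; lra.
have h4 : ~ P ((a + b) / 2) b ((c + d) / 2) d.
  by move=> h4; apply: nP; apply: P4 => //; apply: contrapT.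
by split; [split => //=|split => //=]; lra.
Qed.

(** If [P] failed, repeated bisection would give nested failing rectangles. The suprema of their
    lower left corners form a point lying in all of them, and [loc] at this point contradicts the
    failure of a small enough one. *)
Lemma cousin_box a0 b0 c0 d0 : a0 <= b0 -> c0 <= d0 ->
  (forall x y, a0 <= x <= b0 -> c0 <= y <= d0 -> exists2 e, 0 < e &
     forall a b c d, a0 <= a -> a <= x -> x <= b -> b <= b0 ->
       c0 <= c -> c <= y -> y <= d -> d <= d0 -> b - a < e -> d - c < e -> P a b c d) ->
  P a0 b0 c0 d0.
Proof.
move=> ab0 cd0 loc; apply: contrapT => nP.
pose s n := iter n next (a0, b0, (c0, d0)).
have sP n : [/\ bad (s n), (s n).1.1 <= (s n).1.2, (s n).2.1 <= (s n).2.2,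
    (s n).1.2 - (s n).1.1 = (b0 - a0) / 2 ^+ n &
    (s n).2.2 - (s n).2.1 = (d0 - c0) / 2 ^+ n].
  elim: n => [|n [bn abn cdn wn hn]]; first by rewrite /s /= expr0 !divr1.
  have [[bn' _ _ _ _] [w h]] := bisection_next abn cdn bn.
  have w0 : 0 <= (b0 - a0) / 2 ^+ n by rewrite -wn subr_ge0.
  have h0 : 0 <= (d0 - c0) / 2 ^+ n by rewrite -hn subr_ge0.
  rewrite /s iterS -/(s n); split => //.
  - by rewrite -subr_ge0 w wn divr_ge0.
  - by rewrite -subr_ge0 h hn divr_ge0.
  - by rewrite w wn exprSr invfM mulrA.
  - by rewrite h hn exprSr invfM mulrA.
have sS n : [/\ (s n).1.1 <= (s n.+1).1.1, (s n.+1).1.2 <= (s n).1.2,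
     (s n).2.1 <= (s n.+1).2.1 & (s n.+1).2.2 <= (s n).2.2].
  have [bn abn cdn _ _] := sP n.
  by have [[_ h1 h2 h3 h4] _] := bisection_next abn cdn bn; split.
have mono m n : (m <= n)%N -> [/\ (s m).1.1 <= (s n).1.1, (s n).1.2 <= (s m).1.2,
     (s m).2.1 <= (s n).2.1 & (s n).2.2 <= (s m).2.2].
  elim: n => [|n IH]; first by rewrite leqn0 => /eqP ->.
  rewrite leq_eqVlt => /orP[/eqP -> //|]; rewrite ltnS => /IH[h1 h2 h3 h4].
  have [g1 g2 g3 g4] := sS n; split.
  - exact: le_trans h1 g1.
  - exact: le_trans g2 h2.
  - exact: le_trans h3 g3.
  - exact: le_trans g4 h4.
have cross m n : (s m).1.1 <= (s n).1.2 /\ (s m).2.1 <= (s n).2.2.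
  have [h1 _ h3 _] := mono _ _ (leq_maxl m n).
  have [_ h2 _ h4] := mono _ _ (leq_maxr m n).
  have [_ g1 g2 _ _] := sP (maxn m n).
  by split; [exact: le_trans h1 (le_trans g1 h2)|exact: le_trans h3 (le_trans g2 h4)].
pose A := range (fun n => (s n).1.1); pose B := range (fun n => (s n).2.1).
have supA : has_sup A.
  split; first by exists (s 0%N).1.1; exists 0%N.
  by exists (s 0%N).1.2 => _ [n _ <-]; have [] := cross n 0%N.
have supB : has_sup B.
  split; first by exists (s 0%N).2.1; exists 0%N.
  by exists (s 0%N).2.2 => _ [n _ <-]; have [] := cross n 0%N.
have xP n : (s n).1.1 <= sup A <= (s n).1.2.
  apply/andP; split; first by apply: (ub_le_sup supA.2); exists n.
  by apply: ge_sup => [|_ [m _ <-]]; [exact: supA.1|have [] := cross m n].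
have yP n : (s n).2.1 <= sup B <= (s n).2.2.
  apply/andP; split; first by apply: (ub_le_sup supB.2); exists n.
  by apply: ge_sup => [|_ [m _ <-]]; [exact: supB.1|have [] := cross m n].
have [e e0 he] := loc _ _ (xP 0%N) (yP 0%N).
have [n1 hn1] := pow2_small (b0 - a0) e0.
have [n2 hn2] := pow2_small (d0 - c0) e0.
have small (w : R) m n : (m <= n)%N -> 0 <= w -> w / 2 ^+ m < e -> w / 2 ^+ n < e.
  move=> mn w0; apply: le_lt_trans; apply: ler_wpM2l => //.
  by rewrite lef_pV2 ?posrE ?exprn_gt0// ler_eXn2l// ltr1n.
have [bn _ _ wn hn] := sP (maxn n1 n2).
have [g1 g2 g3 g4] := mono _ _ (leq0n (maxn n1 n2)).
have /andP[x1 x2] := xP (maxn n1 n2); have /andP[y1 y2] := yP (maxn n1 n2).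
apply: bn; apply: he => //.
  by rewrite wn; apply: small hn1; rewrite ?leq_maxl// subr_ge0.
by rewrite hn; apply: small hn2; rewrite ?leq_maxr// subr_ge0.
Qed.

End Cousin.

(** * Goursat's theorem on rectangles *)

Section Goursat.
Context {R : realType}.
Local Notation C := (CC R).
Implicit Types (f : C -> C) (a b c d : R).

Definition inbox a b c d (z : C) := a <= complex.Re z <= b /\ c <= complex.Im z <= d.

Definition bcont f a b c d := forall z, inbox a b c d z -> {for z, continuous f}.

(* Opposite sides of the contour are subtracted pointwise before integrating. *)
Definition box f a b c d : C :=
  cint (fun x => f (Complex x c) - f (Complex x d)) a b +
  'i%C * cint (fun y => f (Complex b y) - f (Complex a y)) c d.

Lemma bcontW f a b c d a' b' c' d' : a <= a' -> b' <= b -> c <= c' -> d' <= d ->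
  bcont f a b c d -> bcont f a' b' c' d'.
Proof.
move=> h1 h2 h3 h4 fc z [/andP[z1 z2] /andP[z3 z4]]; apply: fc; split.
  by rewrite (le_trans h1 z1) (le_trans z2 h2).
by rewrite (le_trans h3 z3) (le_trans z4 h4).
Qed.

Lemma continuous_hline c : continuous (fun x : R => Complex x c : C).
Proof.
move=> z; apply: (@eps_continuous R (CC R) R (CC R)) => e /posC_real[r -> r0].
exists r => // w zw; have -> : (Complex z c : C) - Complex w c = (z - w)%:C%C.
  by apply/eqP; rewrite eq_complex/= subrr !eqxx.
by rewrite norm_real_complex lecR.
Qed.

Lemma continuous_vline a : continuous (fun y : R => Complex a y : C).
Proof.
move=> z; apply: (@eps_continuous R (CC R) R (CC R)) => e /posC_real[r -> r0].
exists r => // w zw; have -> : (Complex a z : C) - Complex a w = 'i%C * (z - w)%:C%C.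
  by apply/eqP; rewrite eq_complex/= !mul0r !mulr0 mul1r subrr !(addr0, add0r, subr0, oppr0) !eqxx.
by rewrite normrM norm_real_complex normc_def/= expr0n expr1n add0r sqrtr1 mul1r lecR.
Qed.

Lemma bcont_h f a b c d y : bcont f a b c d -> c <= y <= d ->
  ccont (fun x => f (Complex x y)) a b.
Proof.
move=> fc cyd t tab; apply: (@continuous_comp R (CC R) (CC R)).
  exact: continuous_hline.
by apply: fc; split.
Qed.

Lemma bcont_v f a b c d x : bcont f a b c d -> a <= x <= b ->
  ccont (fun y => f (Complex x y)) c d.
Proof.
move=> fc cyd t tab; apply: (@continuous_comp R (CC R) (CC R)).
  exact: continuous_vline.
by apply: fc; split.
Qed.

Lemma boxE f a b c d : a <= b -> c <= d -> bcont f a b c d ->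
  box f a b c d = cint (fun x => f (Complex x c)) a b - cint (fun x => f (Complex x d)) a b
   + 'i%C * (cint (fun y => f (Complex b y)) c d - cint (fun y => f (Complex a y)) c d).
Proof.
move=> ab cd fc; rewrite /box !cintB//.
- by apply: (bcont_v fc); rewrite ab lexx.
- by apply: (bcont_v fc); rewrite lexx ab.
- by apply: (bcont_h fc); rewrite cd lexx.
- by apply: (bcont_h fc); rewrite cd lexx.
Qed.

Lemma box_splitx f a m b c d : a <= m -> m <= b -> c <= d -> bcont f a b c d ->
  box f a b c d = box f a m c d + box f m b c d.
Proof.
move=> am mb cd fc; have ab := le_trans am mb.
rewrite !boxE//; last 2 first.
- exact: bcontW fc.
- exact: bcontW fc.
rewrite (@cint_split _ (fun x => f (Complex x c)) a m b) ?am//; last first.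
  by apply: (bcont_h fc); rewrite lexx cd.
rewrite (@cint_split _ (fun x => f (Complex x d)) a m b) ?am//; last first.
  by apply: (bcont_h fc); rewrite lexx cd.
by ring.
Qed.

Lemma box_splity f a b c m d : a <= b -> c <= m -> m <= d -> bcont f a b c d ->
  box f a b c d = box f a b c m + box f a b m d.
Proof.
move=> ab cm md fc; have cd := le_trans cm md.
rewrite !boxE//; last 2 first.
- exact: bcontW fc.
- exact: bcontW fc.
rewrite (@cint_split _ (fun y => f (Complex a y)) c m d) ?cm//; last first.
  by apply: (bcont_v fc); rewrite lexx ab.
rewrite (@cint_split _ (fun y => f (Complex b y)) c m d) ?cm//; last first.
  by apply: (bcont_v fc); rewrite lexx ab.
by ring.
Qed.

(** The contour integral of an affine function vanishes: [k1] and [k2] are the differences of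
    [k * z] between opposite sides, and their two contributions cancel. The factor 4 is 2 for each
    pair of opposite sides times the 2 of [cint_norm_le]. *)
Lemma box_norm_affine f (k0 k : C) a b c d (e : R) : a <= b -> c <= d ->
  bcont f a b c d ->
  (forall z, inbox a b c d z -> `|f z - k0 - k * z| <= e%:C%C) ->
  `|box f a b c d| <= (4 * e * ((b - a) + (d - c)))%:C%C.
Proof.
move=> ab cd fc fe.
pose k1 : C := k * 'i%C * (c - d)%:C%C; pose k2 : C := k * (b - a)%:C%C.
have h1 : ccont (fun x => f (Complex x c) - f (Complex x d)) a b.
  move=> t tab; apply: (@continuousB _ (CC R)).
    by apply: (bcont_h fc) => //; rewrite lexx cd.
  by apply: (bcont_h fc) => //; rewrite lexx cd.
have h2 : ccont (fun y => f (Complex b y) - f (Complex a y)) c d.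
  move=> t tab; apply: (@continuousB _ (CC R)).
    by apply: (bcont_v fc) => //; rewrite lexx ab.
  by apply: (bcont_v fc) => //; rewrite lexx ab.
have cc (k' : C) u v : ccont (fun=> k') u v by move=> t _; exact: cst_continuous.
have -> : box f a b c d =
    cint (fun x => f (Complex x c) - f (Complex x d) - k1) a b +
    'i%C * cint (fun y => f (Complex b y) - f (Complex a y) - k2) c d.
  rewrite /box (cintB h1 (cc _ _ _)) (cintB h2 (cc _ _ _)) !cint_cst// /k1 /k2.
  have -> : (d - c)%:C%C = - (c - d)%:C%C :> C by rewrite -rmorphN opprB.
  by ring.
have four : 4 * e * (b - a + (d - c)) = 2 * (e + e) * (b - a) + 2 * (e + e) * (d - c) by ring.
rewrite four rmorphD/=; apply: (le_trans (ler_normD _ _)); apply: lerD.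
  apply: (@cint_norm_le _ _ _ _ (e + e) ab).
    by move=> t tab; apply: (@continuousB _ (CC R)); [exact: h1|exact: (cc k1 a b)].
  move=> t tab.
  have -> : f (Complex t c) - f (Complex t d) - k1 =
     (f (Complex t c) - k0 - k * Complex t c) - (f (Complex t d) - k0 - k * Complex t d).
    have -> : k1 = k * (Complex t c - Complex t d).
      rewrite /k1 -mulrA; congr (_ * _); apply/eqP.
      by rewrite eq_complex/=; apply/andP; split; apply/eqP; ring.
    by ring.
  rewrite rmorphD/=; apply: (le_trans (ler_normB _ _)); apply: lerD; apply: fe; split => //=.
  - by rewrite lexx cd.
  - by rewrite lexx cd.
rewrite normrM; have -> : `|'i%C : C| = 1 by rewrite normc_def/= expr0n expr1n add0r sqrtr1.
rewrite mul1r; apply: (@cint_norm_le _ _ _ _ (e + e) cd).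
  by move=> t tab; apply: (@continuousB _ (CC R)); [exact: h2|exact: (cc k2 c d)].
move=> t tab.
have -> : f (Complex b t) - f (Complex a t) - k2 =
   (f (Complex b t) - k0 - k * Complex b t) - (f (Complex a t) - k0 - k * Complex a t).
  have -> : k2 = k * (Complex b t - Complex a t).
    rewrite /k2; congr (_ * _); apply/eqP.
    by rewrite eq_complex/=; apply/andP; split; apply/eqP; ring.
  by ring.
rewrite rmorphD/=; apply: (le_trans (ler_normB _ _)); apply: lerD; apply: fe; split => //=.
- by rewrite lexx ab.
- by rewrite lexx ab.
Qed.

Lemma derivable_expand_real f (q : C) : derivable f q 1 ->
  exists k : C, forall e : R, 0 < e -> exists2 dl : R, 0 < dl &
    forall z, `|z - q| < dl%:C%C -> `|f z - f q - k * (z - q)| <= e%:C%C * `|z - q|.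
Proof.
move=> fd; exists ('D_1 f q) => e e0.
have e0C : 0 < (e%:C%C : C) by rewrite ltcR.
by have [d /posC_real[dr -> dr0] hd] := derivable_expand fd e0C; exists dr.
Qed.

Lemma inbox_dist a b c d (z q : C) : inbox a b c d z -> inbox a b c d q ->
  `|z - q| <= ((b - a) + (d - c))%:C%C.
Proof.
move=> [/andP[h1 h2] /andP[h3 h4]] [/andP[g1 g2] /andP[g3 g4]].
apply: norm_le_ReIm; rewrite raddfB/= ler_norml; apply/andP; split; lra.
Qed.

(** A bound by [e] times the squared half perimeter is compatible with cutting into four equal
    quarters, since each quarter has half of the half perimeter. Near a point, differentiability
    brings [f] within [e / 4 * L] of an affine function, and [box_norm_affine] then gives the bound
    [e * L ^+ 2]. *)
Theorem goursat f a b c d : a <= b -> c <= d ->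
  (forall z, inbox a b c d z -> derivable f z 1) -> box f a b c d = 0.
Proof.
move=> ab cd fd.
have fc : bcont f a b c d.
  move=> z /fd /derivable1_diffP; exact: differentiable_continuous.
have bnd (e : R) : 0 < e -> `|box f a b c d| <= (e * ((b - a) + (d - c)) ^+ 2)%:C%C.
  move=> e0.
  pose P a' b' c' d' := a <= a' -> b' <= b -> c <= c' -> d' <= d ->
     `|box f a' b' c' d'| <= (e * ((b' - a') + (d' - c')) ^+ 2)%:C%C.
  suff : P a b c d by apply.
  apply: cousin_box => //.
    move=> a' b' c' d' ab' cd'; set m := (a' + b') / 2; set n := (c' + d') / 2.
    have am : a' <= m by rewrite /m; lra.
    have mb : m <= b' by rewrite /m; lra.
    have cn : c' <= n by rewrite /n; lra.
    have nd : n <= d' by rewrite /n; lra.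
    move=> h1 h2 h3 h4 k1 k2 k3 k4.
    have fc' : bcont f a' b' c' d' by exact: bcontW fc.
    rewrite (box_splitx am mb cd' fc') (box_splity am cn nd); last exact: bcontW fc'.
    rewrite (box_splity mb cn nd); last exact: bcontW fc'.
    have -> : e * (b' - a' + (d' - c')) ^+ 2 =
      (e * ((m - a') + (n - c')) ^+ 2 + e * ((m - a') + (d' - n)) ^+ 2)
      + (e * ((b' - m) + (n - c')) ^+ 2 + e * ((b' - m) + (d' - n)) ^+ 2).
      by rewrite /m /n; field.
    rewrite !rmorphD; apply: (le_trans (ler_normD _ _)); apply: lerD.
      apply: (le_trans (ler_normD _ _)); apply: lerD; [apply: h1|apply: h3] => //.
      - exact: le_trans k2.
      - exact: le_trans k4.
      - exact: le_trans k2.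
      - exact: le_trans cn.
    apply: (le_trans (ler_normD _ _)); apply: lerD; [apply: h2|apply: h4] => //.
    - exact: le_trans am.
    - exact: le_trans k4.
    - exact: le_trans am.
    - exact: le_trans cn.
  move=> x y xab ycd.
  have [k hk] := derivable_expand_real (@fd (Complex x y) (conj xab ycd)).
  have e4 : 0 < e / 4 by rewrite divr_gt0.
  have [dl dl0 hdl] := hk _ e4.
  exists (dl / 2); first by rewrite divr_gt0.
  move=> a' b' c' d' h1 h2 h3 h4 h5 h6 h7 h8 s1 s2 _ _ _ _.
  have ab' := le_trans h2 h3; have cd' := le_trans h6 h7.
  set L := b' - a' + (d' - c').
  have L0 : 0 <= L by rewrite /L addr_ge0// subr_ge0.
  have -> : e * L ^+ 2 = 4 * (e / 4 * L) * L by field.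
  apply: (@box_norm_affine _ (f (Complex x y) - k * Complex x y) k) => //.
    exact: bcontW fc.
  move=> z zin.
  have qin : inbox a' b' c' d' (Complex x y) by split => /=; apply/andP.
  have -> : f z - (f (Complex x y) - k * Complex x y) - k * z =
     f z - f (Complex x y) - k * (z - Complex x y) by ring.
  have zq := inbox_dist zin qin.
  apply: (le_trans (hdl _ _)).
    by apply: (le_lt_trans zq); rewrite ltcR; lra.
  by rewrite (rmorphM _ (e / 4) L)/=; apply: (@ler_wpM2l R[i]) => //; rewrite ler0c ltW.
apply/eqP; rewrite -normr_le0; apply/ler_addgt0Pl => e' /posC_real[e -> e0].
rewrite addr0; set M := ((b - a) + (d - c)) ^+ 2.
have M0 : 0 <= M by rewrite sqr_ge0.
have d0 : 0 < e / (M + 1) by rewrite divr_gt0// ltr_pwDr.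
apply: (le_trans (bnd _ d0)); rewrite lecR -/M mulrAC ler_pdivrMr ?ltr_pwDr//.
by rewrite ler_pM2l// lerDl.
Qed.

End Goursat.

(** * Contour integrals around a singular point *)

Section CauchyEstimate.
Context {R : realType}.
Local Notation C := (CC R).
Implicit Types (f g : C -> C) (a b c d : R).
Local Notation hl f c := (fun x => f (Complex x c)).
Local Notation vl f a := (fun y => f (Complex a y)).

(** Continuity is asked on the four sides only, because the integrand may have a pole inside. *)
Lemma boxE_gen f a b c d :
  ccont (hl f c) a b -> ccont (hl f d) a b ->
  ccont (vl f a) c d -> ccont (vl f b) c d ->
  box f a b c d = cint (hl f c) a b - cint (hl f d) a b
   + 'i%C * (cint (vl f b) c d - cint (vl f a) c d).
Proof. by move=> hc hd va vb; rewrite /box (cintB hc hd) (cintB vb va). Qed.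

Lemma ccontW (g : R -> C) a b u v : a <= u -> v <= b -> ccont g a b -> ccont g u v.
Proof.
by move=> au vb gc t /andP[h1 h2]; apply: gc; rewrite (le_trans au h1) (le_trans h2 vb).
Qed.

Lemma box_splitx_gen f a m b c d : a <= m -> m <= b ->
  ccont (hl f c) a b -> ccont (hl f d) a b ->
  ccont (vl f a) c d -> ccont (vl f m) c d -> ccont (vl f b) c d ->
  box f a b c d = box f a m c d + box f m b c d.
Proof.
move=> am mb hc hd va vm vb.
have amb : a <= m <= b by rewrite am.
rewrite (boxE_gen hc hd va vb).
rewrite (boxE_gen (ccontW (lexx a) mb hc) (ccontW (lexx a) mb hd) va vm).
rewrite (boxE_gen (ccontW am (lexx b) hc) (ccontW am (lexx b) hd) vm vb).
rewrite (cint_split amb hc) (cint_split amb hd).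
by ring.
Qed.

Lemma box_splity_gen f a b c m d : c <= m -> m <= d ->
  ccont (vl f a) c d -> ccont (vl f b) c d ->
  ccont (hl f c) a b -> ccont (hl f m) a b -> ccont (hl f d) a b ->
  box f a b c d = box f a b c m + box f a b m d.
Proof.
move=> cm md va vb hc hm hd.
have cmd : c <= m <= d by rewrite cm.
rewrite (boxE_gen hc hd va vb).
rewrite (boxE_gen hc hm (ccontW (lexx c) md va) (ccontW (lexx c) md vb)).
rewrite (boxE_gen hm hd (ccontW cm (lexx d) va) (ccontW cm (lexx d) vb)).
rewrite (cint_split cmd va) (cint_split cmd vb).
by ring.
Qed.

(** Two vertical cuts, then two horizontal ones in the middle strip, isolate the small square. The
    four pieces removed avoid [z0], so their integrals vanish by Goursat's theorem. *)
Lemma box_hole f a b c d (z0 : C) (h : R) : 0 < h ->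
  a < complex.Re z0 - h -> complex.Re z0 + h < b ->
  c < complex.Im z0 - h -> complex.Im z0 + h < d ->
  (forall z, inbox a b c d z -> z != z0 -> derivable f z 1) ->
  box f a b c d = box f (complex.Re z0 - h) (complex.Re z0 + h)
                        (complex.Im z0 - h) (complex.Im z0 + h).
Proof.
case: z0 => x0 y0 /= h0 ax xb cy yd fd.
have fc z : inbox a b c d z -> z != Complex x0 y0 -> {for z, continuous f}.
  by move=> zi zz; have /derivable1_diffP := fd z zi zz; exact: differentiable_continuous.
have hlc u v y : a <= u -> v <= b -> c <= y <= d -> y != y0 -> ccont (hl f y) u v.
  move=> au vb cyd yy t /andP[ut tv]; apply: (@continuous_comp R (CC R) (CC R)).
    exact: continuous_hline.
  apply: fc; first by split => //=; rewrite (le_trans au ut) (le_trans tv vb).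
  by rewrite eq_complex/= negb_and yy orbT.
have vlc u v x : c <= u -> v <= d -> a <= x <= b -> x != x0 -> ccont (vl f x) u v.
  move=> cu vd axb xx t /andP[ut tv]; apply: (@continuous_comp R (CC R) (CC R)).
    exact: continuous_vline.
  apply: fc; first by split => //=; rewrite (le_trans cu ut) (le_trans tv vd).
  by rewrite eq_complex/= negb_and xx.
have x1 : a <= x0 - h <= b by apply/andP; split; lra.
have x2 : a <= x0 + h <= b by apply/andP; split; lra.
have y1 : c <= y0 - h <= d by apply/andP; split; lra.
have y2 : c <= y0 + h <= d by apply/andP; split; lra.
have xa : a <= a <= b by apply/andP; split; lra.
have xb' : a <= b <= b by apply/andP; split; lra.
have yc : c <= c <= d by apply/andP; split; lra.
have yd' : c <= d <= d by apply/andP; split; lra.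
have nx1 : x0 - h != x0 by rewrite lt_eqF//; lra.
have nx2 : x0 + h != x0 by rewrite gt_eqF//; lra.
have ny1 : y0 - h != y0 by rewrite lt_eqF//; lra.
have ny2 : y0 + h != y0 by rewrite gt_eqF//; lra.
have nxa : a != x0 by rewrite lt_eqF//; lra.
have nxb : b != x0 by rewrite gt_eqF//; lra.
have nyc : c != y0 by rewrite lt_eqF//; lra.
have nyd : d != y0 by rewrite gt_eqF//; lra.
have zero a' b' c' d' : a <= a' -> a' <= b' -> b' <= b -> c <= c' -> c' <= d' -> d' <= d ->
   (b' < x0) || (x0 < a') || (d' < y0) || (y0 < c') -> box f a' b' c' d' = 0.
  move=> h1 h2 h3 h4 h5 h6 hh; apply: goursat => // -[x y] [/= /andP[u1 u2] /andP[u3 u4]].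
  apply: fd.
    split => /=; first by rewrite (le_trans h1 u1) (le_trans u2 h3).
    by rewrite (le_trans h4 u3) (le_trans u4 h6).
  apply/negP => /eqP[e1 e2]; move: u1 u2 u3 u4 hh; rewrite e1 e2 => u1 u2 u3 u4.
  by move=> /orP[/orP[/orP[]|]|]; lra.
have hlc' y : c <= y <= d -> y != y0 -> ccont (hl f y) (x0 - h) b.
  by move=> h1 h2; apply: hlc => //; lra.
have hlc2 y : c <= y <= d -> y != y0 -> ccont (hl f y) (x0 - h) (x0 + h).
  by move=> h1 h2; apply: hlc => //; lra.
have vlc2 x : a <= x <= b -> x != x0 -> ccont (vl f x) (y0 - h) d.
  by move=> h1 h2; apply: vlc => //; lra.
rewrite (@box_splitx_gen f a (x0 - h) b c d); [|lra|lra|exact: hlc|exact: hlc|exact: vlc|exact: vlc|exact: vlc].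
rewrite (zero a (x0 - h) c d); [|lra|lra|lra|lra|lra|lra|by apply/orP; left; apply/orP; left; apply/orP; left; lra].
rewrite add0r (@box_splitx_gen f (x0 - h) (x0 + h) b c d); [|lra|lra|exact: hlc'|exact: hlc'|exact: vlc|exact: vlc|exact: vlc].
rewrite (zero (x0 + h) b c d); [|lra|lra|lra|lra|lra|lra|by apply/orP; left; apply/orP; left; apply/orP; right; lra].
rewrite addr0 (@box_splity_gen f (x0 - h) (x0 + h) c (y0 - h) d); [|lra|lra|exact: vlc|exact: vlc|exact: hlc2|exact: hlc2|exact: hlc2].
rewrite (zero (x0 - h) (x0 + h) c (y0 - h)); [|lra|lra|lra|lra|lra|lra|by apply/orP; left; apply/orP; right; lra].
rewrite add0r (@box_splity_gen f (x0 - h) (x0 + h) (y0 - h) (y0 + h) d); [|lra|lra|exact: vlc2|exact: vlc2|exact: hlc2|exact: hlc2|exact: hlc2].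
rewrite (zero (x0 - h) (x0 + h) (y0 + h) d); [|lra|lra|lra|lra|lra|lra|by apply/orP; right; lra].
by rewrite addr0.
Qed.

Definition onbox a b c d (z : C) := inbox a b c d z /\
  [\/ complex.Re z = a, complex.Re z = b, complex.Im z = c | complex.Im z = d].

Lemma box_norm_le f a b c d (M : R) : a <= b -> c <= d ->
  (forall z, onbox a b c d z -> {for z, continuous f} /\ `|f z| <= M%:C%C) ->
  `|box f a b c d| <= (4 * M * ((b - a) + (d - c)))%:C%C.
Proof.
move=> ab cd fM.
have oc t : a <= t <= b -> onbox a b c d (Complex t c).
  by move=> tab; split; [split => //=; rewrite lexx|apply: Or43].
have od t : a <= t <= b -> onbox a b c d (Complex t d).
  by move=> tab; split; [split => //=; rewrite lexx cd|apply: Or44].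
have oa t : c <= t <= d -> onbox a b c d (Complex a t).
  by move=> tab; split; [split => //=; rewrite lexx|apply: Or41].
have ob t : c <= t <= d -> onbox a b c d (Complex b t).
  by move=> tab; split; [split => //=; rewrite lexx ab|apply: Or42].
have -> : 4 * M * ((b - a) + (d - c)) = 2 * (M + M) * (b - a) + 2 * (M + M) * (d - c) by ring.
rewrite (rmorphD _ (2 * (M + M) * (b - a))).
apply: (le_trans (ler_normD _ _)); apply: lerD.
  apply: (@cint_norm_le _ _ _ _ (M + M) ab) => t tab.
    apply: (@continuousB _ (CC R)); apply: (@continuous_comp R (CC R) (CC R)).
    - exact: continuous_hline.
    - by have [] := fM _ (oc _ tab).
    - exact: continuous_hline.
    - by have [] := fM _ (od _ tab).
  rewrite (rmorphD _ M); apply: (le_trans (ler_normB _ _)); apply: lerD.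
    by have [] := fM _ (oc _ tab).
  by have [] := fM _ (od _ tab).
rewrite normrM; have -> : `|'i%C : C| = 1 by rewrite normc_def/= expr0n expr1n add0r sqrtr1.
rewrite mul1r; apply: (@cint_norm_le _ _ _ _ (M + M) cd) => t tab.
  apply: (@continuousB _ (CC R)); apply: (@continuous_comp R (CC R) (CC R)).
  - exact: continuous_vline.
  - by have [] := fM _ (ob _ tab).
  - exact: continuous_vline.
  - by have [] := fM _ (oa _ tab).
rewrite (rmorphD _ M); apply: (le_trans (ler_normB _ _)); apply: lerD.
  by have [] := fM _ (ob _ tab).
by have [] := fM _ (oa _ tab).
Qed.

End CauchyEstimate.

(** * Lower bound for the winding integral and the Cauchy estimate *)

Section ZeroPropagation.
Context {R : realType}.
Local Notation C := (CC R).
Implicit Types (f g : C -> C) (a b c d : R).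

Lemma derivable_inv_sub (z0 z : C) : z != z0 -> derivable (fun w : C => (w - z0)^-1) z 1.
Proof.
move=> zz; have zz' : z - z0 != 0 by rewrite subr_eq0.
have d1 : derivable (fun w : C => w - z0) z 1.
  by apply: (@derivableB (CC R)); [exact: derivable_id|exact: derivable_cst].
exact: (@derivableV (CC R) _ (fun w => w - z0)).
Qed.

(** The exact value is 2 pi, but a crude bound avoids the arctangent: on a side
    [h / (u ^+ 2 + h ^+ 2)] is at least [1 / (2 * h)], so each pair of opposite sides, of length
    [2 * h], contributes at least 2. *)
Lemma winding_box (z0 : C) (h : R) : 0 < h ->
  4 <= complex.Im (box (fun z : C => (z - z0)^-1) (complex.Re z0 - h) (complex.Re z0 + h)
                        (complex.Im z0 - h) (complex.Im z0 + h)).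
Proof.
move=> h0; have : z0 = Complex (complex.Re z0) (complex.Im z0) by case: (z0).
move: (complex.Re z0) (complex.Im z0) => x0 y0 z0E.
pose F (z : C) := (z - Complex x0 y0)^-1.
have -> : (fun z : C => (z - z0)^-1) = F by rewrite z0E.
have Fc z : z != Complex x0 y0 -> {for z, continuous F}.
  by move=> zz; have /derivable1_diffP := derivable_inv_sub zz; exact: differentiable_continuous.
have FE (x y : R) : F (Complex x y) =
    Complex ((x - x0) / ((x - x0) ^+ 2 + (y - y0) ^+ 2)) (- (y - y0) / ((x - x0) ^+ 2 + (y - y0) ^+ 2)).
  by rewrite /F; apply/eqP; rewrite eq_complex/= mulNr !eqxx.
clearbody F.
have nh y x : y != y0 -> Complex x y != Complex x0 y0 by move=> yy; rewrite eq_complex/= negb_and yy orbT.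
have nv y x : x != x0 -> Complex x y != Complex x0 y0 by move=> yy; rewrite eq_complex/= negb_and yy.
have y1 : y0 - h != y0 by rewrite lt_eqF//; lra.
have y2 : y0 + h != y0 by rewrite gt_eqF//; lra.
have x1 : x0 - h != x0 by rewrite lt_eqF//; lra.
have x2 : x0 + h != x0 by rewrite gt_eqF//; lra.
have hc y u v : y != y0 -> ccont (fun x => F (Complex x y)) u v.
  move=> yy t _; apply: (@continuous_comp R (CC R) (CC R)); first exact: continuous_hline.
  by apply: Fc; apply: nh.
have vc x u v : x != x0 -> ccont (fun y => F (Complex x y)) u v.
  move=> yy t _; apply: (@continuous_comp R (CC R) (CC R)); first exact: continuous_vline.
  by apply: Fc; apply: nv.
have hd : ccont (fun x => F (Complex x (y0 - h)) - F (Complex x (y0 + h))) (x0 - h) (x0 + h).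
  by move=> t tt; apply: (@continuousB _ (CC R)); [exact: (hc _ _ _ y1 t tt)|exact: (hc _ _ _ y2 t tt)].
have vd : ccont (fun y => F (Complex (x0 + h) y) - F (Complex (x0 - h) y)) (y0 - h) (y0 + h).
  by move=> t tt; apply: (@continuousB _ (CC R)); [exact: (vc _ _ _ x2 t tt)|exact: (vc _ _ _ x1 t tt)].
have sq (u : R) : - h <= u <= h -> h^-1 <= h / (u ^+ 2 + h ^+ 2) + h / (u ^+ 2 + h ^+ 2).
  move=> /andP[u1 u2]; have u3 : u ^+ 2 <= h ^+ 2.
    by rewrite -(@real_normK _ u) ?num_real// ler_sqr ?nnegrE ?(ltW h0)// ler_norml u1.
  have p : 0 < u ^+ 2 + h ^+ 2 by rewrite ltr_wpDl ?sqr_ge0// exprn_gt0.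
  rewrite -mulrDl ler_pdivlMr// mulrC ler_pdivrMr//; rewrite expr2 in u3 *.
  by rewrite [h ^+ 2]expr2 in u3 *; lra.
rewrite /box raddfD.
have e2 : 2 = h^-1 * (x0 + h - (x0 - h)) by field; rewrite gt_eqF.
have e3 : 2 = h^-1 * (y0 + h - (y0 - h)) by field; rewrite gt_eqF.
have -> : (4 : R) = 2 + 2 by ring.
apply: lerD.
  rewrite e2; apply: cint_Im_ge; [lra|exact: hd|] => t /andP[t1 t2].
  rewrite !FE raddfB/= -!mulNr !opprK.
  have -> : y0 - h - y0 = - h by ring.
  have -> : y0 + h - y0 = h by ring.
  rewrite sqrrN opprK; apply: sq; lra.
have -> : 'i%C * cint (fun y => F (Complex (x0 + h) y) - F (Complex (x0 - h) y)) (y0 - h) (y0 + h)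
   = cint (fun y => 'i%C * (F (Complex (x0 + h) y) - F (Complex (x0 - h) y))) (y0 - h) (y0 + h).
  by rewrite cintZ.
rewrite e3; apply: cint_Im_ge; [lra| |].
  move=> t tt; apply: (@continuousM (CC R) R (cst 'i%C)); last exact: (vd t tt).
  exact: cst_continuous.
move=> t /andP[t1 t2]; rewrite !FE mulrC ImiRe raddfB/=.
have -> : x0 - h - x0 = - h by ring.
have -> : x0 + h - x0 = h by ring.
rewrite sqrrN -mulNr opprK addrC [h ^+ 2 + _]addrC; apply: sq; lra.
Qed.

Lemma box_subZ q u (k : C) a b c d : a <= b -> c <= d ->
  (forall z, onbox a b c d z -> {for z, continuous q}) ->
  (forall z, onbox a b c d z -> {for z, continuous u}) ->
  box (fun z => q z - k * u z) a b c d = box q a b c d - k * box u a b c d.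
Proof.
move=> ab cd qc uc.
have oc t : a <= t <= b -> onbox a b c d (Complex t c).
  by move=> tab; split; [split => //=; rewrite lexx|apply: Or43].
have od t : a <= t <= b -> onbox a b c d (Complex t d).
  by move=> tab; split; [split => //=; rewrite lexx cd|apply: Or44].
have oa t : c <= t <= d -> onbox a b c d (Complex a t).
  by move=> tab; split; [split => //=; rewrite lexx|apply: Or41].
have ob t : c <= t <= d -> onbox a b c d (Complex b t).
  by move=> tab; split; [split => //=; rewrite lexx ab|apply: Or42].
have hcc (F : C -> C) y : (forall z, onbox a b c d z -> {for z, continuous F}) ->
    (forall t, a <= t <= b -> onbox a b c d (Complex t y)) ->
    ccont (fun t => F (Complex t y)) a b.
  move=> Fc ty t tab; apply: (@continuous_comp R (CC R) (CC R)); first exact: continuous_hline.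
  by apply: Fc; apply: ty.
have vcc (F : C -> C) x : (forall z, onbox a b c d z -> {for z, continuous F}) ->
    (forall t, c <= t <= d -> onbox a b c d (Complex x t)) ->
    ccont (fun t => F (Complex x t)) c d.
  move=> Fc ty t tab; apply: (@continuous_comp R (CC R) (CC R)); first exact: continuous_vline.
  by apply: Fc; apply: ty.
have ku z : onbox a b c d z -> {for z, continuous (fun z => k * u z)}.
  move=> zo; apply: (@continuousM (CC R) (CC R) (cst k) u); last exact: uc.
  exact: cst_continuous.
have quc z : onbox a b c d z -> {for z, continuous (fun z => q z - k * u z)}.
  move=> zo; apply: (@continuousB (CC R) (CC R)); [exact: qc|exact: ku].
have gen F : (forall z, onbox a b c d z -> {for z, continuous F}) ->
     box F a b c d = cint (fun x => F (Complex x c)) a b - cint (fun x => F (Complex x d)) a b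
   + 'i%C * (cint (fun y => F (Complex b y)) c d - cint (fun y => F (Complex a y)) c d).
  move=> Fc; apply: boxE_gen; [exact: hcc|exact: hcc|exact: vcc|exact: vcc].
have hq y : (forall t, a <= t <= b -> onbox a b c d (Complex t y)) ->
   cint (fun x => q (Complex x y) - k * u (Complex x y)) a b =
   cint (fun x => q (Complex x y)) a b - k * cint (fun x => u (Complex x y)) a b.
  move=> ty; rewrite (cintB (hcc _ _ qc ty) (hcc _ _ ku ty)).
  by rewrite (cintZ k (hcc _ _ uc ty)).
have vq x : (forall t, c <= t <= d -> onbox a b c d (Complex x t)) ->
   cint (fun y => q (Complex x y) - k * u (Complex x y)) c d =
   cint (fun y => q (Complex x y)) c d - k * cint (fun y => u (Complex x y)) c d.
  move=> ty; rewrite (cintB (vcc _ _ qc ty) (vcc _ _ ku ty)).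
  by rewrite (cintZ k (vcc _ _ uc ty)).
rewrite (gen _ qc) (gen _ quc) (gen _ uc) (hq _ oc) (hq _ od) (vq _ oa) (vq _ ob).
by ring.
Qed.

Lemma onbox_norm_ge a b c d (z z0 : C) (h : R) : onbox a b c d z ->
  a <= complex.Re z0 - h -> complex.Re z0 + h <= b ->
  c <= complex.Im z0 - h -> complex.Im z0 + h <= d ->
  h%:C%C <= `|z - z0|.
Proof.
move=> [_ hz] h1 h2 h3 h4.
have [h'|h'] : h <= `|complex.Re (z - z0)| \/ h <= `|complex.Im (z - z0)|.
  rewrite !raddfB/=; case: hz => ->; [left|left|right|right]; rewrite ler_normr; apply/orP;
  [right|left|right|left]; lra.
- by apply: le_trans (normc_ge_Re _); rewrite lecR.
- by apply: le_trans (normc_ge_Im _); rewrite lecR.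
Qed.

(** This is Cauchy's formula weakened to an inequality. The integral of [q] over the large square is
    at most [16 * M * rho / dl]; on a small square around [z0] it is [g z0] times the winding
    integral, of modulus at least 4, up to an error controlled by the continuity of [g]. *)
Lemma cauchy_estimate g (rho M dl : R) (z0 : C) : 0 < dl ->
  - rho + dl <= complex.Re z0 <= rho - dl -> - rho + dl <= complex.Im z0 <= rho - dl ->
  (forall z, inbox (- rho) rho (- rho) rho z -> derivable g z 1) ->
  (forall z, onbox (- rho) rho (- rho) rho z -> `|g z| <= M%:C%C) ->
  `|g z0| <= (4 * M * rho / dl)%:C%C.
Proof.
move=> dl0 /andP[x1 x2] /andP[y1 y2] gd gM.
pose q (z : C) := g z * (z - z0)^-1.
have rho0 : 0 < rho by lra.
have dC z : inbox (- rho) rho (- rho) rho z -> {for z, continuous g}.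
  by move=> /gd/derivable1_diffP; exact: differentiable_continuous.
have invC z : z != z0 -> {for z, continuous (fun z : C => (z - z0)^-1)}.
  by move=> /derivable_inv_sub/derivable1_diffP; exact: differentiable_continuous.
have qd z : inbox (- rho) rho (- rho) rho z -> z != z0 -> derivable q z 1.
  by move=> zi zz; apply: (@derivableM (CC R)); [exact: gd|exact: derivable_inv_sub].
have z0in : inbox (- rho) rho (- rho) rho z0 by split; apply/andP; split; lra.
have rpos (u : C) (e : R) : 0 < e -> e%:C%C <= `|u| -> `|u|^-1 <= e^-1%:C%C.
  move=> e0 eu; have e0C : 0 < (e%:C%C : C) by rewrite ltcR.
  by rewrite fmorphV/= lef_pV2 ?posrE//; apply: lt_le_trans eu.
have big : `|box q (- rho) rho (- rho) rho| <= (4 * (M * dl^-1) * ((rho - - rho) + (rho - - rho)))%:C%C.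
  apply: box_norm_le; [lra|lra|] => z zo.
  have zf : dl%:C%C <= `|z - z0| by apply: (onbox_norm_ge zo); lra.
  have zz : z != z0.
    by apply/eqP => e; move: zf; rewrite e subrr normr0 lecR; lra.
  split; first by have /derivable1_diffP := qd z zo.1 zz; exact: differentiable_continuous.
  rewrite /q normrM normfV (rmorphM _ M); apply: (@ler_pM R[i]); [by []|by rewrite invr_ge0|exact: gM|exact: rpos].
apply/ler_addgt0Pl => e' /posC_real[e -> e0].
have e40 : 0 < ((e / 4)%:C%C : C) by rewrite ltcR divr_gt0.
have [d' /posC_real[d1 -> d10] hd] := continuous_eps (dC z0 z0in) e40.
(* The small square has half perimeter [4 * h], so [d1 / 8] keeps it where [g] is within [e / 4] of
   [g z0], while [dl / 2] keeps it inside the large square. *)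
pose h := Num.min (d1 / 8) (dl / 2).
have h0 : 0 < h by rewrite lt_min !divr_gt0.
have h1 : h <= d1 / 8 by rewrite ge_min lexx.
have h2 : h <= dl / 2 by rewrite ge_min lexx orbT.
have hole : box q (- rho) rho (- rho) rho = box q (complex.Re z0 - h) (complex.Re z0 + h)
                        (complex.Im z0 - h) (complex.Im z0 + h).
  by apply: box_hole; [exact: h0|lra|lra|lra|lra|exact: qd].
have W4 := @winding_box z0 h h0.
move: hole W4; clearbody h.
have [a aE] : exists a, a = complex.Re z0 - h by eexists.
have [b bE] : exists a, a = complex.Re z0 + h by eexists.
have [c cE] : exists a, a = complex.Im z0 - h by eexists.
have [d dE] : exists a, a = complex.Im z0 + h by eexists.
rewrite -aE -bE -cE -dE.
set W := box (fun z : C => (z - z0)^-1) a b c d => hole W4.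
pose k (z : C) := q z - g z0 * (z - z0)^-1.
have ab : a <= b by lra.
have cd : c <= d by lra.
have small_in z : inbox a b c d z -> inbox (- rho) rho (- rho) rho z.
  by move=> [/andP[u1 u2] /andP[u3 u4]]; split; apply/andP; split; lra.
have far z : onbox a b c d z -> h%:C%C <= `|z - z0|.
  by move=> zo; apply: (onbox_norm_ge zo); lra.
have onz z : onbox a b c d z -> z != z0.
  by move=> zo; apply/eqP => ez; move: (far _ zo); rewrite ez subrr normr0 lecR; lra.
have ic z : onbox a b c d z -> {for z, continuous (fun z : C => (z - z0)^-1)}.
  by move=> /onz; exact: invC.
have qc z : onbox a b c d z -> {for z, continuous q}.
  move=> zo; have /derivable1_diffP := qd z (small_in _ zo.1) (onz _ zo).
  exact: differentiable_continuous.
have kc z : onbox a b c d z -> {for z, continuous k}.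
  move=> zo; apply: (@continuousB (CC R) (CC R)); first exact: qc.
  apply: (@continuousM (CC R) (CC R) (cst (g z0))); last exact: ic.
  exact: cst_continuous.
have kb : `|box k a b c d| <= (4 * (e / 4 * h^-1) * ((b - a) + (d - c)))%:C%C.
  apply: (@box_norm_le _ k a b c d _ ab cd) => z zo; split; first exact: kc.
  have -> : k z = (g z - g z0) * (z - z0)^-1 by rewrite /k /q mulrBl.
  rewrite normrM normfV (rmorphM _ (e / 4)).
  apply: (@ler_pM R[i]); [by []|by rewrite invr_ge0| |by apply: rpos; [|exact: far]].
  rewrite distrC; apply: hd.
  have z0s : inbox a b c d z0 by split; apply/andP; split; lra.
  by apply: (le_lt_trans (inbox_dist z0s zo.1)); rewrite ltcR; lra.
have qE : box k a b c d = box q a b c d - g z0 * W by apply: (box_subZ (g z0) ab cd qc ic).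
have {}W4 : (4%:C)%C <= `|W|.
  by apply: le_trans (normc_ge_Im _); rewrite lecR; apply: le_trans (ler_norm _).
have gW : g z0 * W = box q (- rho) rho (- rho) rho - box k a b c d by rewrite hole qE; ring.
have : `|g z0| * (4%:C)%C <= (4 * (M * dl^-1) * ((rho - - rho) + (rho - - rho)) + 4 * (e / 4 * h^-1) * ((b - a) + (d - c)))%:C%C.
  apply: (@le_trans _ _ `|g z0 * W|); first by rewrite normrM ler_wpM2l.
  rewrite gW (rmorphD _ (4 * (M * dl^-1) * _)).
  by apply: (le_trans (ler_normB _ _)); apply: (@lerD R[i]).
have -> : 4 * (M * dl^-1) * ((rho - - rho) + (rho - - rho)) + 4 * (e / 4 * h^-1) * ((b - a) + (d - c))
   = (e + 4 * M * rho / dl) * 4.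
  by rewrite aE bE cE dE; field; apply/andP; split; rewrite gt_eqF.
rewrite (rmorphM _ (e + 4 * M * rho / dl)) (@ler_pM2r R[i]) ?ltcR//.
by rewrite (rmorphD _ e).
Qed.

End ZeroPropagation.

(** * Identity theorem in one variable *)

Section IdentityTheorem.
Context {R : realType}.
Local Notation C := (CC R).

Lemma normcE_Re (z : C) : `|z| = (complex.Re `|z|)%:C%C.
Proof. by rewrite RRe_real// normr_real. Qed.

Lemma line_norm_bounded (l : R -> C) (f : C -> C) a b : a <= b -> continuous l ->
  (forall t, a <= t <= b -> {for l t, continuous f}) ->
  exists M : R, forall t, a <= t <= b -> `|f (l t)| <= M%:C%C.
Proof.
move=> ab lc fc.
have gc : {within `[a, b], continuous (fun t => complex.Re `|f (l t)|)}.
  apply/continuous_in_subspaceT => t; rewrite inE/= in_itv/= => tab.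
  apply: (@continuous_comp R (CC R) R (fun t => `|f (l t)|) (@complex.Re R)); last exact: continuous_Re.
  apply: (@continuous_comp R (CC R) (CC R) (f \o l) (fun z => `|z|)); last exact: (@norm_continuous (CC R) (CC R)).
  by apply: (@continuous_comp R (CC R) (CC R)); [exact: lc|exact: fc].
have [c _ cM] := EVT_max ab gc.
exists (complex.Re `|f (l c)|) => t tab; rewrite normcE_Re lecR; apply: cM.
by rewrite in_itv.
Qed.

Lemma le_sum4norm (a b c d : R) (M := `|a| + `|b| + `|c| + `|d|) :
  [/\ a <= M, b <= M, c <= M & d <= M].
Proof.
have a1 := ler_norm a; have b1 := ler_norm b; have c1 := ler_norm c; have d1 := ler_norm d.
have a0 := normr_ge0 a; have b0 := normr_ge0 b; have c0 := normr_ge0 c; have d0 := normr_ge0 d.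
by rewrite /M; split; lra.
Qed.

Lemma derivable_exprV (K : numFieldType) n (z : K) : z != 0 ->
  derivable (fun z : K => (z ^+ n)^-1) z 1.
Proof.
move=> z0; have zn : z ^+ n != 0 by rewrite expf_neq0.
exact: (@derivableV K K (fun z : K => z ^+ n) z 1 zn (@exprn_derivable K n z 1)).
Qed.

(** Division by [z ^+ n] leaves the value at 1 unchanged but multiplies the bound on the boundary,
    where the modulus of [z] is at least 2, by [2 ^- n]. The Cauchy estimate then makes [f 1]
    arbitrarily small; no power series is involved. *)
Lemma zero_at_one (f : C -> C) (e : C) : 0 < e ->
  (forall z, inbox (-2) 2 (-2) 2 z -> derivable f z 1) ->
  (forall z, `|z| < e -> f z = 0) -> f 1 = 0.
Proof.
have ab : (-2 : R) <= 2 by lra.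
have e1 : ((-2 : R) <= -2) && ((-2 : R) <= 2) by apply/andP; split; lra.
have e2 : ((-2 : R) <= 2) && ((2 : R) <= 2) by apply/andP; split; lra.
have e3 : (-2 : R) <= -1 by lra.
move=> e0 fd f0.
have fc z : inbox (-2) 2 (-2) 2 z -> {for z, continuous f}.
  by move=> /fd/derivable1_diffP; exact: differentiable_continuous.
have ii (x y : R) : -2 <= x <= 2 -> -2 <= y <= 2 -> inbox (-2) 2 (-2) 2 (Complex x y : C) by [].
have [M1 h1] := line_norm_bounded ab (@continuous_hline R (-2)) (fun t tt => fc _ (ii t (-2) tt e1)).
have [M2 h2] := line_norm_bounded ab (@continuous_hline R 2) (fun t tt => fc _ (ii t 2 tt e2)).
have [M3 h3] := line_norm_bounded ab (@continuous_vline R (-2)) (fun t tt => fc _ (ii (-2) t e1 tt)).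
have [M4 h4] := line_norm_bounded ab (@continuous_vline R 2) (fun t tt => fc _ (ii 2 t e2 tt)).
pose M := `|M1| + `|M2| + `|M3| + `|M4|.
have M0 : 0 <= M by rewrite !addr_ge0.
have fM z : onbox (-2) 2 (-2) 2 z -> `|f z| <= M%:C%C.
  have [l1 l2 l3 l4] := le_sum4norm M1 M2 M3 M4.
  case: z => x y [[/= xx yy]] /= [] E; rewrite E in xx yy *.
  - by apply: (le_trans (h3 _ yy)); rewrite lecR.
  - by apply: (le_trans (h4 _ yy)); rewrite lecR.
  - by apply: (le_trans (h1 _ xx)); rewrite lecR.
  - by apply: (le_trans (h2 _ xx)); rewrite lecR.
have bnd n : `|f 1| <= (8 * M / 2 ^+ n)%:C%C.
  pose g (z : C) := (z ^+ n)^-1 * f z.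
  have -> : f 1 = g 1 by rewrite /g expr1n invr1 mul1r.
  have -> : 8 * M / 2 ^+ n = 4 * (M / 2 ^+ n) * 2 / 1.
    by field; rewrite expf_eq0 andbC pnatr_eq0.
  have re1 : (- 2 + 1 <= complex.Re (1 : C) <= 2 - 1).
    by rewrite -[complex.Re (1 : C)]/(1 : R); apply/andP; split; lra.
  have im1 : (- 2 + 1 <= complex.Im (1 : C) <= 2 - 1).
    by rewrite -[complex.Im (1 : C)]/(0 : R); apply/andP; split; lra.
  apply: (@cauchy_estimate R g 2 (M / 2 ^+ n) 1 1 ltr01 re1 im1).
  (* Near 0 the function [g] vanishes together with [f], whatever the inverse of 0 is. *)
  - move=> z zi; have [z0|z0] := eqVneq z 0.
      apply: (@near_eq_derivable (CC R) (CC R) (CC R) (cst 0)); last exact: derivable_cst.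
      rewrite z0; apply: filterS (near_dist_le (0 : C) (_ : 0 < e / 2)); last by rewrite divr_gt0.
      move=> w; rewrite sub0r normrN /g => we; rewrite f0 ?mulr0//.
      by apply: (le_lt_trans we); rewrite ltr_pdivrMr// ltr_pMr// ltr1n.
    apply: (@derivableM (CC R)); last exact: fd.
    exact: derivable_exprV.
  - move=> z zo; rewrite /g normrM normfV normrX (rmorphM _ M) mulrC.
    apply: (@ler_pM R[i]); [exact: normr_ge0|by rewrite invr_ge0 exprn_ge0|exact: fM|].
    have z2 : (2%:C)%C <= `|z|.
      have := @onbox_norm_ge R (-2) 2 (-2) 2 z 0 2 zo; rewrite subr0; apply => /=; lra.
    have p2 : 0 < ((2%:C)%C : C) by rewrite ltcR.
    rewrite fmorphV rmorphXn/= lef_pV2 ?posrE ?exprn_gt0//; last exact: lt_le_trans z2.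
    by rewrite lerXn2r ?nnegrE// ltW.
apply/eqP; rewrite -normr_le0; apply/ler_addgt0Pl => _ /posC_real[d -> d0].
rewrite addr0; have [n hn] := pow2_small (8 * M) d0.
by apply: (le_trans (bnd n)); rewrite lecR ltW.
Qed.

End IdentityTheorem.

(** The points 0 and 1 stand for the ends of a segment after reparametrisation, and the radius 4
    covers the square of side 4 used for the complex numbers. *)
Definition zero_propagation (K : numFieldType) := forall (f : K -> K) (e : K),
  0 < e -> (forall z, `|z| <= 4 -> derivable f z 1) ->
  (forall z, `|z| < e -> f z = 0) -> f 1 = 0.

Lemma complex_zero_propagation (R : realType) : zero_propagation (CC R).
Proof.
move=> f e e0 fd f0; apply: (zero_at_one e0) => // z [/andP[h1 h2] /andP[h3 h4]].
apply: fd; have -> : (4 : CC R) = (2 + 2 : R)%:C%C.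
  by rewrite rmorphD/= !rmorph_nat -natrD.
by apply: norm_le_ReIm; rewrite ler_norml; apply/andP; split.
Qed.

(** * Propagation of zeros in normed spaces *)

Section GenericIdentity.
Context {K : numFieldType}.
Hypothesis zp : zero_propagation K.

Lemma derivable_line (V : normedModType K) (f : V -> K) (a v : V) (t : K) :
  derivable f (a + t *: v) v -> derivable (fun s : K => f (a + s *: v)) t 1.
Proof.
rewrite /derivable => fd.
have -> : (fun h : K => h^-1 *: (((fun s : K => f (a + s *: v)) \o shift t) (h *: (1 : K)) - f (a + t *: v)))
  = (fun h : K => h^-1 *: ((f \o shift (a + t *: v)) (h *: v) - f (a + t *: v))).
  apply/funext => h /=; congr (_ *: (f _ - _)).
  by rewrite [h *: 1]mulr1 scalerDl addrCA addrA.
exact: fd.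
Qed.

Lemma derive_line (V : normedModType K) (f : V -> K) (a v : V) (t : K) :
  'D_1 (fun s : K => f (a + s *: v)) t = 'D_v f (a + t *: v).
Proof.
rewrite /derive.
have -> : (fun h : K => h^-1 *: (((fun s : K => f (a + s *: v)) \o shift t) (h *: (1 : K)) - f (a + t *: v)))
  = (fun h : K => h^-1 *: ((f \o shift (a + t *: v)) (h *: v) - f (a + t *: v))).
  apply/funext => h /=; congr (_ *: (f _ - _)).
  by rewrite [h *: 1]mulr1 scalerDl addrCA addrA.
by [].
Qed.

Lemma zero_prop_line (V : normedModType K) (f : V -> K) (a b : V) :
  (forall t, `|t| <= 4 -> derivable f (a + t *: (b - a)) (b - a)) ->
  (exists2 e, 0 < e & forall t, `|t| < e -> f (a + t *: (b - a)) = 0) -> f b = 0.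
Proof.
move=> fd [e e0 f0]; have := @zp (fun t => f (a + t *: (b - a))) e e0.
rewrite scale1r (addrC a) subrK; apply => // z z4.
by apply: derivable_line; apply: fd.
Qed.

(** For parameters of modulus at most 4, the line through [a] and [b] stays within
    [r + 4 * (2 * r) = 9 * r] of [x], inside the ball of radius [16 * r]. *)
Lemma zero_prop_ball (V : normedModType K) (f : V -> K) (x a b : V) (r : K) :
  (forall z v, `|z - x| < 16 * r -> derivable f z v) ->
  `|a - x| < r -> `|b - x| < r -> (\near a, f a = 0) -> f b = 0.
Proof.
move=> fd ax bx /nbhs_ballP[e /= e0 he].
have r0 : 0 < r by apply: le_lt_trans ax.
have ba : `|b - a| <= 2 * r.
  have -> : b - a = (b - x) - (a - x) by rewrite opprB addrA subrK.
  by rewrite mulr_natl mulr2n (le_trans (ler_normB _ _))// lerD// ltW.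
apply: (@zero_prop_line _ _ a b).
  move=> t t4; apply: fd.
  have -> : a + t *: (b - a) - x = (a - x) + t *: (b - a) by rewrite addrAC.
  apply: (@le_lt_trans _ _ (`|a - x| + `|t *: (b - a)|)); first exact: ler_normD.
  apply: (@lt_le_trans _ _ (r + 8 * r)); last first.
    have -> : r + 8 * r = 9 * r by ring.
    by rewrite ler_pM2r// ler_nat.
  apply: ltr_leD => //; rewrite normrZ.
  have -> : 8 * r = 4 * (2 * r) by rewrite mulrA -natrM.
  by apply: ler_pM.
exists (e / (2 * r)); first by rewrite divr_gt0// mulr_gt0.
move=> t te; apply: he; rewrite -ball_normE/= opprD addrA subrr sub0r normrN normrZ.
have [->|t0] := eqVneq t 0; first by rewrite normr0 mul0r.
rewrite ltr_pdivlMr ?mulr_gt0// in te.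
by apply: le_lt_trans te; rewrite ler_pM2l// normr_gt0.
Qed.

(** The points of [U] near which [P] holds form an open set. It is relatively closed because the
    radius depends on the limit point [z] and not on the nearby point [a]. *)
Lemma connected_propagation (V : normedModType K) (U : set V) (P : V -> Prop) :
  connected U ->
  (forall z, U z -> exists2 r, 0 < r &
     forall a, ball z r a -> U a -> (\near a, P a) -> forall b, ball z r b -> P b) ->
  (exists2 z, U z & \near z, P z) -> forall z, U z -> P z.
Proof.
move=> Uc loc [z0 Uz0 Pz0] z Uz.
pose A := [set z | U z /\ \near z, P z].
have AU : A = U.
  apply: Uc; first by exists z0.
    exists (interior [set z | P z]); first exact: open_interior.
    by apply/seteqP; split => y [].
  exists (closure A); first exact: closed_closure.
  apply/seteqP; split => [y Ay|y [Uy Ay]]; first by split; [case: Ay|exact: subset_closure].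
  split=> //; have [r r0 hr] := loc _ Uy.
  have [a [[Ua Pa] ya]] := Ay _ (nbhsx_ballx y r r0).
  by apply: filterS (nbhsx_ballx y r r0); exact: hr ya Ua Pa.
have /= [] : A z by rewrite AU.
by move=> _ /nbhs_singleton.
Qed.

End GenericIdentity.

Section Derivable1.
Context {K : numFieldType}.

Lemma derivable_dir (f : K -> K) (x v : K) : derivable f x 1 -> derivable f x v.
Proof. by move=> /derivable1_diffP; exact: diff_derivable. Qed.

(* Composing with a Lipschitz map keeps the derivative zero, so the propagation of
   zeros applies to a radial reparametrisation that is constant near the origin. *)
Lemma derive0_const (zp : zero_propagation K) (g : K -> K) (d : K) :
  (forall t : K, `|t| < d -> is_derive t 1 g 0) -> forall t, `|t| < d / 8 -> g t = g 0.
Proof.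
move=> gd t td.
have d0 : 0 < d by have := le_lt_trans (normr_ge0 t) td; rewrite pmulr_lgt0// invr_gt0.
(* Twice the positive part of [|z| - 1/2]: it is 0 near the origin, 1 at 1, 2-Lipschitz, and at most
   8 in modulus for [|z| <= 4], whence the [d / 8]. *)
pose rad (z : K) : K := (`|z| - 2^-1) + `| `|z| - 2^-1 |.
have radL (z q : K) : `|rad z - rad q| <= 2 * `|z - q|.
  have -> : rad z - rad q = (`|z| - `|q|) + (`| `|z| - 2^-1 | - `| `|q| - 2^-1 |).
    by rewrite /rad; ring.
  apply: le_trans (ler_normD _ _) _; rewrite mulr_natl mulr2n lerD//.
    exact: ler_dist_dist.
  apply: le_trans (ler_dist_dist _ _) _.
  have -> : `|z| - 2^-1 - (`|q| - 2^-1) = `|z| - `|q| by ring.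
  exact: ler_dist_dist.
have h2 : (0 : K) < 2^-1 by rewrite invr_gt0.
have rad0 z : `|z| < 2^-1 -> rad z = 0.
  by move=> z2; rewrite /rad distrC [X in _ + X]gtr0_norm ?subr_gt0//; ring.
have rad1 : rad 1 = 1.
  rewrite /rad normr1 ger0_norm; first by field.
  by rewrite subr_ge0 invf_le1// ler1n.
have rad8 z : `|z| <= 4 -> `|rad z * t| < d.
  move=> z4; rewrite normrM; apply: (@le_lt_trans _ _ (8 * `|t|)); last first.
    by rewrite mulrC -ltr_pdivlMr.
  apply: ler_wpM2r => //; have -> : rad z = rad z - rad 0 by rewrite (rad0 0) ?subr0// normr0.
  apply: le_trans (radL _ _) _; rewrite subr0.
  have -> : (8 : K) = 2 * 4 by rewrite -natrM.
  by rewrite ler_pM2l.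
have := @zp (fun z => g (rad z * t) - g 0) 2^-1 h2.
rewrite rad1 mul1r => H; apply/eqP; rewrite -subr_eq0; apply/eqP; apply: H; last first.
  by move=> z /rad0 ->; rewrite mul0r subrr.
move=> z z4; have [gd1 gd2] := gd _ (rad8 _ z4).
suff [] : is_derive z 1 (fun z => g (rad z * t) - g 0) 0 by [].
apply: expand_is_derive => e e0.
have t1 : 0 < 2 * `|t| + 1 by rewrite ltr_wpDl// mulr_ge0.
have e1 : 0 < e / (2 * `|t| + 1) by rewrite divr_gt0.
have [dd dd0 hdd] := derivable_expand gd1 e1.
exists (dd / (2 * `|t| + 1)); first by rewrite divr_gt0.
move=> w wz; rewrite ltr_pdivlMr// in wz.
have rw : `|rad w * t - rad z * t| <= `|w - z| * (2 * `|t|).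
  rewrite -mulrBl normrM; apply: le_trans (ler_wpM2r (normr_ge0 t) (radL w z)) _.
  by rewrite -mulrA mulrCA.
have rw1 : `|rad w * t - rad z * t| <= `|w - z| * (2 * `|t| + 1).
  by apply: le_trans rw _; apply: ler_wpM2l => //; rewrite lerDl.
have := hdd (rad w * t) (le_lt_trans rw1 wz).
rewrite gd2 !mul0r !subr0 opprB addrA subrK => h.
apply: le_trans h _; apply: le_trans (ler_wpM2l (ltW e1) rw1) _.
rewrite le_eqVlt; apply/orP; left; apply/eqP; field; by rewrite gt_eqF.
Qed.

End Derivable1.

(** * Functions vanishing on a real segment *)

Section RealZero.
Context {K : numClosedFieldType}.
Hypothesis zp : zero_propagation K.

Lemma normC_ge_Im (z : K) : `|'Im z| <= `|z|.
Proof.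
rewrite -(@ler_sqr K) ?nnegrE// [leRHS]normC2_Re_Im real_normK ?Creal_Im//.
by rewrite lerDr real_exprn_even_ge0// Creal_Re.
Qed.

Let glue (g : K -> K) (w : K) : K := if 0 < 'Im w then g w else 0.

(* Gluing along the real line is compatible with bare complex differentiability
   because the derivative of [g] vanishes at its non-isolated zeros. *)
Lemma derivable_glue (g : K -> K) (r w : K) :
  (forall z, `|z| < r -> derivable g z 1) ->
  (forall x, x \is Num.real -> `|x| < r -> g x = 0) ->
  `|w| < r -> derivable (glue g) w 1.
Proof.
move=> gd g0 wr.
have ImB (u v : K) : `|'Im u - 'Im v| <= `|u - v| by rewrite -raddfB normC_ge_Im.
have near_Im (e : K) : 0 < e -> \forall u \near w, `|'Im w - 'Im u| < e.
  move=> e0; have e2 : 0 < e / 2 by rewrite divr_gt0.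
  apply: filterS (near_dist_le w e2) => u wu; apply: le_lt_trans (ImB _ _) _.
  by apply: le_lt_trans wu _; rewrite ltr_pdivrMr// ltr_pMr// ltr1n.
have [wi|wi|wi] := real_ltgtP (Creal_Im w) (real0 K).
- have wi' : 0 < - 'Im w by rewrite oppr_gt0.
  apply: (@near_eq_derivable K K K (cst 0)); last exact: derivable_cst.
  apply: filterS (near_Im _ wi') => u; rewrite /glue.
  rewrite real_ltr_norml ?rpredB ?Creal_Im// => /andP[h _]; move: h.
  rewrite opprK ltrBrDr -subr_gt0 opprD addrA subrr add0r oppr_gt0 => h.
  by rewrite lt_gtF.
- apply: (@near_eq_derivable K K K g); last exact: gd.
  apply: filterS (near_Im _ wi) => u; rewrite /glue.
  rewrite real_ltr_norml ?rpredB ?Creal_Im// => /andP[_].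
  by rewrite ltrBlDl -subr_gt0 addrK => ->.
have wR : w \is Num.real by apply/Creal_ImP.
have gw : g w = 0 by apply: g0.
have /derivable_epsP[k hk] := gd _ wr.
have k0 : k = 0.
  apply/eqP; rewrite -normr_le0; apply/ler_addgt0Pl => e e0; rewrite addr0.
  have [d d0 hd] := hk _ e0.
  have rw : 0 < r - `|w| by rewrite subr_gt0.
  have [m [m0 md mr]] : exists m : K, [/\ 0 < m, m < d & m < r - `|w|].
    have c : d >=< (r - `|w|) by rewrite real_comparable// gtr0_real.
    have m0 : 0 < Order.min d (r - `|w|) by case: (comparable_leP c).
    exists (Order.min d (r - `|w|) / 2); split; first by rewrite divr_gt0.
      rewrite ltr_pdivrMr//; apply: (@le_lt_trans _ _ d); last by rewrite ltr_pMr// ltr1n.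
      by case: (comparable_leP c) => // /ltW.
    rewrite ltr_pdivrMr//; apply: (@le_lt_trans _ _ (r - `|w|)); last by rewrite ltr_pMr// ltr1n.
    by case: (comparable_leP c).
  have := hd (w + m); rewrite addrAC subrr add0r gtr0_norm// => /(_ md).
  have wmR : w + m \is Num.real by rewrite rpredD//; exact: gtr0_real.
  rewrite (g0 _ wmR); last first.
    apply: le_lt_trans (ler_normD _ _) _; rewrite (gtr0_norm m0).
    by rewrite -ltrBrDl.
  rewrite gw subrr sub0r normrN normrM (gtr0_norm m0).
  by rewrite ler_pM2r.
apply/derivable_epsP; exists 0 => e /hk[d d0 hd]; exists d => // z zw.
have := hd z zw; rewrite k0 gw !mul0r !subr0 => h.
have -> : glue g w = 0 by rewrite /glue wi ltxx.
rewrite subr0 /glue; case: ifP => // _; rewrite normr0.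
by apply: le_trans h.
Qed.

(** The function equal to [f] above the real line and to 0 elsewhere is still differentiable. It
    vanishes around [- 'i * (r / 2)], so the zeros propagate to the upper half of the disc; the
    lower half follows by [z |-> - z]. *)
Lemma zero_on_reals (f : K -> K) (r : K) :
  (forall z, `|z| < 16 * r -> derivable f z 1) ->
  (forall x, x \is Num.real -> `|x| < 16 * r -> f x = 0) ->
  forall z, `|z| < r -> f z = 0.
Proof.
have half (g : K -> K) :
  (forall z, `|z| < 16 * r -> derivable g z 1) ->
  (forall x, x \is Num.real -> `|x| < 16 * r -> g x = 0) ->
  forall z, `|z| < r -> 0 < 'Im z -> g z = 0.
  move=> gd g0 z zr zi.
  have r0 : 0 < r by apply: le_lt_trans zr.
  have <- : glue g z = g z by rewrite /glue zi.
  have r2 : 0 < r / 2 by rewrite divr_gt0.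
  have r2r : r / 2 < r by rewrite ltr_pdivrMr// ltr_pMr// ltr1n.
  have Ima : 'Im (- 'i * (r / 2)) = - (r / 2).
    have -> : - 'i * (r / 2) = 0 + 'i * (- (r / 2)) by rewrite add0r mulrN mulNr.
    by rewrite Im_rect ?real0// rpredN gtr0_real.
  apply: (@zero_prop_ball K zp K (glue g) 0 (- 'i * (r / 2)) z r).
  - move=> w v; rewrite subr0 => wr; apply: derivable_dir.
    exact: derivable_glue gd g0 wr.
  - by rewrite subr0 normrM normrN normCi mul1r gtr0_norm.
  - by rewrite subr0.
  - have r4 : 0 < r / 4 by rewrite divr_gt0.
    apply: filterS (near_dist_le (- 'i * (r / 2)) r4) => u hu.
    rewrite /glue ifF//; apply/negbTE; rewrite -real_leNgt ?Creal_Im//.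
    have := le_trans (normC_ge_Im _) hu; rewrite raddfB/= Ima.
    rewrite real_ler_norml ?rpredB ?rpredN ?Creal_Im ?gtr0_real// => /andP[h _].
    move: h; rewrite lerBrDl => h.
    have : 'Im u <= - (r / 2) + r / 4 by rewrite -lerBlDr.
    move=> h'; apply: le_trans h' _; rewrite addrC subr_le0 ler_pM2l// lef_pV2 ?posrE//.
    by rewrite ler_nat.
move=> fd f0 z zr.
have r0 : 0 < r by apply: le_lt_trans zr.
have [zi|zi|zi] := real_ltgtP (Creal_Im z) (real0 K).
- have -> : f z = (f \o -%R) (- z) by rewrite /= opprK.
  apply: half => [w wr|x xR xr| |]; rewrite ?normrN//.
  + apply/derivable1_diffP; apply: differentiable_comp; first exact: differentiableN.
    by apply/derivable1_diffP; apply: fd; rewrite normrN.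
  + by rewrite /= f0 ?rpredN ?normrN.
  + by rewrite raddfN/= oppr_gt0.
- exact: half.
apply: f0; first exact/Creal_ImP.
by apply: lt_le_trans zr _; rewrite ler_peMl ?ler1n// ltW.
Qed.

End RealZero.

(** * Hermitian forms and isotropic subspaces *)

Section HermitianForm.
Context {K : numClosedFieldType}.

(** The dimension is independent of [r] and [s]: besides the forms of the theorem, [hf n 0] is then
    the standard Hermitian product, which reads off coordinates. *)
Definition hf (r s : nat) n (z w : 'rV[K]_n) : K :=
  \sum_(j < n) (if (j < r)%N then 1 else if (j < r + s)%N then -1 else 0) * z ord0 j * (w ord0 j)^*.

Definition sgn_mx (r s n : nat) : 'M[K]_n :=
  diag_mx (\row_j (if (j < r)%N then 1 else if (j < r + s)%N then -1 else 0)).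

Definition adj m n (A : 'M[K]_(m, n)) : 'M[K]_(n, m) := (map_mx Num.conj A)^T.

Lemma adjK m n : cancel (@adj m n) (@adj n m).
Proof. by move=> A; apply/matrixP => i j; rewrite !mxE conjCK. Qed.

Lemma adjM m n p (A : 'M[K]_(m, n)) (B : 'M[K]_(n, p)) : adj (A *m B) = adj B *m adj A.
Proof. by rewrite /adj map_mxM trmx_mul. Qed.

Lemma adjD m n (A B : 'M[K]_(m, n)) : adj (A + B) = adj A + adj B.
Proof. by apply/matrixP => i j; rewrite !mxE rmorphD. Qed.

Lemma adjZ m n c (A : 'M[K]_(m, n)) : adj (c *: A) = c^* *: adj A.
Proof. by apply/matrixP => i j; rewrite !mxE rmorphM. Qed.

Lemma adj1 n : adj (1%:M : 'M[K]_n) = 1%:M.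
Proof. by rewrite /adj map_mx1 trmx1. Qed.

Variables (r s : nat).
Local Notation Q := (hf r s).
Local Notation J n := (sgn_mx r s n).

Lemma hf_mx n (z w : 'rV[K]_n) : Q z w = (z *m J n *m adj w) ord0 ord0.
Proof.
rewrite mxE; apply: eq_bigr => j _; rewrite mul_mx_diag !mxE.
by congr (_ * _); rewrite mulrC.
Qed.

Lemma hf_row k n (X : 'M[K]_(k, n)) m (Y : 'M[K]_(m, n)) i j :
  (X *m J n *m adj Y) i j = Q (row i X) (row j Y).
Proof.
rewrite hf_mx -!row_mul [RHS]mxE [RHS]mxE [LHS]mxE.
by apply: eq_bigr => l _; rewrite !mxE.
Qed.
Lemma hfC n (z w : 'rV[K]_n) : Q w z = (Q z w)^*.
Proof.
rewrite /hf rmorph_sum; apply: eq_bigr => j _; rewrite !rmorphM/= conjCK.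
rewrite mulrAC; congr (_ * _ * _).
by case: ifP => _; [rewrite rmorph1|case: ifP => _; rewrite ?rmorphN ?rmorph1 ?rmorph0].
Qed.

Lemma hf_eq0C n (z w : 'rV[K]_n) : (Q w z == 0) = (Q z w == 0).
Proof. by rewrite hfC conjC_eq0. Qed.

Lemma hf_orthC n k m (X : 'M[K]_(k, n)) (Y : 'M[K]_(m, n)) :
  X *m J n *m adj Y = 0 -> Y *m J n *m adj X = 0.
Proof.
move=> XY; apply/matrixP => i j; rewrite hf_row [RHS]mxE hfC.
by rewrite -hf_row XY mxE rmorph0.
Qed.

Lemma hfDl n (a b w : 'rV[K]_n) : Q (a + b) w = Q a w + Q b w.
Proof. by rewrite !hf_mx !mulmxDl mxE. Qed.

Lemma hfZl n c (a w : 'rV[K]_n) : Q (c *: a) w = c * Q a w.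
Proof. by rewrite !hf_mx -!scalemxAl mxE. Qed.

Lemma hf0l n (w : 'rV[K]_n) : Q 0 w = 0.
Proof. by rewrite hf_mx !mul0mx mxE. Qed.

Lemma hfNl n (a w : 'rV[K]_n) : Q (- a) w = - Q a w.
Proof. by rewrite -scaleN1r hfZl mulN1r. Qed.

Lemma hfBl n (a b w : 'rV[K]_n) : Q (a - b) w = Q a w - Q b w.
Proof. by rewrite hfDl hfNl. Qed.

Lemma hfDr n (w a b : 'rV[K]_n) : Q w (a + b) = Q w a + Q w b.
Proof. by rewrite hfC hfDl rmorphD/= -!hfC. Qed.

Lemma hfZr n c (w a : 'rV[K]_n) : Q w (c *: a) = c^* * Q w a.
Proof. by rewrite hfC hfZl rmorphM/= -hfC. Qed.

Lemma hfNr n (w a : 'rV[K]_n) : Q w (- a) = - Q w a.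
Proof. by rewrite hfC hfNl rmorphN/= -hfC. Qed.

Lemma hfBr n (w a b : 'rV[K]_n) : Q w (a - b) = Q w a - Q w b.
Proof. by rewrite hfDr hfNr. Qed.

Lemma hf_line n (a b : 'rV[K]_n) t :
  Q (a + t *: b) (a + t *: b) = Q a a + t^* * Q a b + t * (Q a b)^* + t * t^* * Q b b.
Proof.
by rewrite hfDl !hfDr !hfZl !hfZr (hfC a b); ring.
Qed.

Lemma hf_real n (z : 'rV[K]_n) : Q z z \is Num.real.
Proof. by apply/CrealP; rewrite -hfC. Qed.

Lemma rank_ker_le m n k (A : 'M[K]_(m, n)) (B : 'M[K]_(m, k)) :
  (forall u : 'rV[K]_m, u *m A = 0 -> u *m B = 0) -> (\rank B <= \rank A)%N.
Proof.
move=> h; have : (kermx A <= kermx B)%MS.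
  apply/rV_subP => u /sub_kermxP uA; apply/sub_kermxP; exact: h.
move/mxrankS; rewrite !mxrank_ker.
have := rank_leq_row A; have := rank_leq_row B; lia.
Qed.

(* A totally isotropic row space meets the definite coordinate subspace of either
   sign only inside the radical. *)
Lemma isotropic_rank n k (N : 'M[K]_(k, n)) :
  N *m J n *m adj N = 0 -> (\rank (N *m J n) <= minn r s)%N.
Proof.
move=> NN.
have vv (u : 'rV[K]_k) : Q (u *m N) (u *m N) = 0.
  rewrite hf_mx adjM -!mulmxA [N *m _]mulmxA [N *m J n *m _]mulmxA NN.
  by rewrite mul0mx mulmx0 mxE.
have key (v : 'rV[K]_n) : Q v v = 0 ->
   ((forall j : 'I_n, (j < r)%N -> v ord0 j = 0) \/
    (forall j : 'I_n, (r <= j < r + s)%N -> v ord0 j = 0)) -> v *m J n = 0.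
  move=> v0 hv; apply/rowP => j; rewrite mul_mx_diag !mxE.
  have tm (i : 'I_n) : v ord0 i * (v ord0 i)^* = `|v ord0 i| ^+ 2 by rewrite normCK.
  case: hv => hv.
    have [jr|jr] := boolP (j < r)%N; first by rewrite hv// mul0r.
    have [js|js] := boolP (j < r + s)%N; last by rewrite mulr0.
    have : \sum_(i < n) (if (i < r)%N then 0 else if (i < r + s)%N then `|v ord0 i| ^+ 2 else 0) = 0.
      transitivity (- Q v v); last by rewrite v0 oppr0.
      rewrite /hf -sumrN; apply: eq_bigr => i _.
      case: ifP => [ir|_]; first by rewrite hv// mulr0 mul0r oppr0.
      by case: ifP => _; rewrite ?mulN1r ?mul0r ?oppr0// mulNr opprK tm.
    move/psumr_eq0P => /(_ _ j isT); rewrite (negbTE jr) js => h.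
    have -> : v ord0 j = 0; last by rewrite mul0r.
    apply/eqP; rewrite -normr_eq0 -sqrf_eq0; apply/eqP; apply: h => i _.
    by case: ifP => // _; case: ifP => // _; rewrite exprn_ge0.
  have [js|js] := boolP (r <= j < r + s)%N; first by rewrite hv// mul0r.
  have [jr|jr] := boolP (j < r)%N; last first.
    rewrite leqNgt jr/= in js; by rewrite (negbTE js) mulr0.
  have : \sum_(i < n) (if (i < r)%N then `|v ord0 i| ^+ 2 else 0) = 0.
    transitivity (Q v v); last by [].
    rewrite /hf; apply: eq_bigr => i _.
    case: ifP => [ir|ir]; first by rewrite mul1r tm.
    case: ifP => is_; last by rewrite !mul0r.
    by rewrite (hv i) ?mulr0 ?mul0r// leqNgt ir.
  move/psumr_eq0P => /(_ _ j isT); rewrite jr => h.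
  have -> : v ord0 j = 0; last by rewrite mul0r.
  apply/eqP; rewrite -normr_eq0 -sqrf_eq0; apply/eqP; apply: h => i _.
  by case: ifP => // _; rewrite exprn_ge0.
rewrite leq_min; apply/andP; split.
  pose S : 'M[K]_(n, r) := \matrix_(i, j) (i == j :> nat)%:R.
  apply: leq_trans (rank_leq_col (N *m S)); apply: rank_ker_le => u uN.
  rewrite mulmxA; apply: key; first exact: vv.
  left => j jr; rewrite mulmxA in uN; move: (u *m N) uN => v vS.
  have := congr1 (fun A : 'rV[K]_r => A ord0 (Ordinal jr)) vS.
  rewrite mxE [RHS]mxE (bigD1 j)//= mxE eqxx mulr1 big1 ?addr0// => i ij.
  by rewrite mxE (_ : (i == j :> nat) = false) ?mulr0//; apply/negbTE.
pose S : 'M[K]_(n, s) := \matrix_(i, j) (i == (r + j)%N :> nat)%:R.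
apply: leq_trans (rank_leq_col (N *m S)); apply: rank_ker_le => u uN.
rewrite mulmxA; apply: key; first exact: vv.
right => j /andP[jr js]; rewrite mulmxA in uN; move: (u *m N) uN => v vS.
have js' : (j - r < s)%N by rewrite ltn_subLR.
have := congr1 (fun A : 'rV[K]_s => A ord0 (Ordinal js')) vS.
rewrite mxE [RHS]mxE (bigD1 j)//= mxE /= subnKC// eqxx mulr1 big1 ?addr0// => i ij.
by rewrite mxE /= subnKC// (_ : (i == j :> nat) = false) ?mulr0//; apply/negbTE.
Qed.

Lemma exists_ker_row m k (A : 'M[K]_(m, k)) : (k < m)%N ->
  exists2 u : 'rV[K]_m, u != 0 & u *m A = 0.
Proof.
move=> km; have : kermx A != 0.
  by rewrite -mxrank_eq0 mxrank_ker -lt0n subn_gt0; apply: leq_ltn_trans km; exact: rank_leq_col.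
move=> /rowV0Pn[u /sub_kermxP uA u0]; by exists u.
Qed.

Lemma rowV_neq0 n (u : 'rV[K]_n) : u != 0 -> exists j, u ord0 j != 0.
Proof.
move=> /eqP u0; apply: contrapT => h; apply: u0; apply/rowP => j; rewrite mxE.
by apply/eqP/negPn/negP => uj; apply: h; exists j.
Qed.

(** As [k] is less than [r] and [s], both definite coordinate subspaces contain a nonzero vector
    orthogonal to the rows of [X]: a positive [a] and a negative [b]. The scaling [c] makes
    [a + c *: b] null. It pairs nontrivially with [a] while the rows of [X] do not, which gives
    independence modulo the radical. *)
Lemma isotropic_extend n k (X : 'M[K]_(k, n)) : (r + s <= n)%N -> (k < r)%N -> (k < s)%N ->
  X *m J n *m adj X = 0 -> row_free (X *m J n) ->
  exists y : 'rV[K]_n, [/\ Q y y = 0, X *m J n *m adj y = 0 & row_free (col_mx X y *m J n)].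
Proof.
move=> rsn kr ks XX Xfree.
have rn : (r <= n)%N by lia.
pose e1 (j : 'I_r) : 'I_n := widen_ord rn j.
have sn (j : 'I_s) : (r + j < n)%N by have := ltn_ord j; lia.
pose e2 (j : 'I_s) : 'I_n := Ordinal (sn j).
pose E1 : 'M[K]_(r, n) := \matrix_(i, j) (e1 i == j)%:R.
pose E2 : 'M[K]_(s, n) := \matrix_(i, j) (e2 i == j)%:R.
have [u u0 uX] := exists_ker_row (E1 *m J n *m adj X) kr.
have [v v0 vX] := exists_ker_row (E2 *m J n *m adj X) ks.
pose a := u *m E1; pose b := v *m E2.
have aE (j : 'I_n) (jr : (j < r)%N) : a ord0 j = u ord0 (Ordinal jr).
  rewrite mxE (bigD1 (Ordinal jr))//= mxE (_ : e1 _ == j) ?mulr1; last by apply/eqP/val_inj.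
  rewrite big1 ?addr0// => i ij; rewrite mxE (_ : e1 i == j = false) ?mulr0//.
  by apply/negbTE; apply: contra ij => /eqP/(congr1 val)/= h; apply/eqP/val_inj.
have aE1 (j : 'I_r) : a ord0 (e1 j) = u ord0 j.
  have jr : (e1 j < r)%N := ltn_ord j.
  by rewrite (aE _ jr); congr (u _ _); exact: val_inj.
have aE0 (j : 'I_n) : ~~ (j < r)%N -> a ord0 j = 0.
  move=> jr; rewrite mxE big1// => i _; rewrite mxE (_ : e1 i == j = false) ?mulr0//.
  by apply/negbTE; apply: contra jr => /eqP <- /=.
have bE (j : 'I_n) (i : 'I_s) : j = (r + i)%N :> nat -> b ord0 j = v ord0 i.
  move=> ji; rewrite mxE (bigD1 i)//= mxE (_ : e2 _ == j) ?mulr1; last by apply/eqP/val_inj.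
  rewrite big1 ?addr0// => l li; rewrite mxE (_ : e2 l == j = false) ?mulr0//.
  apply/negbTE; apply: contra li => /eqP/(congr1 val) /= ; rewrite ji => /addnI h.
  by apply/eqP/val_inj.
have bE0 (j : 'I_n) : ~~ (r <= j < r + s)%N -> b ord0 j = 0.
  move=> jr; rewrite mxE big1// => i _; rewrite mxE (_ : e2 i == j = false) ?mulr0//.
  apply/negbTE; apply: contra jr => /eqP <- /=; by rewrite leq_addr ltn_add2l ltn_ord.
have sq (x : K) : x * x^* = `|x| ^+ 2 by rewrite normCK.
have aa : 0 < Q a a.
  have [j uj] := rowV_neq0 u0.
  rewrite /hf (bigD1 (e1 j))//= ltn_ord mul1r sq.
  apply: ltr_pwDl; first by rewrite exprn_gt0// normr_gt0 aE1.
  apply: sumr_ge0 => i _; case: ifP => [_|ir]; first by rewrite mul1r sq exprn_ge0.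
  by rewrite aE0 ?ir// mulr0 mul0r.
have bb : 0 < - Q b b.
  have [j vj] := rowV_neq0 v0.
  rewrite /hf -sumrN (bigD1 (e2 j))//= ltnNge leq_addr/= ltn_add2l ltn_ord mulN1r mulNr opprK sq.
  apply: ltr_pwDl; first by rewrite exprn_gt0// normr_gt0 (bE _ j).
  apply: sumr_ge0 => i _; case: ifP => [ir|_]; first by rewrite bE0 ?mulr0 ?mul0r ?oppr0// leqNgt ir.
  by case: ifP => _; rewrite ?mul0r ?oppr0// mulN1r mulNr opprK sq exprn_ge0.
have ab : Q a b = 0.
  rewrite /hf big1// => i _; have [ir|ir] := boolP (i < r)%N.
    by rewrite bE0 ?rmorph0 ?mulr0// leqNgt ir.
  by rewrite aE0// mulr0 mul0r.
have ba : Q b a = 0 by rewrite hfC ab rmorph0.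
pose c := sqrtC (Q a a / - Q b b).
have cc : c * c^* = Q a a / - Q b b.
  have c0 : 0 <= c by rewrite sqrtC_ge0 divr_ge0// ltW.
  have -> : c^* = c by apply/CrealP/ger0_real.
  by rewrite -expr2 sqrtCK.
exists (a + c *: b).
have yX : (a + c *: b) *m J n *m adj X = 0.
  by rewrite !mulmxDl -!scalemxAl /a /b -!mulmxA !(mulmxA _ (J n)) uX vX scaler0 addr0.
have Xy : X *m J n *m adj (a + c *: b) = 0 by exact: hf_orthC.
split => //.
  rewrite hfDl !hfDr !hfZl !hfZr ab ba !mulr0 addr0 add0r mulrA cc.
  by rewrite invrN mulrN mulNr mulfVK ?subrr// -oppr_eq0 gt_eqF.
rewrite -kermx_eq0; apply/rowV0P => w /sub_kermxP.
rewrite -[w]hsubmxK mulmxA mul_row_col mulmxDl => h.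
set w1 := lsubmx w in h *; set w2 := rsubmx w in h *.
have w20 : w2 = 0.
  have : (w1 *m X *m J n + w2 *m (a + c *: b) *m J n) *m adj a = 0 by rewrite h mul0mx.
  rewrite mulmxDl -!mulmxA.
  have -> : X *m (J n *m adj a) = 0.
    by rewrite mulmxA; apply: hf_orthC; rewrite /a -!mulmxA (mulmxA _ (J n)).
  rewrite mulmx0 add0r => h2.
  apply/matrixP => i j; rewrite !ord1 [RHS]mxE.
  have := congr1 (fun A : 'M[K]_1 => A ord0 ord0) h2; rewrite mxE big_ord1 mulmxA -hf_mx [RHS]mxE.
  rewrite hfDl hfZl ba mulr0 addr0 => /eqP; rewrite mulf_eq0 (gt_eqF aa) orbF => /eqP.
  by [].
rewrite w20 mul0mx mul0mx addr0 in h.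
have /row_freeP[B XB] := Xfree.
have w10 : w1 = 0.
  by rewrite -[w1]mulmx1 -XB !mulmxA h mul0mx.
by rewrite w10 w20 row_mx0.
Qed.

Lemma isotropic_dual n k (X : 'M[K]_(k, n)) : row_free (X *m J n) ->
  exists V : 'M[K]_(k, n), X *m J n *m adj V = 1%:M.
Proof. by move=> /row_freeP[B XB]; exists (adj B); rewrite adjK. Qed.

Lemma isotropic_extend_to n k p (X : 'M[K]_(k, n)) : (r + s <= n)%N ->
  (k <= p)%N -> (p <= r)%N -> (p <= s)%N ->
  X *m J n *m adj X = 0 -> row_free (X *m J n) ->
  exists Y : 'M[K]_(p, n), [/\ Y *m J n *m adj Y = 0, row_free (Y *m J n) & (X <= Y)%MS].
Proof.
move=> rsn kp pr ps; move: (subnK kp); move: (p - k)%N => d; elim: d k X kp => [|d IH] k X kp.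
  by rewrite add0n => e; subst k => XX Xf; exists X.
rewrite addSn -addnS => e XX Xf.
have kd : (k < p)%N by rewrite -e; lia.
have [y [yy Xy yf]] := isotropic_extend rsn (leq_trans kd pr) (leq_trans kd ps) XX Xf.
have k1 : (k + 1 = k.+1)%N by rewrite addn1.
have [||||Y [YY Yf XY]] := IH (k + 1)%N (col_mx X y).
- by rewrite addn1.
- by rewrite addn1.
- have yX : y *m J n *m adj X = 0 by exact: hf_orthC.
  have yy' : y *m J n *m adj y = 0.
    by apply/matrixP => i j; rewrite !ord1 -hf_mx yy mxE.
  rewrite (_ : adj (col_mx X y) = row_mx (adj X) (adj y)); last first.
    by rewrite /adj map_col_mx tr_col_mx.
  by rewrite mul_col_mx mul_col_row XX Xy yX yy' block_mx0.
- exact: yf.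
exists Y; split => //; apply: submx_trans XY.
by rewrite -addsmxE addsmxSl.
Qed.

End HermitianForm.

(** * Holomorphic functions on a small ball *)

Section HolomorphicTools.
Context {K : numClosedFieldType}.

(** The order of [K] is partial, but positive elements are real and hence comparable. *)
Lemma gt0_min2 (a b : K) : 0 < a -> 0 < b -> exists c, [/\ 0 < c, c <= a & c <= b].
Proof.
move=> a0 b0; have cab : a >=< b by rewrite real_comparable ?gtr0_real.
by case: (comparable_leP cab) => ab; [exists a|exists b]; split => //; exact: ltW.
Qed.

Lemma differentiable_hf r s n m (f : 'rV[K]_n -> 'rV[K]_m) z (w : 'rV[K]_m) :
  differentiable f z -> differentiable (fun x => hf r s (f x) w) z.
Proof.
move=> fz; rewrite (_ : (fun x => _) = \sum_(j < m) (fun x : 'rV[K]_n =>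
  ((if (j < r)%N then 1 else if (j < r + s)%N then -1 else 0) * (w ord0 j)^*) * f x ord0 j)); last first.
  by apply/funext => x; rewrite fct_sumE; apply: eq_bigr => j _; rewrite mulrAC.
apply: differentiable_sum => j; apply: differentiableM; first exact: differentiable_cst.
exact: (differentiable_comp fz (differentiable_coord _ _ _)).
Qed.

Section Linear.
Variables (r s n : nat) (w : 'rV[K]_n).
Definition hfl (z : 'rV[K]_n) : K := hf r s z w.
Lemma hfl_is_linear : linear hfl.
Proof. by move=> c a b; rewrite /hfl hfDl hfZl. Qed.
HB.instance Definition _ := GRing.isLinear.Build K 'rV[K]_n K _ hfl hfl_is_linear.
End Linear.

Lemma derive_hf r s n m (f : 'rV[K]_n -> 'rV[K]_m) z v (w : 'rV[K]_m) :
  differentiable f z -> 'D_v (fun x => hf r s (f x) w) z = hf r s ('D_v f z) w.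
Proof.
move=> fz; have hc : continuous (hfl r s w).
  move=> x; apply: differentiable_continuous.
  by apply: (@differentiable_hf r s m m id); exact: ex_diff.
have hd x : differentiable (hfl r s w) x.
  by apply: (@differentiable_hf r s m m id); exact: ex_diff.
rewrite -[fun x => _]/(hfl r s w \o f) deriveE; last exact: differentiable_comp.
by rewrite (diff_comp fz (hd _))/= (diff_lin _ hc)/= deriveE.
Qed.

Variables (n : nat) (x0 : 'rV[K]_n) (rho : K).
Hypothesis zp : zero_propagation K.
Hypothesis rho0 : 0 < rho.

Definition indisc (z : 'rV[K]_n) := `|z - x0| < rho.
(* The factor 16 leaves room for zeros to propagate from any point of the small ball to
   the whole of it. *)
Definition hol (f : 'rV[K]_n -> K) := forall z, `|z - x0| < 16 * rho -> differentiable f z.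

Lemma indisc16 z : indisc z -> `|z - x0| < 16 * rho.
Proof. by move=> zd; apply: lt_trans zd _; rewrite ltr_pMl// ltr1n. Qed.

Lemma hol_near_id f a b : hol f -> indisc a -> indisc b -> (\near a, f a = 0) -> f b = 0.
Proof.
move=> fh; apply: (zero_prop_ball zp) => z v zd; apply: diff_derivable; exact: fh.
Qed.

Lemma hol_line_id f a b : hol f -> indisc a -> indisc b ->
  (exists2 e, 0 < e & forall t, `|t| < e -> f (a + t *: (b - a)) = 0) -> f b = 0.
Proof.
move=> fh ad bd; apply: (zero_prop_line zp) => t t4; apply: diff_derivable; apply: fh.
have ba : `|b - a| <= 2 * rho.
  have -> : b - a = (b - x0) - (a - x0) by rewrite opprB addrA subrK.
  by rewrite mulr_natl mulr2n (le_trans (ler_normB _ _))// lerD// ltW.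
have -> : a + t *: (b - a) - x0 = (a - x0) + t *: (b - a) by rewrite addrAC.
apply: (@le_lt_trans _ _ (`|a - x0| + `|t *: (b - a)|)); first exact: ler_normD.
apply: (@lt_le_trans _ _ (rho + 8 * rho)); last first.
  have -> : rho + 8 * rho = 9 * rho by ring.
  by rewrite ler_pM2r// ler_nat.
apply: ltr_leD => //; rewrite normrZ.
have -> : 8 * rho = 4 * (2 * rho) by rewrite mulrA -natrM.
by apply: ler_pM.
Qed.

Lemma indisc_open a : indisc a -> exists2 e, 0 < e & forall b, `|b - a| < e -> indisc b.
Proof.
move=> ad; exists (rho - `|a - x0|); first by rewrite subr_gt0.
move=> b ba; rewrite /indisc; have -> : b - x0 = (b - a) + (a - x0) by rewrite addrA subrK.
by apply: le_lt_trans (ler_normD _ _) _; rewrite -ltrBrDr.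
Qed.

Lemma hol_open_neq0 f a : hol f -> indisc a -> f a != 0 ->
  exists2 e, 0 < e & forall b, `|b - a| < e -> indisc b /\ f b != 0.
Proof.
move=> fh ad fa; have [e1 e10 h1] := indisc_open ad.
have fa2 : 0 < `|f a| / 2 by rewrite divr_gt0// normr_gt0.
have [e2 e20 h2] := continuous_eps (differentiable_continuous (fh _ (indisc16 ad))) fa2.
have [e [e0 l1 l2]] := gt0_min2 e10 e20; exists e => // b be; split.
  by apply: h1; apply: lt_le_trans be l1.
apply/eqP => fb; have := h2 b; rewrite distrC => /(_ (lt_le_trans be l2)).
rewrite fb subr0 ler_pdivlMr// ger_pMr ?normr_gt0//.
by rewrite -[X in _ <= X]/(1%:R) ler_nat.
Qed.

Lemma small_line (v : 'rV[K]_n) (e : K) : 0 < e ->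
  exists2 d, 0 < d & forall t : K, `|t| < d -> `|t *: v| < e.
Proof.
move=> e0; have v1 : 0 < `|v| + 1 by rewrite ltr_wpDl.
exists (e / (`|v| + 1)); first by rewrite divr_gt0.
move=> t; rewrite ltr_pdivlMr// normrZ; apply: le_lt_trans.
by apply: ler_wpM2l => //; rewrite lerDl.
Qed.

Lemma hol_line_neq0 f a v : hol f -> indisc a -> f a != 0 ->
  exists2 e, 0 < e & forall t : K, `|t| < e -> indisc (a + t *: v) /\ f (a + t *: v) != 0.
Proof.
move=> fh ad fa; have [e e0 he] := hol_open_neq0 fh ad fa.
have [d d0 hd] := small_line v e0; exists d => // t /hd tv.
by apply: he; rewrite addrAC subrr add0r.
Qed.

Lemma indisc_line a v : indisc a ->
  exists2 e, 0 < e & forall t : K, `|t| < e -> indisc (a + t *: v).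
Proof.
move=> ad; have [e e0 he] := indisc_open ad.
have [d d0 hd] := small_line v e0; exists d => // t /hd tv.
by apply: he; rewrite addrAC subrr add0r.
Qed.

Lemma hol_cst c : hol (cst c).
Proof. by move=> z _; exact: differentiable_cst. Qed.

Lemma holB f g : hol f -> hol g -> hol (fun z => f z - g z).
Proof. by move=> fh gh z zd; apply: differentiableB; [exact: fh|exact: gh]. Qed.

Lemma holM f g : hol f -> hol g -> hol (fun z => f z * g z).
Proof. by move=> fh gh z zd; apply: differentiableM; [exact: fh|exact: gh]. Qed.

Lemma hol_hf r s w : hol (fun z => hf r s z w).
Proof. by move=> z _; apply: (@differentiable_hf r s n n id); exact: ex_diff. Qed.

Lemma continuous_hf_diag r s : continuous (fun z : 'rV[K]_n => hf r s z z).
Proof.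
move=> z.
rewrite (_ : (fun z => _) = \sum_(j < n) (fun z : 'rV[K]_n =>
  (if (j < r)%N then 1 else if (j < r + s)%N then -1 else 0) * z ord0 j * (z ord0 j)^*)); last first.
  by apply/funext => u; rewrite fct_sumE.
apply: (big_ind (fun f : 'rV[K]_n -> K => {for z, continuous f})).
- exact: cst_continuous.
- by move=> f g fc gc; exact: continuousD.
move=> j _; have cj : {for z, continuous (fun u : 'rV[K]_n => u ord0 j)} by exact: coord_continuous.
apply: (@continuousM K _ (fun u : 'rV[K]_n => _ * u ord0 j)).
  apply: (@continuousM K _ (cst _)); last exact: cj.
  exact: cst_continuous.
apply: (@continuous_comp _ K K _ Num.conj); first exact: cj.
apply: (@eps_continuous K K K K) => e e0; exists e => // w zw.
by rewrite -rmorphB norm_conjC.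
Qed.

Variables (r s : nat).
Local Notation Q := (hf r s).

(* A point near [w1] lies on a complex line whose real points are all isotropic. *)
Lemma null_unique (S : 'rV[K]_n -> Prop) (w1 e : 'rV[K]_n) (eta : K) (f : 'rV[K]_n -> K) :
  (forall a b t, S a -> S b -> S (a + t *: b)) -> hol f ->
  S w1 -> indisc w1 -> Q w1 w1 = 0 -> S e -> Q e e = 0 -> Q w1 e != 0 -> 0 < eta ->
  (forall z, S z -> indisc z -> `|z - w1| < eta -> Q z z = 0 -> f z = 0) ->
  forall b, S b -> indisc b -> f b = 0.
Proof.
move=> Slin fh Sw1 w1d q1 Se qe c10 eta0 fz b Sb bd.
have [d1 d10 hd1] := indisc_open w1d.
have [eta1 [eta10 le1 le2]] := gt0_min2 eta0 d10.
have fz1 z : S z -> `|z - w1| < eta1 -> Q z z = 0 -> f z = 0.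
  move=> Sz zw qz; apply: fz => //; first by apply: hd1; exact: lt_le_trans zw le2.
  exact: lt_le_trans zw le1.
set m := `|Q w1 e|; have m0 : 0 < m by rewrite normr_gt0.
have e1 : 0 < `|e| + 1 by rewrite ltr_wpDl.
(* [rr] keeps the points with parameter below [16 * rr] within [eta1] of [w1]; the bound [kk] on
   [Q w w] puts [w] itself at a parameter of modulus at most [rr / 2]. *)
pose rr := eta1 / (64 * m * (`|e| + 1)).
have rr0 : 0 < rr by rewrite divr_gt0// !mulr_gt0.
pose kk := m ^+ 2 * rr / 4.
have kk0 : 0 < kk by rewrite divr_gt0// mulr_gt0// exprn_gt0.
have m2 : 0 < m / 2 by rewrite divr_gt0.
have cc : {for w1, continuous (fun z => Q z e)}.
  by apply: differentiable_continuous; apply: (@hol_hf r s e w1); exact: indisc16.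
have [a1 a10 ha1] := continuous_eps cc m2.
have [a2 a20 ha2] := continuous_eps (@continuous_hf_diag r s w1) kk0.
have [a3 [a30 l31 l32]] := gt0_min2 a10 a20.
have eta8 : 0 < eta1 / 8 by rewrite divr_gt0.
have [dl [dl0 ldl1 ldl2]] := gt0_min2 a30 eta8.
have near0 w : S w -> `|w - w1| < dl -> f w = 0.
  move=> Sw ww; set c := Q w e; set q := Q w w.
  have wa3 := lt_le_trans ww ldl1.
  have cm : `|Q w1 e - c| <= m / 2.
    by apply: ha1; rewrite distrC; exact: lt_le_trans wa3 l31.
  have qk : `|q| <= kk.
    have := ha2 w; rewrite q1 sub0r normrN; apply.
    by rewrite distrC; exact: lt_le_trans wa3 l32.
  have cge : m / 2 <= `|c|.
    have : m <= m / 2 + `|c|.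
      apply: le_trans (_ : `|Q w1 e - c| + `|c| <= _); last by rewrite lerD2r.
      by apply: le_trans (ler_normD _ _); rewrite subrK.
    by rewrite -lerBlDl; have -> : m - m / 2 = m / 2 by field.
  have cle : `|c| <= 3 * m / 2.
    apply: le_trans (_ : `|Q w1 e| + `|Q w1 e - c| <= _).
      by apply: le_trans (ler_normB _ _); rewrite opprB addrC subrK.
    rewrite -/m; have -> : 3 * m / 2 = m + m / 2 by field.
    by rewrite lerD2l.
  have c_gt0 : 0 < `|c| by apply: lt_le_trans cge.
  have c0 : c != 0 by rewrite -normr_gt0.
  have ccE : c * c^* = `|c| ^+ 2 by rewrite normCK.
  have qR : q^* = q by rewrite -hfC.
  have nR : (`|c| ^+ 2)^* = `|c| ^+ 2 by apply/CrealP; rewrite realX// normr_real.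
  have n0 : `|c| ^+ 2 != 0 by rewrite expf_neq0// gt_eqF.
  (* The shift by [tau] along [e] makes [w'] null. Since [Q w' e'] is purely imaginary and [e'] is
     null, [w' + x *: e'] is null for every real [x], and [w] lies on this line at the parameter
     [sg]. *)
  pose tau := - (q * c / (2 * `|c| ^+ 2)).
  pose w' := w + tau *: e.
  pose e' := ('i * c) *: e.
  pose sg := q / (2 * 'i * `|c| ^+ 2).
  have i0 : 'i != 0 :> K := neq0Ci K.
  have wE : w = w' + sg *: e'.
    rewrite /w' /e' scalerA -addrA -scalerDl (_ : tau + _ = 0) ?scale0r ?addr0//.
    by rewrite /tau /sg; field; rewrite ?i0 ?(gt_eqF c_gt0).
  have tau_c : tau^* * c = - q / 2.
    rewrite /tau rmorphN rmorphM/= rmorphM/= fmorphV rmorphM/= nR qR conjC_nat.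
    have -> : - (q * c^* / (2 * `|c| ^+ 2)) * c = - (q * (c * c^*) / (2 * `|c| ^+ 2)) by ring.
    by rewrite ccE; field; rewrite ?(gt_eqF c_gt0).
  have qw' : Q w' w' = 0.
    rewrite /w' hf_line qe mulr0 addr0 -/c -/q tau_c.
    have -> : tau * c^* = - q / 2.
      have := congr1 (@Num.conj K) tau_c; rewrite rmorphM/= conjCK => ->.
      have r2 : (2 : K)^-1 \is Num.real by rewrite rpredV realn.
      by rewrite rmorphM/= rmorphN/= qR (CrealP r2).
    by field.
  have we' : Q w' e' = - 'i * `|c| ^+ 2.
    rewrite /w' /e' hfZr hfDl hfZl qe mulr0 addr0 -/c rmorphM/= conjCi.
    by rewrite -mulrA [c^* * c]mulrC ccE.
  have qline x : x \is Num.real -> Q (w' + x *: e') (w' + x *: e') = 0.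
    move=> xR; rewrite (hf_line r s w' e' x) qw' we' (CrealP xR).
    have -> : Q e' e' = 0 by rewrite /e' hfZl hfZr qe !mulr0.
    by rewrite rmorphM/= nR rmorphN/= conjCi; ring.
  have Sline x : S (w' + x *: e').
    have Sw' : S w' by exact: Slin.
    rewrite /e' scalerA; exact: Slin.
  have close x : `|x| < 16 * rr -> `|w' + x *: e' - w1| < eta1.
    move=> xr.
    have -> : w' + x *: e' - w1 = (w - w1) + (tau *: e + x *: e') by rewrite /w' -!addrA [- w1 + _]addrC !addrA.
    apply: le_lt_trans (ler_normD _ _) _.
    have hw : `|w - w1| < eta1 / 8 by apply: lt_le_trans ww ldl2.
    have htau : `|tau| * `|e| <= eta1 / 8.
      have : `|tau| <= kk / m.
        have -> : `|tau| = `|q| / (2 * `|c|).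
          rewrite /tau normrN !normrM normfV !normrM !normr_id normr_nat.
          by field; rewrite gt_eqF.
        apply: ler_pM; [exact: normr_ge0|by rewrite invr_ge0 mulr_ge0|exact: qk|].
        rewrite lef_pV2 ?posrE ?mulr_gt0// mulrC -ler_pdivrMr//.
      move=> ht; apply: le_trans (_ : kk / m * (`|e| + 1) <= _).
        by apply: ler_pM => //; rewrite lerDl.
      have -> : kk / m * (`|e| + 1) = eta1 / 256.
        rewrite /kk /rr; field; do ?[apply/andP; split]; by rewrite ?gt_eqF.
      by rewrite ler_pM2l// lef_pV2 ?posrE// ler_nat.
    have hx : `|x *: e'| <= 3 * eta1 / 8.
      rewrite /e' scalerA normrZ !normrM normCi mul1r.
      apply: le_trans (_ : 16 * rr * (3 * m / 2) * (`|e| + 1) <= _).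
        apply: ler_pM; [by rewrite mulr_ge0|by []| |by rewrite lerDl].
        by apply: ler_pM; [exact: normr_ge0|exact: normr_ge0|exact: ltW|].
      rewrite /rr le_eqVlt; apply/orP; left; apply/eqP.
      by field; rewrite !gt_eqF.
    apply: (@lt_le_trans _ _ (eta1 / 8 + (eta1 / 8 + 3 * eta1 / 8))); last first.
      have -> : eta1 / 8 + (eta1 / 8 + 3 * eta1 / 8) = eta1 * (5 / 8) by field.
      by rewrite ger_pMr// ler_pdivrMr// mul1r ler_nat.
    apply: ltr_leD => //; apply: le_trans (ler_normD _ _) _; rewrite normrZ.
    exact: lerD.
  have -> : w = w' + sg *: e' by [].
  apply: (@zero_on_reals K zp (fun x => f (w' + x *: e')) rr).
  - move=> x xr; apply: derivable_line; apply: diff_derivable; apply: fh.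
    by apply: indisc16; apply: hd1; apply: lt_le_trans le2; exact: close.
  - move=> x xR xr; apply: fz1; [exact: Sline|exact: close|exact: qline].
  rewrite /sg normrM normfV !normrM normCi mulr1 !normr_id normr_nat -expr2.
  apply: (@le_lt_trans _ _ (kk / (2 * (m / 2) ^+ 2))).
    apply: ler_pM; [exact: normr_ge0|by rewrite invr_ge0 mulr_ge0// exprn_ge0|exact: qk|].
    rewrite lef_pV2 ?posrE ?mulr_gt0 ?exprn_gt0//.
    by rewrite ler_pM2l// lerXn2r// nnegrE ltW.
  have -> : kk / (2 * (m / 2) ^+ 2) = rr / 2 by rewrite /kk; field; rewrite gt_eqF.
  by rewrite ltr_pdivrMr// ltr_pMr// ltr1n.
apply: (hol_line_id fh w1d bd).
have [d d0 hd] := small_line (b - w1) dl0; exists d => // t /hd tb.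
apply: near0; last by rewrite addrAC subrr add0r.
apply: (Slin) => //; rewrite -scaleN1r; exact: Slin.
Qed.

End HolomorphicTools.

Lemma hf_delta (K : numClosedFieldType) n (z : 'rV[K]_n) j :
  hf n 0 z (delta_mx ord0 j) = z ord0 j.
Proof.
rewrite /hf (bigD1 j)//= ltn_ord mul1r !mxE !eqxx rmorph1 mulr1 big1 ?addr0// => i ij.
by rewrite !mxE (negbTE ij) andbF rmorph0 mulr0.
Qed.

Lemma derive_coord (K : numClosedFieldType) n m (f : 'rV[K]_n -> 'rV[K]_m) z v j :
  differentiable f z -> 'D_v (fun x => f x ord0 j) z = ('D_v f z) ord0 j.
Proof.
move=> fz; rewrite -hf_delta -derive_hf//; congr ('D_v _ z).
by apply/funext => x; rewrite hf_delta.
Qed.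

(** Conjugating both the parameter and the value restores holomorphy, so that the second slot of a
    Hermitian form can be differentiated together with the first. *)
Lemma is_derive_conj_line (K : numClosedFieldType) n (f : 'rV[K]_n -> K) u v (c : K) :
  derivable f u v ->
  is_derive (0 : K) 1 (fun t : K => (f (u + (c * t)^* *: v))^*) (c * ('D_v f u)^*).
Proof.
move=> fu; have fu' : derivable f (u + (0 : K) *: v) v by rewrite scale0r addr0.
have := derivable_expand (derivable_line fu').
rewrite derive_line scale0r addr0 => h.
apply: expand_is_derive => e e0.
have c1 : 0 < `|c| + 1 by rewrite ltr_wpDl.
have e1 : 0 < e / (`|c| + 1) by rewrite divr_gt0.
have [d d0 hd] := h _ e1.
exists (d / (`|c| + 1)); first by rewrite divr_gt0.
move=> t; rewrite subr0 ltr_pdivlMr// => tc.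
have tc1 : `|(c * t)^*| <= `|t| * (`|c| + 1).
  by rewrite norm_conjC normrM mulrC ler_wpM2l// lerDl.
have := hd (c * t)^*; rewrite subr0 => /(_ (le_lt_trans tc1 tc)) hh.
rewrite mulr0 conjC0 scale0r addr0.
have -> : (f (u + (c * t)^* *: v))^* - (f u)^* - c * ('D_v f u)^* * t =
   (f (u + (c * t)^* *: v) - f u - 'D_v f u * (c * t)^*)^*.
  have ctC : ((c * t)^*)^* = c * t by rewrite conjCK.
  by move: (c * t)^* ctC => z zE; rewrite !rmorphB/= rmorphM/= zE; ring.
rewrite norm_conjC; apply: le_trans hh _.
apply: le_trans (ler_wpM2l (ltW e1) tc1) _.
rewrite le_eqVlt; apply/orP; left; apply/eqP; field; by rewrite gt_eqF.
Qed.

(** The columns of [M *m Om] are [q] independent vectors of the column space of [M], whose dimension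
    is at most [q]; hence they span it. *)
Lemma functional_span (K : fieldType) k m q (M : 'M[K]_(k, m)) (Om : 'M[K]_(m, q)) :
  (\rank M <= q)%N -> (forall c : 'cV[K]_q, M *m Om *m c = 0 -> c = 0) ->
  forall b : 'cV[K]_m, exists la : 'cV[K]_q, M *m b = M *m Om *m la.
Proof.
move=> Mq ind b.
have rk : \rank (M *m Om) = q.
  have : row_free (M *m Om)^T.
    rewrite -kermx_eq0; apply/rowV0P => w /sub_kermxP.
    rewrite -[w]trmxK -trmx_mul => h.
    have := ind w^T; rewrite -[M *m Om *m _]trmxK h trmx0 => /(_ erefl) ->.
    by rewrite trmx0.
  by rewrite /row_free mxrank_tr => /eqP.
have sub : ((M *m Om)^T <= M^T)%MS by rewrite trmx_mul submxMl.
have sub2 : (M^T <= (M *m Om)^T)%MS.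
  by have := mxrank_leqif_sup sub; rewrite !mxrank_tr rk => -[h1 <-]; rewrite eqn_leq h1 Mq.
have : ((M *m b)^T <= (M *m Om)^T)%MS.
  by apply: submx_trans sub2; rewrite trmx_mul submxMl.
move=> /submxP[C CE]; exists C^T.
by apply: trmx_inj; rewrite CE [RHS]trmx_mul trmxK.
Qed.

(** The second clause places the row space of [N] inside the span of [S]. A matrix of maximal rank
    with this property must absorb every element of [S]. *)
Lemma spanning_mx (K : fieldType) m (S : set 'rV[K]_m) :
  exists N : 'M[K]_m, (forall v, S v -> (v <= N)%MS) /\
    (forall k (A : 'M[K]_(m, k)), (forall v, S v -> v *m A = 0) -> N *m A = 0).
Proof.
pose P (k : nat) := exists2 N : 'M[K]_m, \rank N = k &
  forall k (A : 'M[K]_(m, k)), (forall v, S v -> v *m A = 0) -> N *m A = 0.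
have exP : exists k, `[< P k >].
  exists 0%N; apply/asboolP; exists 0; first by rewrite mxrank0.
  by move=> k A _; rewrite mul0mx.
have ubP k : `[< P k >] -> (k <= m)%N.
  by move=> /asboolP[N <- _]; exact: rank_leq_row.
case: (ex_maxnP exP ubP) => k /asboolP[N Nk NP] kmax.
exists N; split => // v Sv; apply: contrapT => /negP vN.
have : P (\rank (N + v)%MS).
  exists (N + v)%MS => // l A SA; apply/sub_kermxP.
  by rewrite addsmx_sub; apply/andP; split; apply/sub_kermxP; [exact: NP|exact: SA].
move=> /asboolP/kmax; apply/negP; rewrite -ltnNge -Nk.
have := mxrank_leqif_sup (addsmxSl N v).
by move=> /ltn_leqif ->; rewrite addsmx_sub submx_refl.
Qed.

Lemma spanning_isotropic (K : numClosedFieldType) r s n (S : set 'rV[K]_n) :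
  (forall x w, S x -> S w -> hf r s x w = 0) ->
  exists N : 'M[K]_n, [/\ forall v, S v -> (v <= N)%MS,
    forall k (A : 'M[K]_(n, k)), (forall v, S v -> v *m A = 0) -> N *m A = 0 &
    N *m sgn_mx r s n *m adj N = 0].
Proof.
move=> S0; have [N [SN NS]] := spanning_mx S; exists N; split => //.
have h x : S x -> x *m sgn_mx r s n *m adj N = 0.
  move=> Sx; apply: hf_orthC; rewrite -mulmxA; apply: NS => w Sw; rewrite mulmxA.
  by apply/matrixP => i j; rewrite !ord1 -hf_mx S0// mxE.
by rewrite -mulmxA; apply: NS => x Sx; rewrite mulmxA h.
Qed.

(** * Local orthogonal maps near a null point *)

Section LocalMap.
Context {K : numClosedFieldType}.
Hypothesis zp : zero_propagation K.
Variables (r s n r' s' n' p : nat) (x0 v0 : 'rV[K]_n) (rho : K).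
Variable G : 'rV[K]_n -> 'rV[K]_n'.
Local Notation Q := (hf r s).
Local Notation Q' := (hf r' s').
Local Notation J := (sgn_mx r s n).
Local Notation J' := (sgn_mx r' s' n').
Local Notation D := (indisc x0 rho).
Hypothesis rho0 : 0 < rho.
Hypothesis Gd : forall z, `|z - x0| < 16 * rho -> differentiable G z.
Hypothesis Go : forall z w, D z -> D w -> Q z w = 0 -> Q' (G z) (G w) = 0.
Hypothesis v0n : Q v0 v0 = 0.
Hypothesis v0P : forall z, D z -> Q z v0 != 0.

Let GdD z : D z -> differentiable G z.
Proof. by move=> zd; apply: Gd; exact: indisc16 zd. Qed.

Lemma hol_G w : hol x0 rho (fun z => Q' (G z) w).
Proof. by move=> z zd; apply: differentiable_hf; exact: Gd. Qed.

Lemma dG_lin x a b (t : K) : D x -> 'D_(a + t *: b) G x = 'D_a G x + t *: 'D_b G x.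
Proof. by move=> xd; rewrite !deriveE ?linearD ?linearZ; try exact: GdD. Qed.

Lemma dG_orth x v w : D x ->
  (exists2 e, 0 < e & forall t : K, `|t| < e -> Q' (G (x + t *: v)) w = 0) ->
  Q' ('D_v G x) w = 0.
Proof.
move=> xd [e e0 he]; rewrite -derive_hf; last exact: GdD.
have := derive_line (fun z => Q' (G z) w) x v 0; rewrite scale0r addr0 => <-.
rewrite (@near_eq_derive K K K _ (cst 0)) ?derive_cst//.
have e2 : 0 < e / 2 by rewrite divr_gt0.
apply: filterS (near_dist_le (0 : K) e2) => t; rewrite sub0r normrN => te.
by apply: he; apply: le_lt_trans te _; rewrite ltr_pdivrMr// ltr_pMr// ltr1n.
Qed.

(* For [x] orthogonal to [u], the functional [v |-> <G x, 'D_v G u>] vanishes on the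
   complement of [x], hence is a multiple of [<x, v>]; [hker x u] is its value at [v0]. *)
Definition hker (x u : 'rV[K]_n) := Q' (G x) ('D_v0 G u).

Lemma hkerP x u v : D x -> D u -> Q x u = 0 ->
  Q' (G x) ('D_v G u) * Q x v0 = Q x v * hker x u.
Proof.
move=> xd ud xu; have x0' := v0P xd.
pose c := (Q x v / Q x v0)^*.
have cE : c^* * Q x v0 = Q x v by rewrite /c conjCK divfK.
have : Q' ('D_(v + (- c) *: v0) G u) (G x) = 0.
  apply: dG_orth => //; have [e e0 he] := indisc_line (v + (- c) *: v0) ud.
  exists e => // t /he ut; rewrite hfC Go ?rmorph0//.
  rewrite hfDr hfZr hfDr hfZr xu add0r rmorphN mulNr cE subrr mulr0 //.
rewrite dG_lin// => /eqP; rewrite hf_eq0C => /eqP; rewrite hfDr hfZr rmorphN mulNr => /eqP.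
by rewrite subr_eq0 => /eqP ->; rewrite mulrAC cE.
Qed.

(** The constant [ka] is chosen so that [x + t *: v0] and [u + (ka * t)^* *: v0] remain orthogonal;
    the quadratic term drops out because [v0] is null. The derivative at 0 of the vanishing pairing
    of their images is the claimed symmetry. *)
Lemma hkerC x u : D x -> D u -> Q x u = 0 ->
  hker x u * (Q u v0)^* = (hker u x)^* * Q x v0.
Proof.
move=> xd ud xu; have x0' := v0P xd.
pose ka := - (Q v0 u / Q x v0).
pose F (t : K) := Q' (G (x + t *: v0)) (G (u + (ka * t)^* *: v0)).
pose A (j : 'I_n') (t : K) : K := G (x + t *: v0) ord0 j.
pose B (j : 'I_n') (t : K) : K := (G (u + (ka * t)^* *: v0) ord0 j)^*.
pose sg (j : 'I_n') : K := if (j < r')%N then 1 else if (j < r' + s')%N then -1 else 0.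
have FE : F = \sum_j (fun t => sg j * A j t * B j t).
  by apply/funext => t; rewrite fct_sumE.
have cd j z : D z -> differentiable (fun x => G x ord0 j) z.
  by move=> zd; exact: (differentiable_comp (GdD zd) (differentiable_coord _ _ _)).
have dA j : is_derive (0 : K) 1 (A j) (('D_v0 G x) ord0 j).
  have xv : derivable (fun x => G x ord0 j) (x + (0 : K) *: v0) v0.
    by rewrite scale0r addr0; apply: diff_derivable; exact: cd.
  apply: DeriveDef; first exact: (derivable_line xv).
  by rewrite /A (derive_line (fun x => G x ord0 j)) scale0r addr0 derive_coord//; exact: GdD.
have dB j : is_derive (0 : K) 1 (B j) (ka * (('D_v0 G u) ord0 j)^*).
  rewrite -derive_coord; last exact: GdD.
  apply: (is_derive_conj_line (f := fun z => G z ord0 j)).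
  by apply: diff_derivable; exact: cd.
have dF : is_derive (0 : K) 1 F (\sum_j (sg j * ('D_v0 G x) ord0 j * B j 0 + sg j * A j 0 * (ka * (('D_v0 G u) ord0 j)^*))).
  rewrite FE; apply: is_derive_sum => j.
  have h1 : is_derive (0 : K) 1 (fun t => sg j * A j t) (sg j * ('D_v0 G x) ord0 j).
    have := @is_deriveM K K (cst (sg j)) (A j) 0 1 0 _ (is_derive_cst _ _ _) (dA j).
    by rewrite scaler0 addr0.
  have := @is_deriveM K K _ (B j) 0 1 _ _ h1 (dB j).
  by rewrite addrC [B j 0 *: _]mulrC.
have F0 : \forall t \near (0 : K), F t = 0.
  have [e1 e10 h1] := indisc_line v0 xd.
  have [e2 e20 h2] := indisc_line v0 ud.
  have k1 : 0 < `|ka| + 1 by rewrite ltr_wpDl.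
  have e3 : 0 < e2 / (`|ka| + 1) by rewrite divr_gt0.
  have [e [e0 l1 l2]] := gt0_min2 e10 e3.
  have e4 : 0 < e / 2 by rewrite divr_gt0.
  apply: filterS (near_dist_le (0 : K) e4) => t; rewrite sub0r normrN => te.
  have {}te : `|t| < e by apply: le_lt_trans te _; rewrite ltr_pdivrMr// ltr_pMr// ltr1n.
  apply: Go.
  - by apply: h1; exact: lt_le_trans te l1.
  - apply: h2; rewrite norm_conjC normrM mulrC.
    have : `|t| * (`|ka| + 1) < e2 by rewrite -ltr_pdivlMr//; exact: lt_le_trans te l2.
    by apply: le_lt_trans; apply: ler_wpM2l => //; rewrite lerDl.
  rewrite hfDr hfZr hfDl hfZl hfDl hfZl xu v0n conjCK mulr0 addr0 add0r /ka.
  by rewrite mulNr mulNr mulrAC divfK// [t * _]mulrC subrr.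
have [_ dF0] := dF.
rewrite (@near_eq_derive K K K _ (cst 0) _ _ F0) derive_cst in dF0.
have {dF0} : Q' ('D_v0 G x) (G u) + ka * hker x u = 0.
  rewrite [RHS]dF0 big_split/=; congr (_ + _).
    by rewrite /hf; apply: eq_bigr => j _; rewrite /B mulr0 conjC0 scale0r addr0.
  rewrite /hker /hf mulr_sumr; apply: eq_bigr => j _.
  by rewrite /A scale0r addr0 mulrCA.
rewrite hfC -/(hker u x) => /eqP; rewrite addr_eq0 => /eqP ->.
have kx : ka * Q x v0 = - (Q u v0)^* by rewrite /ka mulNr divfK// -hfC.
by rewrite mulNr mulrAC kx mulNr opprK mulrC.
Qed.

Hypothesis p2 : (1 < p)%N.
Hypothesis pr : (p <= r)%N.
Hypothesis ps : (p <= s)%N.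
Hypothesis rsn : (r + s <= n)%N.
Hypothesis rsp : (minn r' s' <= p)%N.

(** The rank is taken after multiplication by [J'], since the images may spread freely in the
    radical of the target. *)
Lemma null_span_rank (S : set 'rV[K]_n) :
  (forall x w, S x -> S w -> Q' (G x) (G w) = 0) ->
  exists N : 'M[K]_n', [/\ forall x, S x -> (G x <= N)%MS,
    forall k (A : 'M[K]_(n', k)), (forall x, S x -> G x *m A = 0) -> N *m A = 0 &
    (\rank (N *m J') <= p)%N].
Proof.
move=> S0; have [|N [GN NS NN]] := @spanning_isotropic K r' s' n' [set v | exists2 x, S x & v = G x].
  by move=> _ _ [x Sx ->] [w Sw ->]; exact: S0.
exists N; split; last exact: leq_trans (isotropic_rank NN) rsp.
- by move=> x Sx; apply: GN; exists x.
- by move=> k A h; apply: NS => _ [x Sx ->]; exact: h.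
Qed.

(** * The kernel on an isotropic p-space with a dual family *)

Section IsotropicFrame.
Variables (X V : 'M[K]_(p, n)).
Hypothesis XX : X *m J *m adj X = 0.
Hypothesis XV : X *m J *m adj V = 1%:M.

Lemma frame_null (y y' : 'rV[K]_p) : Q (y *m X) (y' *m X) = 0.
Proof.
rewrite hf_mx adjM -!mulmxA [X *m (_ *m _)]mulmxA [X *m J *m _]mulmxA XX.
by rewrite mul0mx mulmx0 mxE.
Qed.

Lemma frame_dual (y : 'rV[K]_p) (c : 'cV[K]_p) :
  Q (y *m X) (adj c *m V) = (y *m c) ord0 ord0.
Proof.
rewrite hf_mx adjM adjK -!mulmxA [X *m (_ *m _)]mulmxA [X *m J *m _]mulmxA XV.
by rewrite mul1mx.
Qed.

Lemma frame_row (y : 'rV[K]_p) i : Q (y *m X) (row i V) = y ord0 i.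
Proof.
have -> : row i V = adj (delta_mx i ord0 : 'cV[K]_p) *m V.
  rewrite rowE; congr (_ *m _); apply/matrixP => a b; rewrite !mxE.
  by rewrite andbC; case: (_ && _); rewrite ?rmorph1 ?rmorph0.
rewrite frame_dual mxE (bigD1 i)//= mxE !eqxx mulr1 big1 ?addr0// => j ji.
by rewrite mxE (negbTE ji) mulr0.
Qed.

(** Since [p] is at least 2, some nonzero functional [c] on the p-space kills [y0]; [v] represents
    it, and [i] is a coordinate on which it does not vanish. *)
Lemma frame_pair (y0 : 'rV[K]_p) : exists (i : 'I_p) (v : 'rV[K]_n) (c : 'cV[K]_p),
  [/\ v = adj c *m V, Q (y0 *m X) v = 0 & Q (row i X) v != 0].
Proof.
have [u u0 uy] := exists_ker_row y0^T p2.
have [i ui] := rowV_neq0 u0.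
exists i, (adj u^T *m V), u^T; split => //.
  by rewrite frame_dual -[y0]trmxK -trmx_mul uy trmx0 mxE.
by rewrite rowE frame_dual -rowE !mxE.
Qed.

Lemma hker_hol u : hol x0 rho (fun z => hker z u).
Proof. exact: hol_G. Qed.

(** By [hkerP], pairing with the derivatives of [G] at [u] along the rows of [V] gives the
    coordinates of [y] up to a common factor. These [p] functionals are independent because the
    factor is nonzero on an open set around [y1], so [functional_span] applies. *)
Lemma hker_functional (yu y1 : 'rV[K]_p) (w' : 'rV[K]_n') :
  D (yu *m X) -> D (y1 *m X) -> hker (y1 *m X) (yu *m X) != 0 ->
  exists la : 'cV[K]_p, forall y : 'rV[K]_p, D (y *m X) ->
    Q' (G (y *m X)) w' * Q (y *m X) v0 = (y *m la) ord0 ord0 * hker (y *m X) (yu *m X).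
Proof.
move=> ud x1d k1; set u := yu *m X.
pose S := [set x | D x /\ exists y : 'rV[K]_p, x = y *m X].
have [|N [GN NS Nr]] := @null_span_rank S.
  by move=> x w [xd [y xE]] [wd [y' wE]]; apply: Go => //; rewrite xE wE frame_null.
pose Om : 'M[K]_(p, n') := \matrix_i 'D_(row i V) G u.
have key (y : 'rV[K]_p) (c : 'cV[K]_p) : D (y *m X) ->
   (G (y *m X) *m J' *m adj Om *m c) ord0 ord0 * Q (y *m X) v0 =
   (y *m c) ord0 ord0 * hker (y *m X) u.
  move=> xd; rewrite mxE [(y *m c) _ _]mxE !mulr_suml; apply: eq_bigr => i _.
  rewrite hf_row rowK row_id mulrAC hkerP//; last exact: frame_null.
  by rewrite frame_row mulrAC.
have ind (c : 'cV[K]_p) : N *m J' *m adj Om *m c = 0 -> c = 0.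
  move=> Nc.
  have yc (y : 'rV[K]_p) : D (y *m X) -> hker (y *m X) u != 0 -> (y *m c) ord0 ord0 = 0.
    move=> xd kx; have /submxP[a aN] : (G (y *m X) <= N)%MS by apply: GN; split => //; exists y.
    have E : G (y *m X) *m J' *m adj Om *m c = a *m (N *m J' *m adj Om *m c).
      by rewrite aN !mulmxA.
    have := key y c xd; rewrite E Nc mulmx0 mxE mul0r => /esym/eqP.
    by rewrite mulf_eq0 (negbTE kx) orbF => /eqP.
  apply/colP => i; rewrite [RHS]mxE.
  pose e : 'rV[K]_p := delta_mx ord0 i.
  have [d d0 hd] := hol_line_neq0 rho0 (e *m X) (@hker_hol u) x1d k1.
  have d2 : 0 < d / 2 by rewrite divr_gt0.
  have td : `|d / 2| < d by rewrite gtr0_norm// ltr_pdivrMr// ltr_pMr// ltr1n.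
  have [xd' kx'] := hd _ td.
  rewrite scalemxAl -mulmxDl in xd' kx'.
  have := yc _ xd' kx'; rewrite mulmxDl mxE yc// add0r -scalemxAl mxE.
  move/eqP; rewrite mulf_eq0 (gt_eqF d2)/= => /eqP.
  by rewrite /e -rowE mxE.
have [la laE] := functional_span Nr ind (adj w').
exists la => y xd; rewrite -key//; congr (_ * _).
have /submxP[a aN] : (G (y *m X) <= N)%MS by apply: GN; split => //; exists y.
have E b : G (y *m X) *m J' *m b = a *m (N *m J' *m b) by rewrite aN !mulmxA.
by rewrite hf_mx E laE -(mulmxA (_ *m J')) (mulmxA _ (adj Om)) E !mulmxA.
Qed.

End IsotropicFrame.

(** The vector [x - (Q x w / Q a w) *: a] is orthogonal to [w]; the bound makes it a small
    perturbation of [x] inside the same isotropic space. *)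
Lemma small_ratio (x a w1 : 'rV[K]_n) (eta : K) : Q x w1 = 0 -> Q a w1 != 0 -> 0 < eta ->
  exists2 d, 0 < d & forall w, `|w - w1| < d -> Q a w != 0 /\ `|Q x w / Q a w| < eta.
Proof.
move=> xw aw eta0.
have m0 : 0 < `|Q w1 a| by rewrite normr_gt0 hf_eq0C.
have m2 : 0 < `|Q w1 a| / 2 by rewrite divr_gt0.
have em : 0 < eta * (`|Q w1 a| / 4) by rewrite mulr_gt0// divr_gt0.
have cont b : {for w1, continuous (fun z => Q z b)}.
  by apply: differentiable_continuous; apply: (@differentiable_hf K r s n n id).
have [d1 d10 h1] := continuous_eps (cont a) m2.
have [d2 d20 h2] := continuous_eps (cont x) em.
have [d [d0 l1 l2]] := gt0_min2 d10 d20.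
exists d => // w ww; rewrite distrC in ww.
have g1 := h1 w (lt_le_trans ww l1).
have := h2 w (lt_le_trans ww l2); rewrite (hfC r s x w1) xw rmorph0 sub0r normrN => g2.
have ge : `|Q w1 a| / 2 <= `|Q w a|.
  have : `|Q w1 a| <= `|Q w1 a| / 2 + `|Q w a|.
    apply: le_trans (_ : `|Q w1 a - Q w a| + `|Q w a| <= _); last by rewrite lerD2r.
    by apply: le_trans (ler_normD _ _); rewrite subrK.
  by rewrite -lerBlDl; have -> : `|Q w1 a| - `|Q w1 a| / 2 = `|Q w1 a| / 2 by field.
have ge0 : 0 < `|Q w a| by apply: lt_le_trans ge.
split; first by rewrite hf_eq0C -normr_gt0.
rewrite (hfC _ _ w x) (hfC _ _ w a) -fmorphV -rmorphM norm_conjC normrM normfV.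
rewrite ltr_pdivrMr//; apply: le_lt_trans g2 _; rewrite ltr_pM2l//.
by apply: lt_le_trans ge; rewrite ltr_pM2l// ltf_pV2 ?posrE// ltr_nat.
Qed.

(** The kernel is antiholomorphic in its second slot, so its conjugate is the function to which
    propagation of zeros applies. *)
Lemma hol_swap x : hol x0 rho (fun w => (Q' (G x) (G w))^*).
Proof. by rewrite (_ : (fun w => _) = fun w => Q' (G w) (G x)); [exact: hol_G|apply/funext => w; rewrite -hfC]. Qed.

Lemma hol_swapQ x : hol x0 rho (fun w => (Q x w)^*).
Proof. by rewrite (_ : (fun w => _) = fun w => Q w x); [exact: hol_hf|apply/funext => w; rewrite -hfC]. Qed.

(* The functionals [<G _, G w>] on an isotropic subspace span at most [p] dimensions,
   already filled by [v |-> <_, v> hker _ u]; so [<G _, G w>] is one of these, and as it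
   vanishes on the complement of [w], its [v] is proportional to [w] there. *)
Lemma kernel_factor (X V : 'M[K]_(p, n)) (yu y1 : 'rV[K]_p) :
  X *m J *m adj X = 0 -> X *m J *m adj V = 1%:M ->
  D (yu *m X) -> D (y1 *m X) -> hker (y1 *m X) (yu *m X) != 0 ->
  forall (y y' : 'rV[K]_p) w, D (y *m X) -> D (y' *m X) -> D w ->
    Q' (G (y *m X)) (G w) * Q (y' *m X) w * (hker (y' *m X) (yu *m X) * Q (y *m X) v0) =
    Q' (G (y' *m X)) (G w) * Q (y *m X) w * (hker (y *m X) (yu *m X) * Q (y' *m X) v0).
Proof.
move=> XX XV ud x1d k1 y y' w xd x'd wd; set u := yu *m X.
have [i [v [c [_ x1v av]]]] := frame_pair XV y1.
set a := row i X in av; set x1 := y1 *m X in x1d k1 x1v.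
have [e e0 he] := indisc_line v x1d.
have e2 : 0 < e / 2 by rewrite divr_gt0.
have te : `|e / 2| < e by rewrite gtr0_norm// ltr_pdivrMr// ltr_pMr// ltr1n.
(* [w1] is orthogonal to [x1] but not to [a], so each [z] near [w1] is orthogonal to a point of the
   p-space close to [x1], where [hker] is still nonzero. *)
pose w1 := x1 + (e / 2) *: v.
have w1d : D w1 by exact: he.
have x1w1 : Q x1 w1 = 0 by rewrite hfDr hfZr x1v mulr0 addr0; exact: frame_null.
have aw1 : Q a w1 != 0.
  rewrite hfDr hfZr {1}/a rowE frame_null// add0r mulf_neq0//.
  by rewrite conjC_eq0 gt_eqF.
pose al := hker (y' *m X) u * Q (y *m X) v0.
pose be := hker (y *m X) u * Q (y' *m X) v0.
pose F z := (Q' (G (y *m X)) (G z))^* * (Q (y' *m X) z)^* * al^* -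
            (Q' (G (y' *m X)) (G z))^* * (Q (y *m X) z)^* * be^*.
have Fh : hol x0 rho F.
  apply: holB; (apply: holM; last exact: hol_cst);
  by apply: holM; [exact: hol_swap|exact: hol_swapQ].
suff : F w = 0.
  move/eqP; rewrite subr_eq0 -!rmorphM => /eqP/(can_inj (@conjCK K)).
  by [].
apply: (hol_near_id zp Fh w1d wd).
have [d d0 hd] := hol_line_neq0 rho0 a (@hker_hol u) x1d k1.
have [d1 d10 hd1] := small_ratio x1w1 aw1 d0.
have [d2 d20 hw1d] := indisc_open w1d.
have [d3 [d30 l1 l2]] := gt0_min2 d10 d20.
have d32 : 0 < d3 / 2 by rewrite divr_gt0.
apply: filterS (near_dist_le w1 d32) => z; rewrite distrC => zw1.
have {}zw1 : `|z - w1| < d3 by apply: le_lt_trans zw1 _; rewrite ltr_pdivrMr// ltr_pMr// ltr1n.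
have zw2 := lt_le_trans zw1 l2.
have [az rz] := hd1 z (lt_le_trans zw1 l1).
pose sg := - (Q x1 z / Q a z).
have sd : `|sg| < d by rewrite normrN.
have [xsd ksd] := hd _ sd.
have [la laP] := hker_functional XX XV (G z) ud x1d k1.
have aE : a = (delta_mx ord0 i : 'rV[K]_p) *m X by rewrite -rowE.
pose ys : 'rV[K]_p := y1 + sg *: delta_mx ord0 i.
have ysE : x1 + sg *: a = ys *m X by rewrite mulmxDl -scalemxAl -aE.
have ysz : Q (ys *m X) z = 0.
  by rewrite -ysE hfDl hfZl /sg mulNr divfK// subrr.
have zero (y3 : 'rV[K]_p) : D (y3 *m X) -> D z -> Q (y3 *m X) z = 0 -> hker (y3 *m X) u != 0 ->
    (y3 *m la) ord0 ord0 = 0.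
  move=> y3d zd y3z k3; have := laP y3 y3d; rewrite Go// mul0r => /esym/eqP.
  by rewrite mulf_eq0 (negbTE k3) orbF => /eqP.
have zd : D z by apply: hw1d; exact: zw2.
rewrite ysE in xsd ksd.
have ys0 := zero _ xsd zd ysz ksd.
(* [la] vanishes at [ys] and at a small displacement of it along any direction orthogonal to [z],
   hence on that direction itself. *)
have kill (e3 : 'rV[K]_p) : Q (e3 *m X) z = 0 -> (e3 *m la) ord0 ord0 = 0.
  move=> e3z; have [d4 d40 hd4] := hol_line_neq0 rho0 (e3 *m X) (@hker_hol u) xsd ksd.
  have d42 : 0 < d4 / 2 by rewrite divr_gt0.
  have t3 : `|d4 / 2| < d4 by rewrite gtr0_norm// ltr_pdivrMr// ltr_pMr// ltr1n.
  have [xd4 kd4] := hd4 _ t3; rewrite scalemxAl -mulmxDl in xd4 kd4.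
  have q3 : Q ((ys + (d4 / 2) *: e3) *m X) z = 0.
    by rewrite mulmxDl hfDl ysz add0r -scalemxAl hfZl e3z mulr0.
  have := zero _ xd4 zd q3 kd4; rewrite mulmxDl mxE ys0 add0r -scalemxAl mxE => /eqP.
  by rewrite mulf_eq0 (gt_eqF d42)/= => /eqP.
have prop : (y *m la) ord0 ord0 * Q (y' *m X) z = (y' *m la) ord0 ord0 * Q (y *m X) z.
  have := kill (Q (y' *m X) z *: y - Q (y *m X) z *: y').
  rewrite mulmxBl hfBl -!scalemxAl !hfZl mulrC subrr => /(_ erefl).
  have lin (A B : 'M[K]_1) (k l : K) : (k *: A - l *: B) ord0 ord0 = k * A ord0 ord0 - l * B ord0 ord0.
    by rewrite !mxE.
  rewrite mulmxBl -!scalemxAl lin => /eqP.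
  by rewrite subr_eq0 mulrC => /eqP ->; rewrite mulrC.
rewrite /F -!rmorphM -rmorphB (_ : _ - _ = 0) ?rmorph0// /al /be.
have e1 := laP _ xd; have e2' := laP _ x'd.
transitivity ((Q' (G (y *m X)) (G z) * Q (y *m X) v0) * Q (y' *m X) z * hker (y' *m X) u -
  (Q' (G (y' *m X)) (G z) * Q (y' *m X) v0) * Q (y *m X) z * hker (y *m X) u); first by ring.
rewrite e1 e2'; transitivity (((y *m la) ord0 ord0 * Q (y' *m X) z - (y' *m la) ord0 ord0 * Q (y *m X) z) *
  hker (y *m X) u * hker (y' *m X) u); first by ring.
by rewrite prop subrr !mul0r.
Qed.

(** Along [w = ut + t *: v0] both sides of [kernel_factor] contain the factor [t^*], because the
    p-space is isotropic. After cancelling it, the derivative at [t = 0] gives the identity. *)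
Lemma hker_rank1 (X V : 'M[K]_(p, n)) (yu y1 : 'rV[K]_p) :
  X *m J *m adj X = 0 -> X *m J *m adj V = 1%:M ->
  D (yu *m X) -> D (y1 *m X) -> hker (y1 *m X) (yu *m X) != 0 ->
  forall y y' yt : 'rV[K]_p, D (y *m X) -> D (y' *m X) -> D (yt *m X) ->
    hker (y *m X) (yt *m X) * hker (y' *m X) (yu *m X) =
    hker (y' *m X) (yt *m X) * hker (y *m X) (yu *m X).
Proof.
move=> XX XV ud x1d k1 y y' yt xd x'd td.
have kf := kernel_factor XX XV ud x1d k1.
set u := yu *m X in ud kf *; set x := y *m X in xd *; set x' := y' *m X in x'd *.
set ut := yt *m X in td *.
have xut : Q x ut = 0 by exact: frame_null.
have x'ut : Q x' ut = 0 by exact: frame_null.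
have [c1 c1E] : exists c, c = Q x' v0 * (hker x' u * Q x v0) by eexists.
have [c2 c2E] : exists c, c = Q x v0 * (hker x u * Q x' v0) by eexists.
have : Q' ('D_v0 G ut) (c1 *: G x - c2 *: G x') = 0.
  apply: dG_orth => //; have [e e0 he] := indisc_line v0 td.
  exists e => // t te; have wd := he _ te; set w := ut + t *: v0 in wd *.
  rewrite hfBr !hfZr (hfC _ _ (G x)) (hfC _ _ (G x')) -!rmorphM -rmorphB.
  rewrite (_ : _ - _ = 0) ?rmorph0//.
  have [t0|t0] := eqVneq t 0.
    by rewrite /w t0 scale0r addr0 !Go// !mulr0 subrr.
  have := kf y y' w xd x'd wd.
  have -> : Q (y' *m X) w = t^* * Q x' v0 by rewrite hfDr hfZr x'ut add0r.
  have -> : Q (y *m X) w = t^* * Q x v0 by rewrite hfDr hfZr xut add0r.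
  have t0' : t^* != 0 by rewrite conjC_eq0.
  rewrite -/x -/x' => h; apply: (mulfI t0'); rewrite mulr0.
  transitivity (Q' (G x) (G w) * (t^* * Q x' v0) * (hker x' u * Q x v0) -
    Q' (G x') (G w) * (t^* * Q x v0) * (hker x u * Q x' v0)); first by rewrite c1E c2E; ring.
  by rewrite h subrr.
rewrite hfBr !hfZr => h.
have {}h : c1 * hker x ut = c2 * hker x' ut.
  have := congr1 (@Num.conj K) h; rewrite rmorphB !rmorphM/= !conjCK rmorph0 -!hfC.
  by move=> /eqP; rewrite subr_eq0 => /eqP.
have x0' := v0P xd; have x0'' := v0P x'd.
have n0 : Q x' v0 * Q x v0 != 0 by rewrite mulf_neq0.
apply: (mulfI n0).
transitivity (c1 * hker x ut).
  by rewrite c1E; move: (hker x ut) (hker x' u) (Q x v0) (Q x' v0) => a b c d; ring.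
by rewrite h c2E; move: (hker x' ut) (hker x u) (Q x v0) (Q x' v0) => a b c d; ring.
Qed.

Lemma hker_neq0C x u : D x -> D u -> Q x u = 0 -> hker x u != 0 -> hker u x != 0.
Proof.
move=> xd ud xu k0; apply/eqP => k1; have := hkerC xd ud xu.
rewrite k1 rmorph0 mul0r => /eqP; rewrite mulf_eq0 (negbTE k0) conjC_eq0 /=.
by rewrite (negbTE (v0P ud)).
Qed.

(** The rank-one identity reads [h(u,x) h(x,u) = h(x,x) h(u,u)], and the left side is nonzero by the
    symmetry of [hker]. *)
Lemma hker_diag (X V : 'M[K]_(p, n)) (yu y1 : 'rV[K]_p) :
  X *m J *m adj X = 0 -> X *m J *m adj V = 1%:M ->
  D (yu *m X) -> D (y1 *m X) -> hker (y1 *m X) (yu *m X) != 0 ->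
  hker (yu *m X) (yu *m X) != 0.
Proof.
move=> XX XV ud x1d k1; apply/eqP => k0.
have := hker_rank1 XX XV ud x1d k1 ud x1d x1d; rewrite k0 mulr0 => h.
have k2 : hker (yu *m X) (y1 *m X) != 0.
  by apply: hker_neq0C => //; exact: frame_null.
by have := mulf_neq0 k2 k1; rewrite h eqxx.
Qed.

Lemma hker_diag_near (X V : 'M[K]_(p, n)) (yu y1 : 'rV[K]_p) :
  X *m J *m adj X = 0 -> X *m J *m adj V = 1%:M ->
  D (yu *m X) -> D (y1 *m X) -> hker (yu *m X) (yu *m X) != 0 ->
  hker (y1 *m X) (yu *m X) != 0 -> hker (y1 *m X) (y1 *m X) != 0.
Proof.
move=> XX XV ud x1d k0 k1; apply/eqP => k2.
have := hker_rank1 XX XV ud ud k0 x1d ud x1d; rewrite k2 mul0r => h.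
have k3 : hker (yu *m X) (y1 *m X) != 0.
  by apply: hker_neq0C => //; exact: frame_null.
by have := mulf_neq0 k3 k1; rewrite -h eqxx.
Qed.

Lemma frame_of k (Y : 'M[K]_(k, n)) : (k <= p)%N ->
  Y *m J *m adj Y = 0 -> row_free (Y *m J) ->
  exists X V : 'M[K]_(p, n), [/\ X *m J *m adj X = 0, X *m J *m adj V = 1%:M & (Y <= X)%MS].
Proof.
move=> kp YY Yf; have [X [XX Xf YX]] := isotropic_extend_to rsn kp pr ps YY Yf.
by have [V XV] := isotropic_dual Xf; exists X, V.
Qed.

(** The vectors [b] and [v0] separate [u] and [z] modulo the radical: [b] pairs with [z] only, and
    [v0] pairs with [u]. *)
Lemma frame_two u z b : D u -> Q u u = 0 -> Q z z = 0 -> Q u z = 0 ->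
  Q u b = 0 -> Q z b != 0 ->
  exists (X V : 'M[K]_(p, n)) (y1 y2 : 'rV[K]_p),
    [/\ X *m J *m adj X = 0, X *m J *m adj V = 1%:M, u = y1 *m X & z = y2 *m X].
Proof.
move=> ud uu zz uz ub zb.
have c1 (v w : 'rV[K]_n) : Q v w = 0 -> v *m J *m adj w = 0.
  by move=> h; apply/matrixP => i j; rewrite !ord1 -hf_mx h mxE.
have zu : Q z u = 0 by rewrite hfC uz rmorph0.
have [|||X [V [XX XV YX]]] := @frame_of (1 + 1) (col_mx u z).
- by [].
- rewrite (_ : adj (col_mx u z) = row_mx (adj u) (adj z)); last first.
    by rewrite /adj map_col_mx tr_col_mx.
  by rewrite mul_col_mx mul_col_row !c1 ?block_mx0.
- rewrite -kermx_eq0; apply/rowV0P => w /sub_kermxP.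
  rewrite -[w]hsubmxK mulmxA mul_row_col mulmxDl => h.
  set w1 := lsubmx w in h *; set w2 := rsubmx w in h *.
  have pair (c : 'rV[K]_n) : w1 ord0 ord0 * Q u c + w2 ord0 ord0 * Q z c = 0.
    have : (w1 *m u *m J + w2 *m z *m J) *m adj c = 0 by rewrite h mul0mx.
    rewrite mulmxDl => /(congr1 (fun A : 'M[K]_1 => A ord0 ord0)).
    by rewrite mxE -!hf_mx (mx11_scalar w1) (mx11_scalar w2) !mul_scalar_mx !hfZl !mxE.
  have w20 : w2 ord0 ord0 = 0.
    have := pair b; rewrite ub mulr0 add0r => /eqP.
    by rewrite mulf_eq0 (negbTE zb) orbF => /eqP.
  have w10 : w1 ord0 ord0 = 0.
    have := pair v0; rewrite w20 mul0r addr0 => /eqP.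
    by rewrite mulf_eq0 (negbTE (v0P ud)) orbF => /eqP.
  by rewrite (mx11_scalar w1) (mx11_scalar w2) w10 w20 !raddf0 row_mx0.
rewrite col_mx_sub in YX; have /andP[/submxP[y1 y1E] /submxP[y2 y2E]] := YX.
by exists X, V, y1, y2.
Qed.

Lemma frame_one u : D u -> Q u u = 0 ->
  exists (X V : 'M[K]_(p, n)) (y1 : 'rV[K]_p),
    [/\ X *m J *m adj X = 0, X *m J *m adj V = 1%:M & u = y1 *m X].
Proof.
move=> ud uu.
have [|||X [V [XX XV /submxP[y yE]]]] := @frame_of 1 u.
- exact: ltnW.
- by apply/matrixP => i j; rewrite !ord1 -hf_mx uu mxE.
- rewrite -kermx_eq0; apply/rowV0P => w /sub_kermxP; rewrite mulmxA => h.
  have : w *m u *m J *m adj v0 = 0 by rewrite h mul0mx.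
  move=> /(congr1 (fun A : 'M[K]_1 => A ord0 ord0)).
  rewrite -hf_mx (mx11_scalar w) mul_scalar_mx hfZl [RHS]mxE => /eqP.
  by rewrite mulf_eq0 (negbTE (v0P ud)) orbF => /eqP ->; rewrite raddf0.
by exists X, V, y.
Qed.

(** Adding a multiple of the null vector [a] to the [v] of [frame_pair] makes it null; orthogonality
    to [y0 *m X] survives because [a] lies in the same isotropic space. *)
Lemma frame_partner (X V : 'M[K]_(p, n)) (y0 : 'rV[K]_p) :
  X *m J *m adj X = 0 -> X *m J *m adj V = 1%:M ->
  exists (i : 'I_p) (b : 'rV[K]_n),
    [/\ Q b b = 0, Q (y0 *m X) b = 0 & Q (row i X) b != 0].
Proof.
move=> XX XV; have [i [v [c [_ yv av]]]] := frame_pair XV y0.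
set a := row i X in av; have aa : Q a a = 0 by rewrite /a rowE frame_null.
have va : Q v a != 0 by rewrite hf_eq0C.
pose t : K := (- Q v v / (2 * Q v a))^*.
exists i, (v + t *: a); split.
- rewrite hf_line aa mulr0 addr0 /t conjCK.
  have -> : (- Q v v / (2 * Q v a))^* * (Q v a)^* = - Q v v / 2.
    rewrite -rmorphM/=; have -> : - Q v v / (2 * Q v a) * Q v a = - Q v v / 2 by field.
    apply/CrealP; rewrite rpredM// ?rpredN ?hf_real// rpredV realn//.
  by field.
- by rewrite hfDr hfZr yv /a rowE frame_null// mulr0 addr0.
- by rewrite hfDr hfZr aa mulr0 addr0.
Qed.

Lemma hol_mul_eq0 f g a : hol x0 rho f -> hol x0 rho g -> D a -> g a != 0 ->
  (forall z, D z -> f z * g z = 0) -> forall z, D z -> f z = 0.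
Proof.
move=> fh gh ad ga fg z zd; apply: (hol_near_id zp fh ad zd).
have [e e0 he] := hol_open_neq0 rho0 gh ad ga.
have e2 : 0 < e / 2 by rewrite divr_gt0.
apply: filterS (near_dist_le a e2) => b; rewrite distrC => ab.
have [bd gb] : D b /\ g b != 0.
  by apply: he; apply: le_lt_trans ab _; rewrite ltr_pdivrMr// ltr_pMr// ltr1n.
by have := fg _ bd => /eqP; rewrite mulf_eq0 (negbTE gb) orbF => /eqP.
Qed.

Lemma half_norm_lt (e : K) : 0 < e -> `|e / 2| < e.
Proof. by move=> e0; rewrite gtr0_norm ?divr_gt0// ltr_pdivrMr// ltr_pMr// ltr1n. Qed.

(* With [b] null and orthogonal to [u0], every null [x] near [u0 + d b] is orthogonal to
   some [u] close to [u0] in the frame, so another isotropic frame contains [x] and [u];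
   the two factorisations meet at [u]. Then [null_unique] removes the assumption that [x]
   is null. *)
Lemma kernel_rank1 (X V : 'M[K]_(p, n)) (y0 : 'rV[K]_p) :
  X *m J *m adj X = 0 -> X *m J *m adj V = 1%:M ->
  D (y0 *m X) -> hker (y0 *m X) (y0 *m X) != 0 ->
  forall x w w', D x -> D w -> D w' ->
    Q' (G x) (G w) * Q (y0 *m X) w * (Q' (G (y0 *m X)) (G w') * Q x w') =
    Q' (G x) (G w') * Q (y0 *m X) w' * (Q' (G (y0 *m X)) (G w) * Q x w).
Proof.
move=> XX XV u0d k00 x w w' xd wd w'd.
have [i [b [bb u0b ab]]] := frame_partner y0 XX XV.
have kf0 := kernel_factor XX XV u0d u0d k00.
have near0 := @hker_diag_near X V y0.
set u0 := y0 *m X in u0d k00 u0b kf0 *; set a := row i X in ab.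
have aE : a = (delta_mx ord0 i : 'rV[K]_p) *m X by rewrite -rowE.
have u0u0 : Q u0 u0 = 0 by exact: frame_null.
have u0a : Q u0 a = 0 by rewrite aE; exact: frame_null.
have aa : Q a a = 0 by rewrite aE; exact: frame_null.
have au0 : Q a u0 = 0 by rewrite aE; exact: frame_null.
have [e e0 he] := indisc_line b u0d.
have e2 : 0 < e / 2 by rewrite divr_gt0.
have xbd := he _ (half_norm_lt e0); set xb := u0 + (e / 2) *: b in xbd.
have xbxb : Q xb xb = 0.
  by rewrite /xb hf_line u0u0 u0b bb rmorph0 !mulr0 !addr0.
have u0xb : Q u0 xb = 0 by rewrite hfDr hfZr u0u0 u0b mulr0 addr0.
have axb : Q a xb != 0.
  by rewrite hfDr hfZr au0 add0r mulf_neq0// conjC_eq0 gt_eqF.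
have [d d0 hd] := hol_line_neq0 rho0 a (@hker_hol u0) u0d k00.
have [eta eta0 heta] := small_ratio u0xb axb d0.
pose c := Q u0 w * Q' (G u0) (G w'); pose c' := Q u0 w' * Q' (G u0) (G w).
pose F z := Q' (G z) (G w) * Q z w' * c - Q' (G z) (G w') * Q z w * c'.
have Fh : hol x0 rho F.
  by apply: holB; (apply: holM; last exact: hol_cst); (apply: holM; [exact: hol_G|exact: hol_hf]).
suff : F x = 0.
  rewrite /F /c /c' => /eqP; rewrite subr_eq0 => /eqP h.
  transitivity (Q' (G x) (G w) * Q x w' * (Q u0 w * Q' (G u0) (G w'))); first by ring.
  by rewrite h; ring.
apply: (null_unique (S := fun _ => True) (w1 := xb) (e := v0) (eta := eta) (r := r) (s := s) zp rho0 _ Fh) => //.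
  exact: v0P.
move=> z _ zd zxb zz; have [az rz] := heta z zxb.
pose sg := - (Q u0 z / Q a z).
have [ud ku] : D (u0 + sg *: a) /\ hker (u0 + sg *: a) u0 != 0 by apply: hd; rewrite normrN.
pose yu := y0 + sg *: delta_mx ord0 i.
have uE : u0 + sg *: a = yu *m X by rewrite mulmxDl -scalemxAl -aE.
rewrite uE in ud ku.
have kuu := near0 yu XX XV u0d ud k00 ku.
set u := yu *m X in uE ud ku kuu.
have uz : Q u z = 0 by rewrite -uE hfDl hfZl /sg mulNr divfK// subrr.
have uu : Q u u = 0 by exact: frame_null.
have ua : Q u a = 0 by rewrite aE; exact: frame_null.
have za : Q z a != 0 by rewrite hf_eq0C.
have [X' [V' [y1 [y2 [XX' XV' y1E y2E]]]]] := frame_two ud uu zz uz ua za.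
have kf1 : forall w, D w -> Q' (G z) (G w) * Q u w * (hker u u * Q z v0) =
    Q' (G u) (G w) * Q z w * (hker z u * Q u v0).
  move=> w0 w0d; have y1d : D (y1 *m X') by rewrite -y1E.
  have k11 : hker (y1 *m X') (y1 *m X') != 0 by rewrite -y1E.
  have := kernel_factor XX' XV' y1d y1d k11 (y := y2) (y' := y1) (w := w0).
  by rewrite -y1E -y2E; apply.
have kf2 : forall w, D w -> Q' (G u) (G w) * Q u0 w * (hker u0 u0 * Q u v0) =
    Q' (G u0) (G w) * Q u w * (hker u u0 * Q u0 v0).
  by move=> w0 w0d; exact: kf0.
pose A := hker u u * Q z v0 * hker u0 u0; pose B := hker z u * hker u u0 * Q u0 v0.
have A0 : A != 0 by exact: mulf_neq0 (mulf_neq0 kuu (v0P zd)) k00.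
(* Combining [kf1] and [kf2] eliminates the pairing of [G u] with [G w]. The common factor [Q u w]
   is then cancelled as a function that is not identically zero. *)
have kf3 : forall w, D w -> Q' (G z) (G w) * Q u0 w * A = Q' (G u0) (G w) * Q z w * B.
  have [e3 e30 he3] := indisc_line v0 ud.
  have ad3 := he3 _ (half_norm_lt e30).
  have ga3 : (Q u (u + (e3 / 2) *: v0))^* != 0.
    rewrite conjC_eq0 hfDr hfZr uu add0r mulf_neq0 ?conjC_eq0 ?v0P//.
    by rewrite gt_eqF// divr_gt0.
  pose F3 w := (Q' (G z) (G w))^* * (Q u0 w)^* * A^* - (Q' (G u0) (G w))^* * (Q z w)^* * B^*.
  have F3h : hol x0 rho F3.
    by apply: holB; (apply: holM; last exact: hol_cst); (apply: holM; [exact: hol_swap|exact: hol_swapQ]).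
  have F30 : forall w, D w -> F3 w = 0.
    apply: (hol_mul_eq0 F3h (hol_swapQ u) ad3 ga3) => w0 w0d.
    rewrite /F3 -!rmorphM -rmorphB -rmorphM (_ : _ * _ = 0) ?rmorph0//.
    transitivity ((Q' (G z) (G w0) * Q u w0 * (hker u u * Q z v0)) * (Q u0 w0 * hker u0 u0) -
      Q' (G u0) (G w0) * Q u w0 * (hker u u0 * Q u0 v0) * (Q z w0 * hker z u)).
      rewrite /A /B; move: (Q' (G z) (G w0)) (Q u0 w0) (Q u w0) (Q' (G u0) (G w0)) (Q z w0).
      move: (hker u u) (Q z v0) (hker u0 u0) (hker z u) (hker u u0) (Q u0 v0).
      by move=> a1 a2 a3 a4 a5 a6 a7 a8 a9 a10 a11; ring.
    rewrite (kf1 _ w0d) -(kf2 _ w0d).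
    move: (Q' (G u) (G w0)) (Q u0 w0) (Q z w0) (hker z u) (hker u0 u0) (Q u v0).
    by move=> a1 a2 a3 a4 a5 a6; ring.
  move=> w0 /F30/eqP; rewrite subr_eq0 -!rmorphM => /eqP.
  exact: (can_inj (@conjCK K)).
apply: (mulIf A0); rewrite mul0r /F /c /c'.
transitivity ((Q' (G z) (G w) * Q u0 w * A) * (Q' (G u0) (G w') * Q z w') -
  (Q' (G z) (G w') * Q u0 w' * A) * (Q' (G u0) (G w) * Q z w)); first by ring.
by rewrite !kf3//; ring.
Qed.

(** The hypothesis makes [hker w x] nonzero, but [w] need not be null. Uniqueness from null points,
    applied inside the complement of [x], yields a null [z] orthogonal to [x] with [hker z x]
    nonzero; then [x] and [z] share a frame and [hker_diag] applies. *)
Lemma nondegenerate_frame x w e : D x -> D w -> Q x x = 0 -> Q x w = 0 ->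
  Q' ('D_e G x) (G w) != 0 ->
  exists (X V : 'M[K]_(p, n)) (y0 : 'rV[K]_p),
    [/\ X *m J *m adj X = 0, X *m J *m adj V = 1%:M, D (y0 *m X) &
        hker (y0 *m X) (y0 *m X) != 0].
Proof.
move=> xd wd xx xw nz.
have wx : Q w x = 0 by rewrite hfC xw rmorph0.
have kwx : hker w x != 0.
  apply/eqP => k0; have := hkerP e wd xd wx; rewrite k0 mulr0 => /eqP.
  by rewrite mulf_eq0 (negbTE (v0P wd)) orbF hf_eq0C (negbTE nz).
have [X [V [y [XX XV yE]]]] := frame_one xd xx.
have [i [b [bb xb ab]]] := frame_partner y XX XV.
rewrite -yE in xb; set a := row i X in ab.
have aE : a = (delta_mx ord0 i : 'rV[K]_p) *m X by rewrite -rowE.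
have aa : Q a a = 0 by rewrite aE; exact: frame_null.
have ax : Q a x = 0 by rewrite aE yE; exact: frame_null.
have xa : Q x a = 0 by rewrite hfC ax rmorph0.
have [e1 e10 he1] := indisc_line a xd.
have e2 : 0 < e1 / 2 by rewrite divr_gt0.
have w1d := he1 _ (half_norm_lt e10); set w1 := x + (e1 / 2) *: a in w1d.
have w1b : Q w1 b != 0 by rewrite hfDl hfZl xb add0r mulf_neq0// gt_eqF.
have [eta eta0 heta] := hol_open_neq0 rho0 (@hol_hf K n x0 rho r s b) w1d w1b.
have [z [zx zd zw1 zz kzx]] : exists z, [/\ Q z x = 0, D z, `|z - w1| < eta, Q z z = 0 & hker z x != 0].
  apply: contrapT => none; move/eqP: kwx; apply.
  apply: (null_unique (S := fun z => Q z x = 0) (w1 := w1) (e := b) (eta := eta) (r := r) (s := s) zp rho0 _ (@hker_hol x)) => //.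
  - by move=> u v t ux vx; rewrite hfDl hfZl ux vx mulr0 addr0.
  - by rewrite hfDl hfZl xx ax mulr0 addr0.
  - by rewrite hf_line xx xa aa rmorph0 !mulr0 !addr0.
  - by rewrite hfC xb rmorph0.
  - move=> z zx zd zw zz; apply/eqP/negPn/negP => kz; apply: none; exists z; split => //.
have [_ zb] := heta z zw1.
have xz : Q x z = 0 by rewrite hfC zx rmorph0.
have [X' [V' [y1 [y2 [XX' XV' y1E y2E]]]]] := frame_two xd xx zz xz xb zb.
exists X', V', y1; split; [exact: XX'|exact: XV'|by rewrite -y1E|].
by apply: (hker_diag (y1 := y2) XX' XV'); rewrite -?y1E -?y2E.
Qed.

(** Fixing [w'] in the rank-one identity writes the kernel as [Q x w * be x * ga w]. Hermitian
    symmetry forces [be] to be a real constant [c] times the conjugate of [ga]; the modulus of [c]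
    is absorbed into [b] and its sign is [eps]. *)
Lemma local_isometry (X V : 'M[K]_(p, n)) (y0 : 'rV[K]_p) :
  X *m J *m adj X = 0 -> X *m J *m adj V = 1%:M ->
  D (y0 *m X) -> hker (y0 *m X) (y0 *m X) != 0 ->
  exists (a : 'rV[K]_n) (d : K) (b : 'rV[K]_n -> K) (eps : K),
    [/\ 0 < d, eps = 1 \/ eps = -1,
        forall z, `|z - a| < d -> D z /\ b z != 0 &
        forall z w, `|z - a| < d -> `|w - a| < d ->
          Q' (G z) (G w) = eps * b z * (b w)^* * Q z w].
Proof.
move=> XX XV u0d k00; have kr := kernel_rank1 XX XV u0d k00.
move: (y0 *m X) u0d k00 kr => u0 u0d k00 kr.
have [w' w'd nz] : exists2 w', D w' & Q' (G u0) (G w') != 0.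
  apply: contrapT => none; move: k00; rewrite /hker hf_eq0C => /eqP; apply.
  apply: dG_orth => //; have [e e0 he] := indisc_line v0 u0d.
  exists e => // t /he td; apply/eqP/negPn/negP => h; apply: none.
  by exists (u0 + t *: v0); rewrite // hf_eq0C.
have KQ x w : D x -> D w -> Q' (G x) (G w) != 0 -> Q x w != 0.
  by move=> xd wd; apply: contra => /eqP h; rewrite Go.
pose f x := Q' (G x) (G w') * Q' (G x) (G u0).
have fh : hol x0 rho f by apply: holM; exact: hol_G.
have [a0 a0d fa0] : exists2 a, D a & f a != 0.
  apply: contrapT => none; have nz' : Q' (G w') (G u0) != 0 by rewrite hf_eq0C.
  suff : Q' (G u0) (G w') = 0 by move/eqP; rewrite (negbTE nz).
  apply: (hol_mul_eq0 (@hol_G (G w')) (@hol_G (G u0)) w'd nz' _ u0d) => x xd.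
  by apply/eqP/negPn/negP => fx; apply: none; exists x.
(* A non-null centre keeps [Q x z1] nonzero for [x] near [z1], so that it can be cancelled in the
   symmetry relation. From a null [a0], a suitable step along [v0] leaves the null cone. *)
have [z1 [z1d fz1 z1z1]] : exists z1, [/\ D z1, f z1 != 0 & Q z1 z1 != 0].
  have [aa|] := eqVneq (Q a0 a0) 0; last by exists a0.
  have [e e0 he] := hol_line_neq0 rho0 ((Q a0 v0) *: v0) fh a0d fa0.
  have e2 : 0 < e / 2 by rewrite divr_gt0.
  have [zd fz] := he (e / 2) (half_norm_lt e0).
  exists (a0 + (e / 2) *: (Q a0 v0 *: v0)); split => //.
  rewrite scalerA hf_line aa v0n mulr0 addr0 add0r rmorphM/=.
  have -> : (e / 2)^* = e / 2 by apply/CrealP; exact: gtr0_real.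
  have := v0P a0d; move: (Q a0 v0) => c c0.
  have -> : e / 2 * c^* * c + e / 2 * c * c^* = e * (c * c^*) by field.
  by rewrite -normCK mulf_neq0 ?expf_neq0 ?normr_eq0// gt_eqF.
have hh : hol x0 rho (fun x => f x * Q x z1) by apply: holM => //; exact: hol_hf.
have hz1 : f z1 * Q z1 z1 != 0 by rewrite mulf_neq0.
have [d d0 hd] := hol_open_neq0 rho0 hh z1d hz1.
have hd1 x : `|x - z1| < d ->
    [/\ D x, Q' (G x) (G w') != 0, Q' (G x) (G u0) != 0 & Q x z1 != 0].
  by move=> /hd[xd]; rewrite /f !mulf_eq0 !negb_or => /andP[/andP[h1 h2] h3].
pose be x := Q' (G x) (G w') / Q x w'.
pose ga w := Q u0 w' / Q' (G u0) (G w') * (Q' (G u0) (G w) / Q u0 w).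
have be0 x : `|x - z1| < d -> be x != 0.
  by move=> /hd1[xd h1 _ _]; rewrite mulf_neq0 ?invr_neq0// KQ.
have ga0 x : `|x - z1| < d -> ga x != 0.
  move=> /hd1[xd _ h1 _]; rewrite hf_eq0C in h1.
  by rewrite !mulf_neq0 ?invr_neq0 ?KQ.
have fac x w : `|x - z1| < d -> `|w - z1| < d -> Q' (G x) (G w) = Q x w * be x * ga w.
  move=> /hd1[xd x1 x2 _] /hd1[wd w1 w2 _].
  have := kr x w w' xd wd w'd.
  rewrite hf_eq0C in w2; have q1 := KQ _ _ u0d wd w2.
  have q2 := KQ _ _ xd w'd x1; have q3 := KQ _ _ u0d w'd nz.
  rewrite /be /ga; move: (Q' (G x) (G w)) (Q' (G x) (G w')) (Q' (G u0) (G w)) (Q' (G u0) (G w')) nz x1 w2.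
  move: (Q x w) (Q x w') (Q u0 w) (Q u0 w') q1 q2 q3.
  move=> q_ qx qu qq qu0 qx0 qq0 k1 k2 k3 k4 k40 k20 k30 E.
  have D0 : qu * (k4 * qx) != 0 by rewrite !mulf_neq0.
  apply: (mulIf D0); rewrite [LHS]mulrA E.
  by field; rewrite qx0 qu0 k40.
have z1d' : `|z1 - z1| < d by rewrite subrr normr0.
have herm x : `|x - z1| < d -> be x * ga z1 = (be z1)^* * (ga x)^*.
  move=> xd; have [_ _ _ q0] := hd1 _ xd.
  have : Q' (G x) (G z1) = (Q' (G z1) (G x))^* by rewrite -hfC.
  rewrite !fac// !rmorphM/= -hfC -!mulrA => /(mulfI q0) //.
have zd0 := be0 _ z1d'; have gd0 := ga0 _ z1d'.
pose c := (be z1)^* / ga z1.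
have c0 : c != 0 by rewrite mulf_neq0 ?invr_neq0 ?conjC_eq0.
have beE x : `|x - z1| < d -> be x = c * (ga x)^*.
  by move=> /herm h; apply: (mulIf gd0); rewrite h /c; field.
have creal : c \is Num.real.
  apply/CrealP; have := beE _ z1d'.
  have h : be z1 = c^* * (ga z1)^*.
    by rewrite /c rmorphM/= conjCK fmorphV/= divfK// conjC_eq0.
  by rewrite {1}h => /mulIf; apply; rewrite conjC_eq0.
pose sq := sqrtC `|c|.
have sq0 : sq != 0 by rewrite sqrtC_eq0 normr_eq0.
have sqr : sq^* = sq by apply/CrealP; apply: ger0_real; rewrite sqrtC_ge0.
exists z1, d, (fun x => sq * (ga x)^*), (c / `|c|); split => //.
- have nc0 : `|c| != 0 by rewrite normr_eq0.
  move: creal; rewrite realE => /orP[cp|cn].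
    by left; rewrite ger0_norm// divff.
  by right; rewrite ler0_norm// invrN mulrN divff.
- move=> z zd; have [zD _ _ _] := hd1 _ zd; split => //.
  by rewrite mulf_neq0// conjC_eq0 ga0.
- move=> z w zd wd; rewrite fac// beE//.
  have -> : (sq * (ga w)^*)^* = sq * ga w by move: (ga w) => g; rewrite rmorphM/= conjCK sqr.
  have nc0 : `|c| != 0 by rewrite normr_eq0.
  have sE : sq * sq = `|c| by rewrite -expr2 sqrtCK.
  transitivity (c / `|c| * (sq * sq) * (ga z)^* * ga w * Q z w); last by ring.
  by rewrite sE divfK//; ring.
Qed.

(** * The degenerate case: flags and the Wronskian *)

Hypothesis x0n : Q x0 x0 = 0.

Lemma rank_drop k l m q (A : 'M[K]_(k, m)) (B : 'M[K]_(l, m)) (c : 'M[K]_(m, q)) :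
  (A <= B)%MS -> A *m c = 0 -> B *m c != 0 -> (\rank A < \rank B)%N.
Proof.
move=> AB Ac Bc; have [le eq] := mxrank_leqif_sup AB.
rewrite ltn_neqAle le andbT eq; apply: contra Bc => /submxP[C ->].
by rewrite -mulmxA Ac mulmx0.
Qed.

(** Controls the shift along [v0] that makes a fixed vector orthogonal to a moving point
    [x1 + t *: v]: it tends to 0 with [t]. *)
Lemma small_frac (A B C d : K) : A != 0 -> 0 < d ->
  exists2 e, 0 < e & forall t, `|t| < e -> A + t * B != 0 /\ `|t * C / (A + t * B)| < d.
Proof.
move=> A0 d0; have a0 : 0 < `|A| by rewrite normr_gt0.
have b0 : 0 < `|B| + 1 by rewrite ltr_wpDl.
have c0 : 0 < `|C| + 1 by rewrite ltr_wpDl.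
have e1 : 0 < `|A| / (2 * (`|B| + 1)) by rewrite divr_gt0// mulr_gt0.
have e2 : 0 < d * `|A| / (2 * (`|C| + 1)) by rewrite divr_gt0 ?mulr_gt0.
have [e [e0 l1 l2]] := gt0_min2 e1 e2; exists e => // t te.
have tB : `|t * B| <= `|A| / 2.
  rewrite normrM; apply: le_trans (_ : `|t| * (`|B| + 1) <= _).
    by apply: ler_wpM2l => //; rewrite lerDl.
  rewrite -ler_pdivlMr//; apply: le_trans (ltW te) _; apply: le_trans l1 _.
  by rewrite invfM mulrA.
have tC : `|t * C| < d * (`|A| / 2).
  rewrite normrM; apply: le_lt_trans (_ : `|t| * (`|C| + 1) < _).
    by apply: ler_wpM2l => //; rewrite lerDl.
  rewrite -ltr_pdivlMr//; apply: lt_le_trans te _; apply: le_trans l2 _.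
  by rewrite invfM !mulrA.
have ge : `|A| / 2 <= `|A + t * B|.
  have : `|A| <= `|A + t * B| + `|A| / 2.
    apply: le_trans (_ : `|A + t * B| + `|t * B| <= _); last by rewrite lerD2l.
    by apply: le_trans (ler_normB _ _); rewrite addrK.
  by rewrite -lerBlDr; have -> : `|A| - `|A| / 2 = `|A| / 2 by field.
have ge0 : 0 < `|A + t * B| by apply: lt_le_trans ge; rewrite divr_gt0.
split; first by rewrite -normr_gt0.
by rewrite normrM normfV ltr_pdivrMr//; apply: lt_le_trans tC _; rewrite ler_pM2l.
Qed.

(* Otherwise [<G x, G z> = 0] for every [z] near [w1] on the line from [w1] to [w],
   because such a [z] is orthogonal to a small perturbation [y' *m X] of [x]. *)
Lemma flag_step (X V : 'M[K]_(p, n)) k (E : 'M[K]_(k, p)) (y : 'rV[K]_p) w :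
  X *m J *m adj X = 0 -> X *m J *m adj V = 1%:M -> (k + 1 < p)%N ->
  D (y *m X) -> D w -> E *m X *m J *m adj w = 0 -> Q' (G (y *m X)) (G w) != 0 ->
  exists y' : 'rV[K]_p, [/\ D (y' *m X),
    exists w', [/\ D w', E *m X *m J *m adj w' = 0 & Q' (G (y' *m X)) (G w') != 0] &
    exists (y2 : 'rV[K]_p) w2, [/\ D (y2 *m X), D w2, col_mx E y' *m X *m J *m adj w2 = 0 &
      Q' (G (y2 *m X)) (G w2) != 0]].
Proof.
move=> XX XV kp xd wd Ew nz; apply: contrapT => none; move/eqP: (nz); apply.
have [u u0 uE] := exists_ker_row (col_mx E y)^T kp.
pose c := u^T; have : col_mx E y *m c = 0.
  by apply: trmx_inj; rewrite trmx_mul trmxK uE trmx0.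
rewrite mul_col_mx -[RHS](@vsubmxK _ k 1) => /eq_col_mx[]; rewrite !linear0 => Ec yc.
have [i ui] := rowV_neq0 u0.
pose v := adj c *m V; set x := y *m X in xd nz *; pose a := row i X.
have EX (z : 'rV[K]_p) : E *m X *m J *m adj (z *m X) = 0.
  by rewrite adjM -!mulmxA [X *m (_ *m _)]mulmxA [X *m J *m _]mulmxA XX mul0mx mulmx0.
have Ev : E *m X *m J *m adj v = 0.
  by rewrite adjM adjK -!mulmxA [X *m (_ *m _)]mulmxA [X *m J *m _]mulmxA XV mul1mx.
have xv : Q x v = 0 by rewrite frame_dual// yc mxE.
have av : Q a v != 0 by rewrite /a rowE frame_dual// -rowE !mxE.
have xx : Q x x = 0 by exact: frame_null.
have aE : a = (delta_mx ord0 i : 'rV[K]_p) *m X by rewrite -rowE.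
have ax : Q a x = 0 by rewrite aE; exact: frame_null.
have [e e0 he] := indisc_line v xd.
have w1d := he _ (half_norm_lt e0); set w1 := x + (e / 2) *: v in w1d.
have xw1 : Q x w1 = 0 by rewrite hfDr hfZr xx xv mulr0 addr0.
have aw1 : Q a w1 != 0.
  by rewrite hfDr hfZr ax add0r mulf_neq0// conjC_eq0 gt_eqF// divr_gt0.
have Ew1 : E *m X *m J *m adj w1 = 0.
  by rewrite adjD adjZ mulmxDr -scalemxAr EX Ev scaler0 addr0.
have [d d0 hd] := hol_line_neq0 rho0 a (@hol_G (G w)) xd nz.
have [d1 d10 hd1] := small_ratio xw1 aw1 d0.
have [d2 d20 hd2] := indisc_open w1d.
have [d3 [d30 l1 l2]] := gt0_min2 d10 d20.
suff : Q' (G w) (G x) = 0 by move=> h; rewrite hfC h rmorph0.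
apply: (hol_line_id zp rho0 (@hol_G (G x)) w1d wd).
have [e3 e30 he3] := small_line (w - w1) d30.
exists e3 => // t /he3 tw; set z := w1 + t *: (w - w1).
have zw1 : `|z - w1| < d3 by rewrite /z addrAC subrr add0r.
have zd : D z by apply: hd2; exact: lt_le_trans zw1 l2.
have [az rz] := hd1 z (lt_le_trans zw1 l1).
have Ez : E *m X *m J *m adj z = 0.
  by rewrite adjD adjZ adjD -scaleN1r adjZ mulmxDr -scalemxAr mulmxDr -scalemxAr Ew1 Ew !scaler0 addr0 scaler0 addr0.
pose sg := - (Q x z / Q a z).
have [yd nz'] : D (x + sg *: a) /\ Q' (G (x + sg *: a)) (G w) != 0 by apply: hd; rewrite normrN.
pose y' := y + sg *: delta_mx ord0 i.
have yE : x + sg *: a = y' *m X by rewrite mulmxDl -scalemxAl -aE.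
rewrite yE in yd nz'.
have y'z : Q (y' *m X) z = 0 by rewrite -yE hfDl hfZl /sg mulNr divfK// subrr.
rewrite hfC; apply/eqP; rewrite conjC_eq0; apply/negPn/negP => xz; apply: none.
exists y'; split; first exact: yd.
  by exists w; split; [exact: wd|exact: Ew|exact: nz'].
exists y, z; split; [exact: xd|exact: zd| |exact: xz].
rewrite !mul_col_mx Ez (_ : y' *m X *m J *m adj z = 0) ?col_mx0//.
by apply/matrixP => i' j'; rewrite !ord1 -hf_mx y'z mxE.
Qed.

(** Each extension of the flag by a vector [y'] strictly increases the rank of the span of the
    images: pairing with [G w'] kills the old span but not [G (y' *m X)]. The total cannot exceed
    [p], so the rank on a flag of [k] vectors is at most [k]. *)
Lemma flag_rank (X V : 'M[K]_(p, n)) d : X *m J *m adj X = 0 -> X *m J *m adj V = 1%:M ->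
  forall k (E : 'M[K]_(k, p)) (y : 'rV[K]_p) w, (k + d.+1 = p)%N ->
  D (y *m X) -> D w -> E *m X *m J *m adj w = 0 -> Q' (G (y *m X)) (G w) != 0 ->
  forall N : 'M[K]_n', (forall q (A : 'M[K]_(n', q)),
      (forall y' : 'rV[K]_p, D (y' *m X) -> (y' <= E)%MS -> G (y' *m X) *m A = 0) -> N *m A = 0) ->
  (\rank (N *m J') <= k)%N.
Proof.
move=> XX XV; elim: d => [|d IH] k E y w kd yd wd Ew nz N NE.
  pose S := [set x | D x /\ exists y' : 'rV[K]_p, x = y' *m X].
  have [|N' [GN' NS' Nr']] := @null_span_rank S.
    by move=> x z [xd [y1 xE]] [zd [y2 zE]]; apply: Go => //; rewrite xE zE frame_null.
  suff : (\rank (N *m J') < \rank (N' *m J'))%N by move: Nr' kd; clear; lia.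
  apply: (rank_drop (c := adj (G w))).
  - apply: submxMr; rewrite submxE; apply/eqP; apply: NE => y' y'd _.
    by apply/eqP; rewrite -submxE; apply: GN'; split => //; exists y'.
  - rewrite -mulmxA; apply: NE => y' y'd /submxP[C y'E]; rewrite mulmxA.
    apply/matrixP => i j; rewrite !ord1 -hf_mx Go ?mxE//.
    by rewrite hf_mx y'E -!mulmxA (mulmxA X) (mulmxA E) (mulmxA E) Ew mulmx0 mxE.
  - apply: contra nz => /eqP h; have /submxP[C GE] : (G (y *m X) <= N')%MS.
      by apply: GN'; split => //; exists y.
    by rewrite hf_mx GE -!mulmxA (mulmxA N') h mulmx0 mxE.
have kp : (k + 1 < p)%N by move: kd; clear; lia.
have [y' [y'd [w' [w'd Ew' nz']] [y2 [w2 [y2d w2d Ew2 nz2]]]]] := flag_step XX XV kp yd wd Ew nz.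
have [N' [GN' NS']] := spanning_mx [set v | exists y3 : 'rV[K]_p,
   [/\ D (y3 *m X), (y3 <= col_mx E y')%MS & v = G (y3 *m X)]].
have rkN : (\rank (N' *m J') <= k + 1)%N.
  have kd' : (k + 1 + d.+1 = p)%N by move: kd; clear; lia.
  apply: (IH _ (col_mx E y') y2 w2 kd' y2d w2d Ew2 nz2).
  by move=> q A h; apply: NS' => _ [y3 [y3d y3E ->]]; exact: h.
suff : (\rank (N *m J') < \rank (N' *m J'))%N.
  by move: rkN; clear; lia.
apply: (rank_drop (c := adj (G w'))).
- apply: submxMr; rewrite submxE; apply/eqP; apply: NE => y3 y3d y3E.
  apply/eqP; rewrite -submxE; apply: GN'; exists y3; split => //.
  by apply: submx_trans y3E _; rewrite -addsmxE addsmxSl.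
- rewrite -mulmxA; apply: NE => y3 y3d /submxP[C y3E]; rewrite mulmxA.
  apply/matrixP => i j; rewrite !ord1 -hf_mx Go ?mxE//.
  by rewrite hf_mx y3E -!mulmxA (mulmxA X) (mulmxA E) (mulmxA E) Ew' mulmx0 mxE.
- apply: contra nz' => /eqP h; have /submxP[C GE] : (G (y' *m X) <= N')%MS.
    by apply: GN'; exists y'; split => //; rewrite -addsmxE addsmxSr.
  by rewrite hf_mx GE -!mulmxA (mulmxA N') h mulmx0 mxE.
Qed.

Lemma flag_two (X V : 'M[K]_(p, n)) (y : 'rV[K]_p) w :
  X *m J *m adj X = 0 -> X *m J *m adj V = 1%:M ->
  D (y *m X) -> D w -> Q' (G (y *m X)) (G w) != 0 ->
  exists (y1 y2 : 'rV[K]_p) w1 w2 (N : 'M[K]_n'),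
    [/\ [/\ D (y1 *m X), D (y2 *m X), D w1 & D w2],
        Q' (G (y1 *m X)) (G w1) != 0, Q (y1 *m X) w2 = 0, Q' (G (y2 *m X)) (G w2) != 0 &
        (forall y' : 'rV[K]_p, D (y' *m X) -> (y' <= col_mx y1 y2)%MS -> (G (y' *m X) <= N)%MS) /\
        (\rank (N *m J') <= 2)%N].
Proof.
move=> XX XV yd wd nz.
have E0 (z : 'rV[K]_n) : (0 : 'M[K]_(0, p)) *m X *m J *m adj z = 0 by apply/matrixP => -[].
have p2' : (0 + 1 < p)%N by exact: p2.
have [y1 [y1d [w1 [w1d _ nz1]] [y2 [w2 [y2d w2d]]]]] := flag_step XX XV p2' yd wd (E0 w) nz.
rewrite !mul_col_mx -[RHS](@vsubmxK _ 0 1) => /eq_col_mx[_]; rewrite !linear0 => y1w2 nz2.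
(* For [p = 2] the flag has no room for another step, but the general bound [p] is already 2. *)
have [pp|pp] : (p = 2)%N \/ (1 + 1 < p)%N by move: p2; clear; lia.
  pose S := [set x | D x /\ exists y' : 'rV[K]_p, x = y' *m X].
  have [|N [GN NS Nr]] := @null_span_rank S.
    by move=> x z [xd [y3 xE]] [zd [y4 zE]]; apply: Go => //; rewrite xE zE frame_null.
  exists y1, y2, w1, w2, N; split => //; first by rewrite hf_mx y1w2 mxE.
  split; last by rewrite -pp.
  by move=> y' y'd _; apply: GN; split => //; exists y'.
have [y3 [y3d [w3 [w3d y1w3 nz3]] [y4 [w4 [y4d w4d E4 nz4]]]]] := flag_step XX XV pp y2d w2d y1w2 nz2.
have [N [GN NS]] := spanning_mx [set v | exists y3' : 'rV[K]_p,
   [/\ D (y3' *m X), (y3' <= col_mx y1 y3)%MS & v = G (y3' *m X)]].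
exists y1, y3, w1, w3, N; split => //; first by rewrite hf_mx y1w3 mxE.
split; first by move=> y' y'd y'E; apply: GN; exists y'.
have kd : (1 + 1 + (p - 3).+1 = p)%N by move: pp; clear; lia.
apply: (@flag_rank X V (p - 3) XX XV (1 + 1) (col_mx y1 y3) y4 w4 kd y4d w4d E4 nz4).
by move=> q A h; apply: NS => _ [y5 [y5d y5E ->]]; exact: h.
Qed.

Hypothesis deg : forall x w e, D x -> D w -> Q x x = 0 -> Q x w = 0 ->
  Q' ('D_e G x) (G w) = 0.

(* On the line through the first two vectors of the flag, every [<G _, G w>] is a
   combination of [f w1] and [f w2], and a suitable [w] gives one with a double zero at
   any prescribed small parameter. So the Wronskian of [f w1] and [f w2] vanishes and
   their quotient is constant, which is absurd. *)
Lemma degenerate_frame (X V : 'M[K]_(p, n)) (y : 'rV[K]_p) w :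
  X *m J *m adj X = 0 -> X *m J *m adj V = 1%:M ->
  D (y *m X) -> D w -> Q' (G (y *m X)) (G w) = 0.
Proof.
move=> XX XV yd wd; apply/eqP/negPn/negP => nz.
have [y1 [y2 [w1 [w2 [N [[x1d x2d w1d w2d] nz1 x1w2 nz2 [GN Nr]]]]]]] := flag_two XX XV yd wd nz.
have x1w2k : Q' (G (y1 *m X)) (G w2) = 0 by exact: Go.
have y1E : (y1 <= col_mx y1 y2)%MS by rewrite -addsmxE addsmxSl.
have y2E : (y2 <= col_mx y1 y2)%MS by rewrite -addsmxE addsmxSr.
pose Om : 'M[K]_(n', 1 + 1) := row_mx (adj (G w1)) (adj (G w2)).
have OmE (g : 'rV[K]_n') (c : 'cV[K]_(1 + 1)) :
    (g *m J' *m Om *m c) ord0 ord0 = usubmx c ord0 ord0 * Q' g (G w1) + dsubmx c ord0 ord0 * Q' g (G w2).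
  rewrite -mulmxA -{1}[c]vsubmxK mul_row_col mulmxDr mxE.
  rewrite [usubmx c]mx11_scalar [dsubmx c]mx11_scalar !mul_mx_scalar -!scalemxAr.
  by rewrite [X in X + _]mxE [X in _ + X]mxE -!hf_mx !mxE.
have ind (c : 'cV[K]_(1 + 1)) : N *m J' *m Om *m c = 0 -> c = 0.
  move=> Nc; have ev (y' : 'rV[K]_p) : D (y' *m X) -> (y' <= col_mx y1 y2)%MS ->
      usubmx c ord0 ord0 * Q' (G (y' *m X)) (G w1) + dsubmx c ord0 ord0 * Q' (G (y' *m X)) (G w2) = 0.
    move=> y'd y'E; have /submxP[C GE] := GN _ y'd y'E.
    by rewrite -OmE GE -!mulmxA (mulmxA N) (mulmxA (N *m J')) Nc mulmx0 mxE.
  have c1 : usubmx c ord0 ord0 = 0.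
    have := ev y1 x1d y1E; rewrite x1w2k mulr0 addr0 => /eqP.
    by rewrite mulf_eq0 (negbTE nz1) orbF => /eqP.
  have c2 : dsubmx c ord0 ord0 = 0.
    have := ev y2 x2d y2E; rewrite c1 mul0r add0r => /eqP.
    by rewrite mulf_eq0 (negbTE nz2) orbF => /eqP.
  by rewrite -[c]vsubmxK [usubmx c]mx11_scalar [dsubmx c]mx11_scalar c1 c2 !raddf0 col_mx0.
have comb (z : 'rV[K]_n) : exists l1 l2 : K, forall y' : 'rV[K]_p,
    D (y' *m X) -> (y' <= col_mx y1 y2)%MS ->
    Q' (G (y' *m X)) (G z) = l1 * Q' (G (y' *m X)) (G w1) + l2 * Q' (G (y' *m X)) (G w2).
  have [la laE] := @functional_span K n' n' (1 + 1) (N *m J') Om Nr ind (adj (G z)).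
  exists (usubmx la ord0 ord0), (dsubmx la ord0 ord0) => y' y'd y'E.
  have /submxP[C GE] := GN _ y'd y'E; rewrite -OmE hf_mx GE.
  have E b : C *m N *m J' *m b = C *m (N *m J' *m b) by rewrite !mulmxA.
  by rewrite E laE -[RHS]/((_ *m _ *m la) ord0 ord0) -!mulmxA (mulmxA N) !mulmxA.
set x1 := y1 *m X in x1d nz1 x1w2 x1w2k; set x2 := y2 *m X in x2d nz2.
pose v := x2 - x1.
have xtE (t : K) : x1 + t *: v = (y1 + t *: (y2 - y1)) *m X.
  by rewrite mulmxDl -scalemxAl mulmxBl.
have ytE (t : K) : ((y1 + t *: (y2 - y1))%R <= col_mx y1 y2)%MS.
  apply: (addmx_sub y1E); apply: scalemx_sub; apply: (addmx_sub y2E).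
  by rewrite eqmx_opp.
pose f (w : 'rV[K]_n) (t : K) := Q' (G (x1 + t *: v)) (G w).
pose df (w : 'rV[K]_n) (t : K) := Q' ('D_v G (x1 + t *: v)) (G w).
have fD w' t : D (x1 + t *: v) -> is_derive t 1 (f w') (df w' t).
  move=> td; have Gt := GdD td; apply: DeriveDef.
    have h : derivable (fun z => Q' (G z) (G w')) (x1 + t *: v) v.
      by apply: diff_derivable; exact: differentiable_hf.
    exact: (derivable_line h).
  by rewrite /f (derive_line (fun z => Q' (G z) (G w'))) derive_hf.
have x1x1 : Q x1 x1 = 0 by exact: frame_null.
have [d1 d10 h1] := hol_line_neq0 rho0 v (@hol_G (G w1)) x1d nz1.
have nz2' : Q' (G w2) (G x2) != 0 by rewrite hf_eq0C.
have [d2 d20 h2] := hol_line_neq0 rho0 v0 (@hol_G (G x2)) w2d nz2'.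
have [d3 d30 h3] := small_frac (Q v v0) (Q x2 w2) (v0P x1d) d20.
have [d [dd0 l1 l2]] := gt0_min2 d10 d30.
have wronskian t : `|t| < d -> f w1 t * df w2 t = f w2 t * df w1 t.
  move=> td; have [xd f1] := h1 t (lt_le_trans td l1).
  have [A0 sm] := h3 t (lt_le_trans td l2).
  set x := x1 + t *: v in xd f1.
  have xv0 : Q x v0 = Q x1 v0 + t * Q v v0 by rewrite hfDl hfZl.
  have xw2 : Q x w2 = t * Q x2 w2 by rewrite hfDl hfZl hfBl x1w2 add0r subr0.
  (* [z] is [w2] moved along [v0] until it is orthogonal to [x]. Orthogonality kills the combination
     at [t] ([e1]) and [deg] kills its derivative ([e2]); its coefficients are not both zero because
     [G z] and [G x2] are not orthogonal. *)
  pose sg := (- (t * Q x2 w2 / (Q x1 v0 + t * Q v v0)))^*.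
  have [zd nzz] : D (w2 + sg *: v0) /\ Q' (G (w2 + sg *: v0)) (G x2) != 0.
    by apply: h2; rewrite norm_conjC normrN.
  set z := w2 + sg *: v0 in zd nzz.
  have xz : Q x z = 0.
    by rewrite hfDr hfZr xw2 /sg conjCK xv0 mulNr divfK// subrr.
  have xx : Q x x = 0 by rewrite /x xtE; exact: frame_null.
  have [m1 [m2 mE]] := comb z.
  have xdX : D ((y1 + t *: (y2 - y1)) *m X) by rewrite -xtE.
  have e1 : m1 * f w1 t + m2 * f w2 t = 0.
    have := mE _ xdX (ytE t); rewrite -xtE Go// => h; exact: esym h.
  have e2 : m1 * df w1 t + m2 * df w2 t = 0.
    have : Q' ('D_v G x) (G z - m1^* *: G w1 - m2^* *: G w2) = 0.
      apply: dG_orth => //; have [e e0 he] := indisc_line v xd.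
      exists e => // tt /he; rewrite /x -addrA -scalerDl => ttd.
      rewrite !hfBr !hfZr !conjCK.
      have ttd' : D ((y1 + (t + tt) *: (y2 - y1)) *m X) by rewrite -xtE.
      have := mE _ ttd' (ytE (t + tt)); rewrite -xtE => ->.
      by rewrite addrAC addrK subrr.
    rewrite !hfBr !hfZr !conjCK deg// sub0r => /eqP.
    by rewrite -opprD oppr_eq0 => /eqP.
  have m0 : m1 != 0 \/ m2 != 0.
    have [m10|] := eqVneq m1 0; last by left.
    have [m20|] := eqVneq m2 0; last by right.
    have := mE _ x2d y2E; rewrite m10 m20 !mul0r addr0 => /eqP.
    by rewrite hf_eq0C (negbTE nzz).
  move: (f w1 t) (f w2 t) (df w1 t) (df w2 t) e1 e2 => F1 F2 D1 D2 e1 e2.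
  case: m0 => m0; apply: (mulfI m0).
    have a1 : m1 * F1 = - (m2 * F2) by apply/eqP; rewrite -addr_eq0 e1.
    have a2 : m1 * D1 = - (m2 * D2) by apply/eqP; rewrite -addr_eq0 e2.
    by rewrite mulrA a1 mulrCA a2; ring.
  have a1 : m2 * F2 = - (m1 * F1) by apply/eqP; rewrite -addr_eq0 addrC e1.
  have a2 : m2 * D2 = - (m1 * D1) by apply/eqP; rewrite -addr_eq0 addrC e2.
  by rewrite mulrCA a2 mulrA a1; ring.
pose g (t : K) : K := f w2 t * (f w1 t)^-1.
have gd (t : K) : `|t| < d -> is_derive t 1 g 0.
  move=> td; have [xd f1] := h1 t (lt_le_trans td l1).
  have [fd1 fv1] := fD w1 t xd; have [fd2 fv2] := fD w2 t xd.
  apply: DeriveDef; first by apply: derivableM => //; apply: (@derivableV K K (f w1)).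
  have fV := @derivableV K K (f w1) t 1 f1 fd1.
  rewrite (@deriveM K K (f w2) _ t 1 fd2 fV) (@deriveV K K (f w1) t 1 f1 fd1) fv1 fv2.
  rewrite -![_ *: _]/(_ * _).
  have := wronskian t td; move: (df w1 t) (df w2 t) f1 => D1 D2.
  rewrite -[Q' _ _]/(f w1 t); move: (f w1 t) (f w2 t) => F1 F2 F10 W.
  have -> : F2 * (- F1 ^- 2 * D1) + F1^-1 * D2 = (F1 * D2 - F2 * D1) / F1 ^+ 2.
    by field.
  by rewrite W subrr mul0r.
(* The constant quotient is 0 because [x1] is orthogonal to [w2]; so [f w2] vanishes near 0 and, by
   propagation along the line, at [x2], against [nz2]. *)
have g0 : g 0 = 0 by rewrite /g /f scale0r addr0 x1w2k mul0r.
have d8 : 0 < d / 8 by rewrite divr_gt0.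
move/eqP: nz2; apply; apply: (hol_line_id zp rho0 (@hol_G (G w2)) x1d x2d).
exists (d / 8) => // t td; have := derive0_const zp gd td; rewrite g0 => /eqP.
have td' : `|t| < d by apply: lt_le_trans td _; rewrite ler_pdivrMr// ler_peMr ?ler1n// ltW.
have [_ f1] := h1 t (lt_le_trans td' l1).
by rewrite mulf_eq0 invr_eq0 (negbTE f1) orbF => /eqP.
Qed.

(** Every null point of the ball lies in a frame, where the kernel vanishes; uniqueness from null
    points around [x0] covers the others. *)
Lemma degenerate_zero x w : D x -> D w -> Q' (G x) (G w) = 0.
Proof.
move=> xd wd; have x0d : D x0 by rewrite /indisc subrr normr0.
apply: (null_unique (r := r) (s := s) (S := fun _ => True) (w1 := x0) (e := v0) (eta := 1) zp rho0 _ (@hol_G (G w))) => //.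
  exact: v0P.
move=> z _ zd _ zz; have [X [V [y [XX XV zE]]]] := frame_one zd zz.
by rewrite zE; apply: (degenerate_frame XX XV) => //; rewrite -zE.
Qed.

End LocalMap.

(** * Linear models and extension to the whole domain *)

Section Models.
Context {K : numClosedFieldType}.

Lemma adj_sgn r s n : adj (sgn_mx r s n) = sgn_mx r s n :> 'M[K]_n.
Proof.
apply/matrixP => i j; rewrite !mxE; have [->|ij] := eqVneq i j; last first.
  by rewrite !mulr0n rmorph0.
rewrite !mulr1n; case: ifP => _; first by rewrite rmorph1.
by case: ifP => _; rewrite ?rmorphN ?rmorph1 ?rmorph0.
Qed.

(** Equivalently, [J *m J] is the coordinate projection along the radical and fixes [J]. *)
Lemma sgn_mx_cube r s n :
  sgn_mx r s n *m sgn_mx r s n *m sgn_mx r s n = sgn_mx r s n :> 'M[K]_n.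
Proof.
rewrite /sgn_mx !mulmx_diag; congr diag_mx; apply/rowP => j; rewrite !mxE.
by case: ifP => _; [ring|case: ifP => _; ring].
Qed.

Lemma sgn_mx_unit r s n : n = (r + s)%N -> sgn_mx r s n \in @unitmx K n.
Proof.
move=> ->; rewrite unitmxE det_diag unitfE; apply/prodf_neq0 => j _; rewrite !mxE.
by rewrite ltn_ord; case: ifP => _; rewrite ?oppr_eq0 oner_neq0.
Qed.

(** The rows [a + t *: delta_mx ord0 j] are independent as soon as [t] and the coordinate sum of [a]
    plus [t] are nonzero; of two distinct small values of [t], one satisfies this. *)
Lemma basis_near n (a : 'rV[K]_n) (d : K) : 0 < d ->
  exists2 Z : 'M[K]_n, Z \in unitmx & forall i, `|row i Z - a| < d.
Proof.
move=> d0.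
have small : exists2 t, t != 0 & \sum_j a ord0 j + t != 0 /\ forall j, `|t *: (delta_mx ord0 j : 'rV[K]_n)| < d.
  pose C := \sum_(j < n) `|delta_mx ord0 j : 'rV[K]_n| + 1.
  have C0 : 0 < C by rewrite ltr_wpDl// sumr_ge0.
  pose e := d / C; have e0 : 0 < e by rewrite divr_gt0.
  have h (t : K) : `|t| < e -> forall j, `|t *: (delta_mx ord0 j : 'rV[K]_n)| < d.
    rewrite ltr_pdivlMr// => te j; rewrite normrZ; apply: le_lt_trans te.
    apply: ler_wpM2l => //; rewrite /C (bigD1 j)//= -addrA lerDl.
    by rewrite addr_ge0// sumr_ge0.
  have t1 : `|e / 2| < e by exact: half_norm_lt.
  have t2 : `|e / 2 / 2| < e.
    apply: lt_trans t1; rewrite normrM [ltRHS]ger0_norm; last by rewrite divr_ge0// ltW.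
    rewrite ger0_norm ?divr_ge0// ?ltW//  ger0_norm ?invr_ge0//.
    by rewrite ltr_pdivrMr ?ltr_pMr ?divr_gt0// ltr1n.
  have [s0|s1] := eqVneq (\sum_j a ord0 j + e / 2) 0; last first.
    by exists (e / 2); [rewrite gt_eqF// divr_gt0|split => //; exact: h].
  exists (e / 2 / 2); first by rewrite gt_eqF// !divr_gt0.
  split; last exact: h.
  have -> : \sum_j a ord0 j + e / 2 / 2 = (\sum_j a ord0 j + e / 2) - e / 2 / 2 by field.
  by rewrite s0 sub0r oppr_eq0 gt_eqF// !divr_gt0.
have [t t0 [st td]] := small.
exists (\matrix_i (a + t *: (delta_mx ord0 i : 'rV[K]_n))); last first.
  by move=> i; rewrite rowK addrAC subrr add0r.
rewrite -row_free_unit; apply: inj_row_free => u uZ.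
have uE : (\sum_j u ord0 j) *: a + t *: u = 0.
  rewrite -[RHS]uZ; apply/rowP => j; rewrite [LHS]mxE [X in X + _]mxE [X in _ + X]mxE [RHS]mxE.
  under [RHS]eq_bigr => i _ do rewrite !mxE mulrDr.
  rewrite big_split/= mulr_suml; congr (_ + _).
  rewrite (bigD1 j)//= ?eqxx mulr1 big1 ?addr0 1?mulrC// => i ij.
  by rewrite [j == i]eq_sym (negbTE ij) ?andbF !mulr0.
have su : \sum_j u ord0 j = 0.
  have : (\sum_j u ord0 j) * (\sum_j a ord0 j + t) = 0.
    rewrite mulrDr mulr_sumr [_ * t]mulrC mulr_sumr -big_split/= big1// => j _.
    by have := congr1 (fun M : 'rV[K]_n => M ord0 j) uE; rewrite !mxE.
  by move/eqP; rewrite mulf_eq0 (negbTE st) orbF => /eqP.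
move: uE; rewrite su scale0r add0r => /eqP; rewrite scaler_eq0 (negbTE t0) => /eqP //.
Qed.

Section LinearModel.
Variables (r s n r' s' n' : nat).
Local Notation J := (sgn_mx r s n).
Local Notation J' := (sgn_mx r' s' n').

(** [L0] is the linear map agreeing with [g] on the basis [Z]. Pairing with its image is linear in
    [z] by hypothesis, which makes each defect [g z - z *m L] orthogonal to the image of [L], and
    then the defects orthogonal to one another. *)
Lemma linear_model (S : set 'rV[K]_n) (g : 'rV[K]_n -> 'rV[K]_n') (eps : K) (Z : 'M[K]_n) :
  eps^* = eps -> Z \in unitmx -> (forall i, S (row i Z)) ->
  (forall z w, S z -> S w -> hf r' s' (g z) (g w) = eps * hf r s z w) ->
  exists (L : 'M[K]_(n, n')) (H : 'M[K]_n'),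
    [/\ L *m J' *m adj L = eps *: J, forall u : 'rV[K]_n, u *m J = 0 -> u *m L = 0,
        H *m J' *m adj H = 0, H *m J' *m adj L = 0 &
        forall z, S z -> (g z - z *m L <= H)%MS].
Proof.
move=> er Zu SZ gS; pose Gm := \matrix_i g (row i Z); pose L0 := invmx Z *m Gm.
have cube k (M : 'M[K]_(k, n)) : M *m J *m J *m J = M *m J.
  by rewrite -2!mulmxA [J *m (J *m J)]mulmxA sgn_mx_cube.
have ZZ : adj Z *m adj (invmx Z) = 1%:M by rewrite -adjM mulVmx// adj1.
have gG w : S w -> g w *m J' *m adj Gm = eps *: (w *m J *m adj Z).
  move=> Sw; apply/matrixP => i j; rewrite hf_row [RHS]mxE hf_row !ord1 !row_id rowK.
  exact: gS.
have gL0 w : S w -> g w *m J' *m adj L0 = eps *: (w *m J).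
  by move=> Sw; rewrite adjM mulmxA gG// -scalemxAl -mulmxA ZZ mulmx1.
have L0L0 : L0 *m J' *m adj L0 = eps *: J.
  have GG : Gm *m J' *m adj L0 = eps *: (Z *m J).
    apply/row_matrixP => i; rewrite !row_mul rowK gL0//.
    by rewrite linearZ/= row_mul.
  by rewrite -2!mulmxA (mulmxA Gm) GG -scalemxAr mulKmx.
(* Precomposition with the projection along the radical makes [L] kill the radical without changing
   any pairing. *)
pose L := J *m J *m L0.
have adjL : adj L = adj L0 *m J *m J by rewrite !adjM !adj_sgn mulmxA.
have gL w : S w -> g w *m J' *m adj L = eps *: (w *m J).
  by move=> Sw; rewrite adjL !mulmxA gL0// -!scalemxAl cube.
have LL : L *m J' *m adj L = eps *: J.
  have -> : L *m J' *m adj L = J *m J *m (L0 *m J' *m adj L0) *m J *m J.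
    by rewrite adjL /L !mulmxA.
  by rewrite L0L0 -scalemxAr -!scalemxAl cube sgn_mx_cube.
have nuL z : S z -> (g z - z *m L) *m J' *m adj L = 0.
  move=> Sz; rewrite !mulmxBl gL//.
  have -> : z *m L *m J' *m adj L = z *m (L *m J' *m adj L) by rewrite !mulmxA.
  by rewrite LL -scalemxAr subrr.
have nuLr z w : S z -> hf r' s' (g z - z *m L) (w *m L) = 0.
  by move=> Sz; rewrite hf_mx adjM mulmxA nuL// mul0mx mxE.
have [|H [nuH HS HH]] := @spanning_isotropic K r' s' n' [set v | exists2 z, S z & v = g z - z *m L].
  move=> _ _ [z Sz ->] [w Sw ->]; rewrite hfBr nuLr// subr0 hfBl gS//.
  have -> : hf r' s' (z *m L) (g w) = eps * hf r s z w.
    rewrite hfC hf_mx adjM mulmxA gL// -scalemxAl mxE -hf_mx rmorphM/= er.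
    by rewrite -hfC.
  by rewrite subrr.
exists L, H; split => //.
- by move=> u uJ; rewrite /L !mulmxA uJ !mul0mx.
- rewrite -mulmxA; apply: HS => _ [z Sz ->]; by rewrite mulmxA nuL.
- by move=> z Sz; apply: nuH; exists z.
Qed.
End LinearModel.
End Models.

(** * Analytic continuation over the domain and the dichotomy *)

Section Alternative.
Context {K : numClosedFieldType}.
Hypothesis zp : zero_propagation K.

Lemma differentiable_mul_coord n m k (g : 'rV[K]_n -> 'rV[K]_m) (M : 'M[K]_(m, k)) z j :
  differentiable g z -> differentiable (fun w => (g w *m M) ord0 j) z.
Proof.
move=> gz; rewrite (_ : (fun w => _) = (fun w => hf m 0 (g w) (adj (col j M)))); last first.
  apply/funext => w; rewrite mxE; apply: eq_bigr => i _.
  by rewrite ltn_ord mul1r !mxE conjCK.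
exact: differentiable_hf.
Qed.

Section Global.
Variables (r s n r' s' n' p : nat).
Local Notation Q := (hf r s).
Local Notation Q' := (hf r' s').
Local Notation J := (sgn_mx r s n).
Local Notation J' := (sgn_mx r' s' n').
Variables (U : set 'rV[K]_n) (F : 'rV[K]_n -> 'rV[K]_n').
Hypothesis Uc : connected U.
Hypothesis lift : forall z, U z -> exists (V : set 'rV[K]_n) (G : 'rV[K]_n -> 'rV[K]_n'),
  [/\ open V, V z, V `<=` U, forall w, V w -> differentiable G w &
      forall w, V w -> exists2 mu, mu != 0 & F w = mu *: G w].
Hypothesis Fo : forall z w, U z -> U w -> Q z w = 0 -> Q' (F z) (F w) = 0.

(** Homogeneity of [Phi] in its first argument makes the condition independent of the
    representative, so it can be tested on the local holomorphic lifts. *)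
Lemma global_vanish (Phi : 'rV[K]_n' -> 'rV[K]_n -> K) :
  (forall c v z, Phi (c *: v) z = c * Phi v z) ->
  (forall (G : 'rV[K]_n -> 'rV[K]_n') z, differentiable G z ->
     differentiable (fun w => Phi (G w) w) z) ->
  (exists2 z, U z & \near z, Phi (F z) z = 0) -> forall z, U z -> Phi (F z) z = 0.
Proof.
move=> PhiZ Phid base; apply: (connected_propagation Uc _ base) => z Uz.
have [V [G [Vo Vz VU Gd FG]]] := lift Uz.
have [e /= e0 he] := (@nbhs_ballP _ _ _ _).1 (open_nbhs_nbhs (conj Vo Vz)).
exists (e / 32); first by rewrite divr_gt0.
have r16 (w : 'rV[K]_n) : `|w - z| < 16 * (e / 32) -> V w.
  move=> wz; apply: he; rewrite -ball_normE /= distrC; apply: lt_trans wz _.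
  have -> : 16 * (e / 32) = e / 2 by field.
  by rewrite ltr_pdivrMr// ltr_pMr// ltr1n.
have rV (w : 'rV[K]_n) : ball z (e / 32) w -> `|w - z| < e / 32.
  by rewrite -ball_normE /= distrC.
move=> a /rV az Ua Pa b /rV bz.
have sub x : `|x - z| < e / 32 -> V x.
  by move=> xz; apply: r16; apply: lt_trans xz _; rewrite ltr_pMl ?divr_gt0// ltr1n.
have [mu _ ->] := FG b (sub _ bz).
rewrite PhiZ (_ : Phi (G b) b = 0) ?mulr0//.
apply: (zero_prop_ball zp (f := fun w => Phi (G w) w) _ az bz).
  by move=> x v xz; apply: diff_derivable; apply: Phid; apply: Gd; exact: r16.
have Vn : nbhs a V by apply: open_nbhs_nbhs; split => //; exact: sub.
apply: filterS2 Vn Pa => x Vx; have [nu nu0 ->] := FG x Vx.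
by rewrite PhiZ => /eqP; rewrite mulf_eq0 (negbTE nu0) => /eqP.
Qed.

(** The given null point may lie in the radical. A small multiple of a null vector outside the
    radical moves it off, and it remains null because radical vectors are orthogonal to
    everything. *)
Lemma null_point_off_radical : (2 <= r)%N -> (2 <= s)%N -> (r + s <= n)%N -> open U ->
  (exists2 z, U z & Q z z = 0) -> exists x, [/\ U x, Q x x = 0 & x *m J != 0].
Proof.
move=> r2 s2 rsn Uo [z Uz zz]; have [zJ|] := eqVneq (z *m J) 0; last by exists z.
have J0 : (0 : 'M[K]_(0, n)) *m J *m adj (0 : 'M[K]_(0, n)) = 0 by apply/matrixP => -[].
have f0 : row_free ((0 : 'M[K]_(0, n)) *m J) by rewrite /row_free mul0mx mxrank0.
have [y [yy _]] := isotropic_extend rsn (ltnW r2) (ltnW s2) J0 f0.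
move=> yf; have yJ : y *m J != 0.
  apply/eqP => y0; move: yf; rewrite mul_col_mx y0 /row_free mul0mx.
  by rewrite col_mx0 mxrank0.
have [e /= e0 he] := (@nbhs_ballP _ _ _ _).1 (open_nbhs_nbhs (conj Uo Uz)).
have [d d0 hd] := small_line y e0.
have d2 : `|d / 2| < d by exact: half_norm_lt.
exists (z + (d / 2) *: y); split.
- by apply: he; rewrite -ball_normE /= opprD addrA subrr sub0r normrN hd.
- have zy w : Q z w = 0 by rewrite hf_mx zJ mul0mx mxE.
  by rewrite hf_line zy zy yy conjC0 !mulr0 !addr0.
- rewrite mulmxDl zJ add0r -scalemxAl scaler_eq0 negb_or yJ andbT.
  by rewrite gt_eqF// divr_gt0.
Qed.

Lemma null_partner (x : 'rV[K]_n) : Q x x = 0 -> x *m J != 0 ->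
  exists2 v, Q v v = 0 & Q x v != 0.
Proof.
move=> xx /rowV_neq0[j xj]; pose e : 'rV[K]_n := delta_mx ord0 j.
have xe : Q x e != 0.
  by rewrite hf_mx -[_ *m adj e]trmxK; move: xj; rewrite /adj /e map_delta_mx trmx_delta -colE !mxE.
pose c := - (Q e e / (2 * Q x e)).
exists (e + c *: x); last by rewrite hfDr hfZr xx mulr0 addr0.
have cq : c * Q x e = - (Q e e / 2) by rewrite /c; field.
have qe : (Q e e)^* = Q e e by rewrite -hfC.
have cq' : c^* * Q e x = - (Q e e / 2).
  by rewrite (hfC r s x e) -rmorphM cq rmorphN rmorphM/= qe fmorphV/= conjC_nat.
by rewrite hf_line xx mulr0 addr0 -hfC cq cq'; field.
Qed.

Lemma local_chart (x v : 'rV[K]_n) : open U -> U x -> Q x v != 0 ->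
  exists (rho : K) (G : 'rV[K]_n -> 'rV[K]_n'), [/\ 0 < rho,
    forall z, `|z - x| < 16 * rho -> [/\ U z, differentiable G z & exists2 mu, mu != 0 & F z = mu *: G z] &
    forall z, `|z - x| < rho -> Q z v != 0].
Proof.
move=> Uo Ux xv; have [V [G [Vo Vx VU Gd FG]]] := lift Ux.
have [e /= e0 he] := (@nbhs_ballP _ _ _ _).1 (open_nbhs_nbhs (conj Vo Vx)).
have x1 : indisc x 1 x by rewrite /indisc subrr normr0.
have [d d0 hd] := hol_open_neq0 ltr01 (@hol_hf K n x 1 r s v) x1 xv.
have e16 : 0 < e / 16 by rewrite divr_gt0.
have [rho [rho0 l1 l2]] := gt0_min2 e16 d0.
exists rho, G; split => // z zx; last by have [] := hd z (lt_le_trans zx l2).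
have Vz : V z.
  apply: he; rewrite -ball_normE /= distrC; apply: lt_le_trans zx _.
  by rewrite mulrC -ler_pdivlMr.
by split; [exact: VU|exact: Gd|exact: FG].
Qed.

Hypothesis p2 : (2 <= p)%N.
Hypothesis pr : (p <= r)%N.
Hypothesis ps : (p <= s)%N.
Hypothesis rsn : (r + s <= n)%N.
Hypothesis rsp : (minn r' s' <= p)%N.

(** In the second case the component [x] is only asked to be some multiple of [z *m L], possibly
    zero; the last clause provides one point where the factor is nonzero. *)
Lemma orthogonal_alternative : open U -> (exists2 z, U z & Q z z = 0) ->
  (exists2 N : 'M[K]_n', N *m J' *m adj N = 0 & forall z, U z -> (F z <= N)%MS) \/
  (exists (L : 'M[K]_(n, n')) (H : 'M[K]_n') (eps : K),
    [/\ [/\ eps = 1 \/ eps = -1, L *m J' *m adj L = eps *: J,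
          forall u : 'rV[K]_n, u *m J = 0 -> u *m L = 0,
          H *m J' *m adj H = 0 & H *m J' *m adj L = 0],
        forall z, U z -> exists x h : 'rV[K]_n', [/\ F z = x + h, (x <= L)%MS, (h <= H)%MS &
          z *m L != 0 -> exists c, x = c *: (z *m L)] &
        exists z c (h : 'rV[K]_n'), [/\ U z, z *m L != 0, c != 0, (h <= H)%MS & F z = c *: (z *m L) + h]]).
Proof.
move=> Uo exn.
have [x0 [Ux0 x0n x0J]] := null_point_off_radical (leq_trans p2 pr) (leq_trans p2 ps) rsn Uo exn.
have [v0 v0n x0v0] := null_partner x0n x0J.
have [rho [G [rho0 chart v0P]]] := local_chart Uo Ux0 x0v0.
have Gd z : `|z - x0| < 16 * rho -> differentiable G z by move=> /chart[].
have Dch z : indisc x0 rho z -> U z /\ exists2 mu, mu != 0 & F z = mu *: G z.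
  by move=> zd; have [] := chart z (indisc16 rho0 zd).
have Go z w : indisc x0 rho z -> indisc x0 rho w -> Q z w = 0 -> Q' (G z) (G w) = 0.
  move=> /Dch[Uz [mu mu0 Fz]] /Dch[Uw [nu nu0 Fw]] zw; have := Fo Uz Uw zw.
  rewrite Fz Fw hfZl hfZr => /eqP; rewrite !mulf_eq0 conjC_eq0 (negbTE mu0) (negbTE nu0).
  by move=> /eqP.
have x0d : indisc x0 rho x0 by rewrite /indisc subrr normr0.
have Dnear a : indisc x0 rho a -> \near a, indisc x0 rho a.
  move=> ad; have [e e0 he] := indisc_open ad.
  have e2 : 0 < e / 2 by rewrite divr_gt0.
  apply: filterS (near_dist_le a e2) => z; rewrite distrC => za.
  by apply: he; apply: le_lt_trans za _; rewrite ltr_pdivrMr// ltr_pMr// ltr1n.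
have [deg|ndeg] := pselect (forall x w e, indisc x0 rho x -> indisc x0 rho w ->
  Q x x = 0 -> Q x w = 0 -> Q' ('D_e G x) (G w) = 0).
  left; have G0 := degenerate_zero zp rho0 Gd Go v0n v0P p2 pr ps rsn rsp x0n deg.
  have [|N [GN _ NN]] := @spanning_isotropic K r' s' n' [set v | exists2 z, indisc x0 rho z & v = G z].
    by move=> _ _ [z zd ->] [w wd ->]; exact: G0.
  exists N => // z Uz; rewrite submxE; apply/eqP/rowP => j; rewrite [RHS]mxE.
  refine (@global_vanish (fun v _ => (v *m cokermx N) ord0 j) _ _ _ z Uz).
  - by move=> c v _; rewrite -scalemxAl mxE.
  - by move=> g y gd; exact: differentiable_mul_coord.
  exists x0 => //; apply: filterS (Dnear _ x0d) => y yd.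
  have [_ [mu _ ->]] := Dch _ yd.
  have : (G y <= N)%MS by apply: GN; exists y.
  by rewrite submxE -scalemxAl => /eqP ->; rewrite scaler0 mxE.
right; have [x [w [e [xd wd xx xw nz]]]] : exists x w e, [/\ indisc x0 rho x, indisc x0 rho w, Q x x = 0,
    Q x w = 0 & Q' ('D_e G x) (G w) != 0].
  apply: contrapT => none; apply: ndeg => x w e xd wd xx xw; apply/eqP/negPn/negP => nz.
  by apply: none; exists x, w, e.
have [X [V [y0 [XX XV yd k0]]]] := nondegenerate_frame zp rho0 Gd Go v0n v0P p2 pr ps rsn rsp xd wd xx xw nz.
have [a [d [b [eps [d0 epsE bP GG]]]]] := local_isometry zp rho0 Gd Go v0n v0P p2 pr ps rsn rsp XX XV yd k0.
have epsr : eps^* = eps by case: epsE => ->; rewrite ?rmorphN rmorph1.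
have eps2 : eps * eps = 1 by case: epsE => ->; rewrite ?mulrNN mulr1.
have [Z Zu Za] := basis_near a d0.
pose g z := (b z)^-1 *: G z.
have gS z w' : `|z - a| < d -> `|w' - a| < d -> Q' (g z) (g w') = eps * Q z w'.
  move=> zd w'd; have [_ bz] := bP _ zd; have [_ bw] := bP _ w'd.
  rewrite /g hfZl hfZr GG// fmorphV/=.
  have bw' : (b w')^* != 0 by rewrite conjC_eq0.
  move: ((b w')^*) (b z) (Q z w') bz bw' => c c' q c0 c0'.
  by field; rewrite c0 c0'.
have [L [H [LL JL HH HL nuH]]] := linear_model (S := [set z | `|z - a| < d]) epsr Zu Za gS.
have FE z : `|z - a| < d -> exists c (h : 'rV[K]_n'), [/\ c != 0, (h <= H)%MS & F z = c *: (z *m L) + h].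
  move=> zd; have [zD bz] := bP _ zd; have [_ [mu mu0 Fz]] := Dch _ zD.
  exists (mu * b z), ((mu * b z) *: (g z - z *m L)); split; first by rewrite mulf_neq0.
    by apply: scalemx_sub; exact: nuH.
  by rewrite -scalerDr addrC subrK /g scalerA mulrK ?unitfE.
have aa : `|a - a| < d by rewrite subrr normr0.
have [aD _] := bP _ aa.
have nearF (P : 'rV[K]_n -> Prop) : (forall z, `|z - a| < d -> P z) -> exists2 z, U z & \near z, P z.
  move=> h; exists a; first by have [] := Dch _ aD.
  have d2 : 0 < d / 2 by rewrite divr_gt0.
  apply: filterS (near_dist_le a d2) => z; rewrite distrC => za.
  by apply: h; apply: le_lt_trans za _; rewrite ltr_pdivrMr// ltr_pMr// ltr1n.
(* The orthogonal projection onto the image of [L]: it fixes [L] and kills [H]. *)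
pose pi := eps *: (J' *m adj L *m J *m L).
have hpi (h : 'rV[K]_n') : (h <= H)%MS -> h *m pi = 0.
  move=> /submxP[C ->]; rewrite /pi -scalemxAr !mulmxA.
  have -> : C *m H *m J' *m adj L = C *m (H *m J' *m adj L) by rewrite !mulmxA.
  by rewrite HL !(mul0mx, mulmx0) scaler0.
have JJL : J *m J *m L = L.
  apply/eqP; rewrite eq_sym -subr_eq0 -[X in X - _]mul1mx -mulmxBl; apply/eqP/row_matrixP => i.
  rewrite row_mul row0 JL// -row_mul mulmxBl mul1mx sgn_mx_cube subrr row0 //.
have Lpi : L *m pi = L.
  by rewrite /pi -scalemxAr !mulmxA LL -!scalemxAl scalerA eps2 scale1r JJL.
have F1 z : U z -> (F z <= L + H)%MS.
  move=> Uz; rewrite submxE; apply/eqP/rowP => j; rewrite [RHS]mxE.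
  refine (@global_vanish (fun v _ => (v *m cokermx (L + H)%MS) ord0 j) _ _ _ z Uz).
  - by move=> c v _; rewrite -scalemxAl mxE.
  - by move=> g' y gd; exact: differentiable_mul_coord.
  apply: nearF => y /FE[c [h [_ hH ->]]].
  have : ((c *: (y *m L) + h)%R <= L + H)%MS.
    rewrite addmx_sub ?scalemx_sub//; first exact: submx_trans (submxMl _ _) (addsmxSl _ _).
    exact: submx_trans hH (addsmxSr _ _).
  by rewrite submxE => /eqP ->; rewrite mxE.
(* Proportionality of [F z *m pi] and [z *m L] is expressed by 2 x 2 minors, which are linear in
   [F z] as [global_vanish] requires. *)
have F2 z i j : U z -> (F z *m pi) ord0 i * (z *m L) ord0 j - (F z *m pi) ord0 j * (z *m L) ord0 i = 0.
  move=> Uz; pose Phi (v : 'rV[K]_n') (z : 'rV[K]_n) :=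
    (v *m pi) ord0 i * (z *m L) ord0 j - (v *m pi) ord0 j * (z *m L) ord0 i.
  refine (@global_vanish Phi _ _ _ z Uz).
  - by move=> c v y; rewrite /Phi -scalemxAl !mxE mulrBr !mulrA.
  - move=> g' y gd; rewrite /Phi; apply: differentiableB; apply: differentiableM;
      by apply: differentiable_mul_coord => //; exact: ex_diff.
  apply: nearF => y /FE[c [h [_ hH ->]]]; rewrite /Phi mulmxDl (hpi h hH) addr0.
  rewrite -scalemxAl -[y *m L *m pi]mulmxA Lpi !mxE.
  by rewrite -mulrA -[X in _ - X]mulrA [X in c * X]mulrC subrr.
exists L, H, eps; split; first by split.
- move=> z Uz; have /sub_addsmxP[[u1 u2] /= FE'] := F1 z Uz.
  exists (u1 *m L), (u2 *m H); split; rewrite ?submxMl// => /rowV_neq0[j zj].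
  have xpi : F z *m pi = u1 *m L.
    by rewrite FE' mulmxDl (hpi _ (submxMl u2 H)) addr0 -mulmxA Lpi.
  exists ((u1 *m L) ord0 j / (z *m L) ord0 j); apply/rowP => i.
  have := F2 z i j Uz; rewrite xpi => /eqP; rewrite subr_eq0 => /eqP h.
  by apply: (mulIf zj); rewrite h [in RHS]mxE mulrAC divfK.
(* [a *m L] is nonzero, since otherwise [a] would lie in the radical, whereas it pairs nontrivially
   with [v0]. *)
have [c [h [c0 hH Fa]]] := FE a aa.
exists a, c, h; split => //; first by have [] := Dch _ aD.
apply: contra (v0P _ aD) => /eqP aL; rewrite hf_mx.
have : a *m L *m J' *m adj L = eps *: (a *m J).
  by rewrite -2!mulmxA (mulmxA L) LL -scalemxAr.
rewrite aL !mul0mx => /esym/eqP; rewrite scaler_eq0 => /orP[/eqP e0'|/eqP ->].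
  by move: eps2; rewrite e0' mul0r => /esym/eqP; rewrite oner_eq0.
by rewrite mul0mx mxE.
Qed.

End Global.
End Alternative.

(** * Orthogonal splitting of the target by the linear model *)

Section Splitting.
Context {K : numClosedFieldType}.
Variables (r s n r' s' n' : nat) (L : 'M[K]_(n, n')) (H : 'M[K]_n') (eps : K).
Local Notation Q := (hf r s).
Local Notation Q' := (hf r' s').
Local Notation J := (sgn_mx r s n).
Local Notation J' := (sgn_mx r' s' n').
Hypothesis epsE : eps = 1 \/ eps = -1.
Hypothesis LL : L *m J' *m adj L = eps *: J.
Hypothesis JL : forall u : 'rV[K]_n, u *m J = 0 -> u *m L = 0.
Hypothesis HH : H *m J' *m adj H = 0.
Hypothesis HL : H *m J' *m adj L = 0.

(** The orthogonal complement of the image of [L]. It is a true complement, although the forms may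
    be degenerate, because [L] kills the radical and scales the form by [eps]. *)
Definition orth_image := kermx (J' *m adj L).
Local Notation A := <<L>>%MS.
Local Notation B := orth_image.

Lemma eps_scale_eq0 (u : 'rV[K]_n) : eps *: u = 0 -> u = 0.
Proof.
case: epsE => ->; first by rewrite scale1r.
by rewrite scaleN1r => /eqP; rewrite oppr_eq0 => /eqP.
Qed.

Lemma hf_image (u v : 'rV[K]_n) : Q' (u *m L) (v *m L) = eps * Q u v.
Proof.
rewrite !hf_mx adjM !mulmxA -(mulmxA u) -(mulmxA u) LL -scalemxAr -scalemxAl mxE //.
Qed.

Lemma sub_orth_image k (h : 'M[K]_(k, n')) : (h <= H)%MS -> (h <= B)%MS.
Proof.
move=> /submxP[C ->]; apply/sub_kermxP.
by rewrite !mulmxA -!(mulmxA C) HL mulmx0.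
Qed.

Lemma hf_orth_image (a b : 'rV[K]_n') : (a <= A)%MS -> (b <= B)%MS -> Q' a b = 0.
Proof.
rewrite genmxE => /submxP[C ->] /sub_kermxP bB; rewrite hfC hf_mx adjM !mulmxA.
by rewrite -(mulmxA b) bB mul0mx mxE rmorph0.
Qed.

Lemma cap_orth_image : (A :&: B)%MS = 0.
Proof.
apply/eqP/rowV0P => v; rewrite sub_capmx genmxE => /andP[/submxP[u ->] /sub_kermxP].
rewrite -mulmxA [L *m (_ *m _)]mulmxA LL -scalemxAr => /eps_scale_eq0; exact: JL.
Qed.

Lemma add_orth_image : (A + B == 1%:M)%MS.
Proof.
have eps2 : eps * eps = 1 by case: epsE => ->; rewrite ?mulrNN mulr1.
pose pi := eps *: (J' *m adj L *m J *m L).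
rewrite submx1 sub1mx; rewrite -sub1mx -[X in (X <= _)%MS](subrK pi) addrC.
apply: addmx_sub_adds; first by rewrite genmxE scalemx_sub// submxMl.
apply/sub_kermxP; rewrite mulmxBl mul1mx /pi -scalemxAl.
have -> : J' *m adj L *m J *m L *m (J' *m adj L) = J' *m adj L *m J *m (L *m J' *m adj L).
  by rewrite !mulmxA.
rewrite LL -scalemxAr scalerA eps2 scale1r -!mulmxA.
have -> : adj L *m (J *m J) = adj L; last by rewrite subrr.
rewrite -{1}adj_sgn -{2}adj_sgn -!adjM; congr adj.
apply/row_matrixP => i; apply/eqP; rewrite -subr_eq0 -linearB/=; apply/eqP.
rewrite -[X in _ - X]mul1mx -mulmxBl row_mul JL// -row_mul mulmxBl mul1mx.
by rewrite sgn_mx_cube subrr row0.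
Qed.

Lemma hf_null (a b : 'rV[K]_n') : (a <= H)%MS -> (b <= H)%MS -> Q' a b = 0.
Proof.
move=> /submxP[C ->] /submxP[E ->]; rewrite hf_mx adjM !mulmxA.
have -> : C *m H *m J' *m adj H = C *m (H *m J' *m adj H) by rewrite !mulmxA.
by rewrite HH mulmx0 mul0mx mxE.
Qed.

Lemma hf_null_image (u : 'rV[K]_n) (h : 'rV[K]_n') c : (h <= H)%MS ->
  Q' (c *: (u *m L) + h) (c *: (u *m L) + h) = `|c| ^+ 2 * eps * Q u u.
Proof.
move=> hH; have hL a : Q' (c *: (a *m L)) h = 0.
  by apply: hf_orth_image; rewrite ?genmxE ?scalemx_sub ?submxMl ?sub_orth_image.
by rewrite hfDl !hfDr hL (hf_null hH hH) (hfC _ _ _ h) hL rmorph0 !addr0 hfZl hfZr hf_image normCK !mulrA.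
Qed.

(** A nonzero [h] in [H] joined to the image of an isotropic p-space gives an isotropic space of
    rank [p + 1]; as [J'] is invertible here, none of this rank is lost to a radical. *)
Lemma null_part0 p : (r + s <= n)%N -> n' = (r' + s')%N -> (p <= r)%N -> (p <= s)%N ->
  (minn r' s' <= p)%N -> H = 0.
Proof.
move=> rsn n'E pr ps rsp; apply/eqP/rowV0P => h hH; apply/eqP/negPn/negP => h0.
have [||X [XX Xf _]] := @isotropic_extend_to K r s n 0 p 0 rsn (leq0n p) pr ps.
- by apply/matrixP => -[].
- by rewrite /row_free mul0mx mxrank0.
have [V XV] := isotropic_dual Xf.
pose N := col_mx (X *m L) h.
have uN (u : 'rV[K]_(p + 1)) : u *m N = lsubmx u *m X *m L + (rsubmx u) ord0 ord0 *: h.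
  rewrite -{1}[u]hsubmxK mul_row_col mulmxA; congr (_ + _).
  by rewrite {1}[rsubmx u]mx11_scalar mul_scalar_mx.
have hB : (h <= B)%MS by exact: sub_orth_image.
have hL a : Q' (a *m L) h = 0.
  by apply: hf_orth_image => //; rewrite genmxE submxMl.
have NN : N *m J' *m adj N = 0.
  apply/matrixP => i j; rewrite hf_row !rowE !uN [RHS]mxE hfDl !hfDr !hfZl !hfZr.
  rewrite (hfC _ _ _ h) !hL (hf_null hH hH) rmorph0 !mulr0 !addr0 hf_image.
  rewrite hf_mx adjM !mulmxA; set a := lsubmx _.
  have -> : a *m X *m J *m adj X = a *m (X *m J *m adj X) by rewrite !mulmxA.
  by rewrite XX mulmx0 mul0mx mxE mulr0.
have Ju : J' \in @unitmx K n' by exact: sgn_mx_unit.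
have : row_free (N *m J').
  apply: inj_row_free => u; rewrite mulmxA => /(congr1 (fun M => M *m invmx J')).
  rewrite mulmxK// mul0mx uN => uN0.
  have u1 : lsubmx u = 0.
    apply: (row_free_inj Xf); rewrite mul0mx mulmxA; apply: eps_scale_eq0.
    have := congr1 (fun M => M *m (J' *m adj L)) uN0; rewrite mul0mx mulmxDl -scalemxAl.
    rewrite (sub_kermxP hB) scaler0 addr0 => <-.
    have -> : lsubmx u *m X *m L *m (J' *m adj L) = lsubmx u *m X *m (L *m J' *m adj L).
      by rewrite !mulmxA.
    by rewrite LL -scalemxAr.
  have u2 : rsubmx u = 0.
    move: uN0; rewrite u1 !mul0mx add0r => /eqP; rewrite scaler_eq0 (negbTE h0) orbF => /eqP c0.
    by rewrite [rsubmx u]mx11_scalar c0 raddf0.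
  by rewrite -[u]hsubmxK u1 u2 row_mx0.
rewrite /row_free => /eqP rk; have := leq_trans (isotropic_rank NN) rsp.
by rewrite rk addn1 ltnn.
Qed.

Lemma opposite_signs (c q : K) : eps = -1 ->
  (0 < q -> (0 < `|c| ^+ 2 * eps * q) = false) /\ (q < 0 -> (`|c| ^+ 2 * eps * q < 0) = false).
Proof.
move=> ->; rewrite mulrN1 mulNr oppr_gt0 oppr_lt0; split => q0.
  by rewrite le_gtF// mulr_ge0 ?exprn_ge0// ltW.
by rewrite le_gtF// mulr_ge0_le0 ?exprn_ge0// ltW.
Qed.

End Splitting.

(** * From the linear model to quasi-linear and quasi-standard maps *)

Section Conclusion.
Variables (R : realType) (r s t r' s' t' : nat).
Local Notation n := (r + s + t)%N.
Local Notation n' := (r' + s' + t')%N.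
Variables (U : set 'rV[R[i]]_n) (F : 'rV[R[i]]_n -> 'rV[R[i]]_n').

Lemma null_spaceP (N : 'M[R[i]]_n') :
  N *m sgn_mx r' s' n' *m adj N = 0 -> null_space N.
Proof. move=> NN a b aN bN; exact: (hf_null NN aN bN). Qed.

Variables (L : 'M[R[i]]_(n, n')) (H : 'M[R[i]]_n') (eps : R[i]).
Hypothesis epsE : eps = 1 \/ eps = -1.
Hypothesis LL : L *m sgn_mx r' s' n' *m adj L = eps *: sgn_mx r s n.
Hypothesis JL : forall u : 'rV[R[i]]_n, u *m sgn_mx r s n = 0 -> u *m L = 0.
Hypothesis HH : H *m sgn_mx r' s' n' *m adj H = 0.
Hypothesis HL : H *m sgn_mx r' s' n' *m adj L = 0.
Hypothesis FE : forall z, U z -> exists x h : 'rV[R[i]]_n', [/\ F z = x + h, (x <= L)%MS, (h <= H)%MS &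
  z *m L != 0 -> exists c, x = c *: (z *m L)].
Hypothesis Fa : exists z c (h : 'rV[R[i]]_n'),
  [/\ U z, z *m L != 0, c != 0, (h <= H)%MS & F z = c *: (z *m L) + h].

(** Subspaces of the target are square matrices, hence the generated space [<<L>>] instead of the
    rectangular [L]. *)
Let A : 'M[R[i]]_n' := <<L>>%MS.
Let B : 'M[R[i]]_n' := orth_image r' s' L.

Lemma same_pointZ (v w : 'rV[R[i]]_n') c : v = c *: w -> v != 0 -> same_point v w.
Proof.
by move=> vE v0; exists c; split => //; apply: contra v0 => /eqP c0; rewrite vE c0 scale0r.
Qed.

Lemma projA (x h : 'rV[R[i]]_n') : (x <= L)%MS -> (h <= H)%MS -> (x + h) *m proj_mx A B = x.
Proof.
move=> xL hH; have cap := cap_orth_image epsE LL JL.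
by rewrite mulmxDl proj_mx_id ?genmxE// proj_mx_0 ?addr0// (sub_orth_image HL).
Qed.

Lemma projB (x h : 'rV[R[i]]_n') : (x <= L)%MS -> (h <= H)%MS -> (x + h) *m proj_mx B A = h.
Proof.
move=> xL hH; have cap := cap_orth_image epsE LL JL; rewrite capmxC in cap.
by rewrite mulmxDl proj_mx_0 ?genmxE// add0r proj_mx_id// (sub_orth_image HL).
Qed.

Lemma linear_of_model : (forall z, U z -> F z *m proj_mx B A = 0) -> linear_into U F 1%:M L.
Proof.
move=> FB; split; first exact: submx1.
  by have [z [c [h [Uz zL _ _ _]]]] := Fa; exists z.
move=> z Uz zL Fz; have [x [h [FzE xL hH xE]]] := FE Uz.
have h0 : h = 0 by rewrite -(FB z Uz) FzE projB.
have [c cE] := xE zL; apply: (same_pointZ (c := c)) => //.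
by rewrite FzE h0 addr0.
Qed.

(** The point [z0] guarantees that [B] is nonzero and that the projection to [B] is defined
    somewhere, as a proper decomposition demands. *)
Lemma decomposition_of_model z0 : U z0 -> F z0 *m proj_mx B A != 0 ->
  [/\ orth_decomp A B,
      (exists z, U z /\ F z *m proj_mx A B != 0),
      (exists z, U z /\ F z *m proj_mx B A != 0),
      linear_into U (fun z => F z *m proj_mx A B) A L
    & null_into U (fun z => F z *m proj_mx B A) B].
Proof.
move=> Uz0 Fz0.
have [a [c [h [Ua aL c0 hH FaE]]]] := Fa.
have caL : (c *: (a *m L) <= L)%MS by rewrite scalemx_sub ?submxMl.
have FaA : F a *m proj_mx A B != 0 by rewrite FaE projA// scaler_eq0 negb_or c0.
split.
- split.
  + apply: contra aL => /eqP A0.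
    have : (a *m L <= A)%MS by rewrite genmxE submxMl.
    by rewrite A0 submx0.
  + apply: contra Fz0 => /eqP B0.
    by have := proj_mx_sub B A (F z0); rewrite B0 submx0.
  + exact: (add_orth_image epsE LL JL).
  + by rewrite (cap_orth_image epsE LL JL) submx_refl.
  + exact: hf_orth_image.
- by exists a.
- by exists z0.
- split; [by rewrite genmxE|by exists a|].
  move=> z Uz zL Pz; have [x [k [FzE xL kH xE]]] := FE Uz.
  have [d dE] := xE zL; apply: (same_pointZ (c := d)) => //.
  by rewrite FzE projA.
- exists H; split; [exact: (sub_orth_image HL)|exact: null_spaceP|].
  by move=> z Uz; have [x [k [-> xL kH _]]] := FE Uz; rewrite projB.
Qed.

(** The null part is isotropic and orthogonal to the image of [L], so only the linear part
    contributes; a non-null [z] has [z *m L] nonzero, so this part is a multiple of [z *m L]. *)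
Lemma herm_model z : U z -> herm z z != 0 ->
  exists c : R[i], herm (F z) (F z) = `|c| ^+ 2 * eps * herm z z.
Proof.
move=> Uz zz; have [x [h [FzE xL hH xE]]] := FE Uz.
have zL : z *m L != 0.
  apply: contra zz => /eqP zL; have := hf_image LL z z; rewrite zL hf0l => /esym/eqP.
  rewrite mulf_eq0; case: epsE => ->; by rewrite ?oppr_eq0 oner_eq0.
have [c cE] := xE zL; exists c.
by rewrite FzE cE; exact: (hf_null_image LL HH HL).
Qed.

End Conclusion.

Theorem mainTheorem6 (R : realType) (r s t r' s' t' : nat)
    (U : set 'rV[R[i]]_(r + s + t))
    (F : 'rV[R[i]]_(r + s + t) -> 'rV[R[i]]_(r' + s' + t')) :
  (2 <= r)%N -> (2 <= s)%N ->
  proj_domain U ->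
  holo_proj_map U F ->
  local_orthogonal U F ->
  (minn r' s' <= minn r s)%N ->
  [/\ is_null U F \/ is_quasi_linear U F,
      (t' = 0%N -> is_null U F \/ is_linear U F)
    & ((exists z, U z /\ 0 < herm z z /\ 0 < herm (F z) (F z)) \/
       (exists z, U z /\ herm z z < 0 /\ herm (F z) (F z) < 0)) ->
      is_quasi_standard U F /\ (t' = 0%N -> is_standard U F)].
Proof.
move=> r2 s2 [Uo Uc _ _ [z0 [Uz0 z00]]] [F0 _ lift] Fo rsp.
have p2 : (2 <= minn r s)%N by rewrite leq_min r2.
have rsn : (r + s <= r + s + t)%N by exact: leq_addr.
have lift' z : U z -> exists (V : set 'rV[R[i]]_(r + s + t)) (G : 'rV[R[i]]_(r + s + t) -> 'rV[R[i]]_(r' + s' + t')),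
  [/\ @open (cvec R (r + s + t)) V, V z, V `<=` U,
      forall w, V w -> differentiable (G : cvec R (r + s + t) -> cvec R (r' + s' + t')) (w : cvec R (r + s + t)) &
      forall w, V w -> exists2 mu, mu != 0 & F w = mu *: G w].
  move=> /lift[V [G [Vo Vz VU Gd FG]]]; exists V, G; split => // w /FG[_ [mu [mu0 FwE]]].
  by exists mu.
have exn : exists2 z, U z & hf r s z z = 0 by exists z0.
have pr := geq_minl r s; have ps := geq_minr r s.
have zp : zero_propagation R[i] := @complex_zero_propagation R.
have := orthogonal_alternative zp Uc lift' Fo p2 pr ps rsn rsp Uo exn.
case=> [[N NN FN]|[L [H [eps [[epsE LL JL HH HL] FE Fa]]]]].
  have nu : is_null U F by exists N; split; [exact: submx1|exact: null_spaceP|].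
  split; [by left|by left|].
  have FF z : U z -> herm (F z) (F z) = 0.
    by move=> Uz; apply: null_spaceP NN _ _ _ _; exact: FN.
  by case=> -[z [Uz [_]]]; rewrite FF// ltxx.
pose A : 'M[R[i]]_(r' + s' + t') := <<L>>%MS.
pose B : 'M[R[i]]_(r' + s' + t') := orth_image r' s' L.
(* If the null component vanishes throughout, its projection has no point of definition and [F] is
   itself linear; otherwise the decomposition is genuine. *)
have dich : (forall z, U z -> F z *m proj_mx B A = 0) \/ exists2 z, U z & F z *m proj_mx B A != 0.
  have [h|h] := pselect (exists2 z, U z & F z *m proj_mx B A != 0); first by right.
  by left=> z Uz; apply/eqP/negPn/negP => nz; apply: h; exists z.
have lin0 := linear_of_model epsE LL JL HL FE Fa.
have dec z := decomposition_of_model epsE LL JL HH HL FE Fa (z0 := z).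
have t0 : t' = 0%N -> linear_into U F 1%:M L.
  move=> t0; apply: lin0 => z Uz; have [x [h [-> xL hH _]]] := FE z Uz.
  rewrite (projB epsE LL JL HL xL hH).
  have H0 : H = 0 by apply: (null_part0 epsE LL HH HL rsn _ pr ps rsp); rewrite t0 addn0.
  by move: hH; rewrite H0 submx0 => /eqP.
split.
- right; case: dich => [/lin0 h|[z Uz nz]]; first by left; exists L.
  by right; exists A, B; have [d1 d2 d3 d4 d5] := dec z Uz nz; split; [exact: d1|exact: d2|exact: d3|exists L; exact: d4|exact: d5].
- by move=> /t0 h; right; exists L.
(* For [eps = -1] the squared length of [F z] is a nonpositive multiple of that of [z], so neither
   sign can be preserved. *)
move=> sgn; have eps1 : eps = 1.
  case: (epsE) => // epsN; case: sgn => -[z [Uz [zz]]].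
    have [|c ->] := herm_model epsE LL HH HL FE Uz; first by rewrite gt_eqF.
    by rewrite (opposite_signs c (herm z z) epsN).1.
  have [|c ->] := herm_model epsE LL HH HL FE Uz; first by rewrite lt_eqF.
  by rewrite (opposite_signs c (herm z z) epsN).2.
have iso : isometry_mx L by move=> u v; rewrite [LHS](hf_image LL) eps1 mul1r.
split; last by move=> /t0 h; exists L.
case: dich => [/lin0 h|[z Uz nz]]; first by left; exists L.
by right; exists A, B; have [d1 d2 d3 d4 d5] := dec z Uz nz; split; [exact: d1|exact: d2|exact: d3|by exists L; split; [exact: d4|exact: iso]|exact: d5].
Qed.
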